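(* Let $\mathcal{T}$ and $\widetilde{\mathcal{T}}$ be compact nonnegative self-adjoint operators in Hilbert spaces $\mathcal{H}$ and $\widetilde{\mathcal{H}}$ having the spectral asymptotics $$\mathcal{N}(t,\mathcal{T})\sim\frac{\varphi(1/t)\,s(\ln(1/t))}{t^{1/p}},\qquad \mathcal{N}(t,\widetilde{\mathcal{T}})\sim\frac{\widetilde\varphi(1/t)\,\widetilde s(\ln(1/t))}{t^{1/p}},\qquad t\to+0,$$ where $p>0$, $\varphi,\widetilde\varphi$ are slowly varying functions, and $s,\widetilde s$ are continuous periodic functions. Suppose that $$\int_1^\infty\varphi(\tau)\frac{d\tau}{\tau}=\int_1^\infty\widetilde\varphi(\tau)\frac{d\tau}{\tau}=\infty,$$ and that the periods of $s$ and $\widetilde s$ coincide and equal $T$. Then $$\mathcal{N}(t,\mathcal{T}\otimes\widetilde{\mathcal{T}})\sim\frac{\phi(1/t)\,s_\otimes(\ln(1/t))}{t^{1/p}},\qquad t\to+0,$$ where $\phi=\varphi\ast\widetilde\varphi$ is a slowly varying function and $$s_\otimes(\eta)=\frac{(s\star\widetilde s)(\eta)}{p}+(s\star\widetilde s)'(\eta)=e^{-\eta/p}\,\frac1T\int_0^T\varrho(\eta-\sigma)\,d\widetilde\varrho(\sigma)$$ is a continuous positive $T$-periodic function. Here $\varrho(\tau)=e^{\tau/p}s(\tau)$, $\widetilde\varrho(\tau)=e^{\tau/p}\widetilde s(\tau)$.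
   Context: For a compact nonnegative self-adjoint operator $\mathcal{T}$ in a Hilbert space, $\lambda_n=\lambda_n(\mathcal{T})$ denote its positive eigenvalues arranged in nonincreasing order and repeated according to multiplicity, and $\mathcal{N}(t,\mathcal{T})=\#\{n:\lambda_n(\mathcal{T})>t\}$ for $t>0$. The operator $\mathcal{T}\otimes\widetilde{\mathcal{T}}$ acts in the Hilbert space $\mathcal{H}\otimes\widetilde{\mathcal{H}}$. The relation $f\sim g$ means $f=g\,(1+o(1))$. A positive (measurable) function $\varphi(\tau)$, $\tau>0$, is called slowly varying if $\varphi(c\tau)/\varphi(\tau)\to1$ as $\tau\to+\infty$ for every constant $c>0$. The Mellin convolution is $(\varphi\ast\psi)(\tau)=\int_1^\tau\varphi(\sigma)\psi(\tau/\sigma)\frac{d\sigma}{\sigma}$. For $s,\widetilde s$ with common period $T$, $(s\star\widetilde s)(\eta)=\frac1T\int_0^T s(\eta-\lambda)\widetilde s(\lambda)\,d\lambda$. Standing assumptions: slowly varying functions in the spectral asymptotics are $C^2$-smooth with $\tau(\ln\varphi)'(\tau)\to0$ and $\tau^2(\ln\varphi)''(\tau)\to0$ as $\tau\to\infty$; the periodic functions $s,\widetilde s$ are continuous, positive (bounded and separated from zero), and $\varrho,\widetilde\varrho$ are monotone. The integral with respect to $d\widetilde\varrho$ is a Lebesgue--Stieltjes integral. *)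

(* Defs.v *)
From HB Require Import structures.
From mathcomp Require Import all_boot all_order all_algebra.
From mathcomp Require Import sesquilinear finmap.
From mathcomp Require Import all_classical all_reals all_analysis.
From mathcomp Require Import complex.

Set Implicit Arguments.
Unset Strict Implicit.
Unset Printing Implicit Defensive.

Import Order.TTheory GRing.Theory Num.Theory.
Import numFieldNormedType.Exports.

Local Open Scope classical_set_scope.
Local Open Scope ring_scope.

(* The scalar field of a Hilbert space over R: the axioms leave, up to
   isomorphism, only R itself and the complex numbers over R. The norm and the
   order are those of the numFieldType; in the complex case 0 <= z means that
   z is real and nonnegative. Both instances are given below. *)
Record scalars (R : realType) := Scalars {
  scalar_field :> numFieldType;
  sconj : {rmorphism scalar_field -> scalar_field};
  of_real : {rmorphism R -> scalar_field};
  of_realP : forall x : scalar_field,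
    (x \is Num.real) <-> (exists r, x = of_real r);
  sconjP : forall x : scalar_field, x * sconj x = `|x| ^+ 2
}.

Section Instances.
Variable R : realType.

Lemma real_of_realP (x : R) : (x \is Num.real) <-> (exists r, x = idfun r).
Proof. by split=> [_|_]; [exists x | exact: num_real]. Qed.

Lemma real_conjP (x : R) : x * idfun x = `|x| ^+ 2.
Proof. by rewrite real_normK ?num_real. Qed.

Definition real_scalars : scalars R :=
  @Scalars R R idfun idfun real_of_realP real_conjP.

Lemma complex_of_realP (x : R[i]) :
  (x \is Num.real) <-> (exists r, x = real_complex R r).
Proof.
split=> [xr|[r ->]]; last by rewrite complex_real.
by exists (complex.Re x); rewrite RRe_real.
Qed.

Lemma complex_conjP (x : R[i]) : x * Num.conj x = `|x| ^+ 2.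
Proof. by rewrite normCK. Qed.

Definition complex_scalars : scalars R :=
  @Scalars R R[i] Num.conj (real_complex R) complex_of_realP complex_conjP.
End Instances.

(* The inner product is linear in its first argument. *)
Record hilbert (R : realType) (K : scalars R) := Hilbert {
  hilbert_space :> completeNormedModType K;
  inner : {dot hilbert_space for sconj K};
  innerP : forall x, inner x x = `|x| ^+ 2
}.

(* A model of the Hilbert tensor product, which these axioms determine up to a
   unique isometric isomorphism compatible with the pure tensors. *)
Record hilbert_tensor (R : realType) (K : scalars R) (H1 H2 : hilbert K) :=
  HilbertTensor {
  tensor_space :> hilbert K;
  tens : {bilinear H1 -> H2 -> tensor_space};
  tens_inner : forall (x x' : H1) (y y' : H2),
    inner tensor_space (tens x y) (tens x' y') = inner H1 x x' * inner H2 y y';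
  tens_dense : dense [set z : tensor_space |
    exists n (x : 'I_n -> H1) (y : 'I_n -> H2), z = \sum_(i < n) tens (x i) (y i)]
}.

Section Operators.
Variables (R : realType) (K : scalars R).

Definition compact_operator (H : hilbert K) (A : H -> H) : Prop :=
  precompact (A @` [set x | `|x| <= 1]).

Definition nonneg_self_adjoint (H : hilbert K) (A : H -> H) : Prop :=
  (forall x y, inner H (A x) y = inner H x (A y)) /\
  (forall x, 0 <= inner H (A x) x).

Definition tensor_operator (H1 H2 : hilbert K) (H : hilbert_tensor H1 H2)
    (A1 : H1 -> H1) (A2 : H2 -> H2) (A : H -> H) : Prop :=
  continuous A /\
  (forall x y, A (tens H x y) = tens H (A1 x) (A2 y)).

Definition eigenspace (H : hilbert K) (A : H -> H) (mu : R) : set H :=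
  [set x | A x = of_real K mu *: x].

Definition has_dim (V : lmodType K) (E : set V) (m : nat) : Prop :=
  exists e : 'I_m -> V,
    [/\ forall i, E (e i),
        forall c : 'I_m -> K, \sum_i c i *: e i = 0 -> forall i, c i = 0 &
        forall x, E x -> exists c : 'I_m -> K, x = \sum_i c i *: e i].

(* Indices start at 0; when A has only finitely many positive eigenvalues the
   sequence is continued by 0. *)
Definition enumerates_eigenvalues (H : hilbert K) (A : H -> H) (lam : nat -> R)
    : Prop :=
  [/\ forall n, 0 <= lam n,
      {homo lam : m n / (m <= n)%N >-> n <= m} &
      forall mu, 0 < mu ->
        exists2 m, ([set n | lam n = mu] #= `I_m)%card & has_dim (eigenspace A mu) m].

(* At most one sequence enumerates the eigenvalues when these accumulate only
   at 0, and one exists if A is compact nonnegative self-adjoint; the null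
   sequence is used if there is none. *)
Definition eigenvalues (H : hilbert K) (A : H -> H) : nat -> R :=
  xget (fun=> 0) [set lam | enumerates_eigenvalues A lam].

Definition counting_function (H : hilbert K) (A : H -> H) (t : R) : R :=
  #|` fset_set [set n | t < eigenvalues A n]|%fset%:R.

End Operators.

Section Functions.
Variable R : realType.
Implicit Types (a p T t x y : R) (phi psi s : R -> R).

(* Slow variation at +oo of a function on ]a, +oo[; what happens outside of
   this interval is irrelevant. *)
Definition slowly_varying a phi : Prop :=
  [/\ measurable_fun `]a, +oo[ phi,
      forall x, a < x -> 0 < phi x &
      forall c, 0 < c -> phi (c * x) / phi x @[x --> +oo] --> (1 : R)].

Definition C2_log_regular phi : Prop :=
  [/\ forall x, 0 < x -> derivable phi x 1 /\ derivable (derive1 phi) x 1,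
      forall x, 0 < x -> {for x, continuous (derive1n 2 phi)},
      x * derive1 (fun y => ln (phi y)) x @[x --> +oo] --> (0 : R) &
      x ^+ 2 * derive1n 2 (fun y => ln (phi y)) x @[x --> +oo] --> (0 : R)].

Definition mellin_conv phi psi x : R :=
  \int[lebesgue_measure]_(y in `[1, x]) (phi y * psi (x / y) / y).

Definition periodic_conv T s1 s2 x : R :=
  T^-1 * \int[lebesgue_measure]_(y in `[0, T]) (s1 (x - y) * s2 y).

Definition rho p s x : R := expR (x / p) * s x.

Definition continuous_positive_periodic T s : Prop :=
  [/\ continuous s, forall x, 0 < s x & periodic s T].

Lemma rho_right_continuous p T s :
  continuous_positive_periodic T s -> right_continuous (rho p s).
Proof.
case=> cs _ _ x; apply: cvg_at_right_filter.
apply: cvgM; last exact: cs.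
apply: continuous_comp; last exact: continuous_expR.
by apply: cvgM; [exact: cvg_id | exact: cvg_cst].
Qed.

Definition rho_cumulative p T s (hs : continuous_positive_periodic T s)
    (hrho : nondecreasing (rho p s)) : cumulative R R :=
  HB.pack (rho p s)
    (isCumulative.Build R _ R (rho p s) hrho (rho_right_continuous hs)).

Definition spectral_density p phi s t : R :=
  phi t^-1 * s (ln t^-1) / t `^ p^-1.

Definition s_tensor p T s1 s2 x : R :=
  periodic_conv T s1 s2 x / p + derive1 (periodic_conv T s1 s2) x.

End Functions.

(* Main.v *)
(* The eigenvalues of the tensor product are the products of the eigenvalues of
   the factors, because the range of a compact nonnegative operator is spanned
   by its eigenvectors. In the variable x = ln(1/t) the counting function of the
   product is therefore the convolution of f1 against d f2, with
   fi(x) ~ e^(x/p) ai(x) si(x) and ai(x) = phi_i(e^x).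
   Cut the convolution into chunks [kT, (k+1)T]. Far from both ends a1(x - .)
   and a2 are nearly constant on a chunk, and by periodicity e^(-x/p) times the
   chunk is close to a1(x - kT) a2(kT) times a Riemann-Stieltjes sum of
   e^(-x/p) int_0^T rho1(x - u) d rho2(u) = T s_tensor(x), uniformly in x.
   Summing over k gives s_tensor(x) int_0^x a1(x - u) a2(u) du. The chunks near
   the ends are O(a1(x) + a2(x)), which is negligible against the integral since
   a1 and a2 have infinite integrals.
   The density s_tensor is obtained by moving the increment h of
   int_0^T rho1(x + h - u) rho2(u) du from rho1 to rho2, the integrand being
   T-periodic in u, so that no derivative of s1 or s2 is needed. *)

Require Import Defs.
From HB Require Import structures.
From mathcomp Require Import all_boot all_order all_algebra.
From mathcomp Require Import sesquilinear finmap.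
From mathcomp Require Import all_classical all_reals all_analysis.
From mathcomp Require Import ring lra.

Set Implicit Arguments.
Unset Strict Implicit.
Unset Printing Implicit Defensive.

Import Order.TTheory GRing.Theory Num.Theory.
Import numFieldNormedType.Exports.

Local Open Scope classical_set_scope.
Local Open Scope ring_scope.

(** * Hilbert spaces *)

(** Two obstacles shape the proof. The asymptotics of f2 says nothing about its increments over
    short intervals: an error o(a2(x) e^(x/p)) may exceed the increment itself. So the number of
    mesh cells per chunk is fixed first, from a bound on Stieltjes sums that is uniform in x, and
    only then is x taken so large that the errors of f1 and f2 are small against the reciprocal of
    this number. No integral against d f2 is formed: a chunk is a difference of two values of a
    counting function [G x], squeezed between two finite sums by counting pairs in rectangles. The
    error of a chunk is measured by the integral of a1(x - u) a2(u) over the same chunk, so that the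
    number of chunks does not matter. The second obstacle is that [A] is known only through its
    continuity and its values on pure tensors, and that the kernels of the factors carry no
    eigenbasis. Both are bypassed by testing an eigenvector of [A] for a positive eigenvalue against
    the vectors A1 x ⊗ A2 y only. *)

Section Scalars.
Variables (R : realType) (K : scalars R).
Local Notation ofr := (of_real K).
Local Notation conj := (sconj K).

Lemma of_real_is_real r : ofr r \is Num.real.
Proof. by apply/of_realP; exists r. Qed.

(** [of_real] is just a ring morphism; it respects the order because a nonnegative real is a square,
    and squares of real elements of [K] are nonnegative. *)
Lemma of_real_ge0 r : (0 <= ofr r) = (0 <= r).
Proof.
have pos t : 0 <= t -> 0 <= ofr t.
  move=> t0; rewrite -(sqr_sqrtr t0) rmorphXn /=.
  by rewrite real_exprn_even_ge0 // of_real_is_real.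
apply/idP/idP; last exact: pos.
move=> r0; rewrite leNgt; apply/negP => rneg.
have : 0 <= ofr (- r) by apply: pos; rewrite oppr_ge0 ltW.
rewrite rmorphN oppr_ge0 => r0'.
have /eqP : ofr r = 0 by apply/le_anti; rewrite r0 r0'.
by rewrite fmorph_eq0 => /eqP r00; rewrite r00 ltxx in rneg.
Qed.

Lemma ler_of_real r t : (ofr r <= ofr t) = (r <= t).
Proof. by have := of_real_ge0 (t - r); rewrite rmorphB !subr_ge0. Qed.

Lemma ltr_of_real r t : (ofr r < ofr t) = (r < t).
Proof. by rewrite !lt_def ler_of_real (inj_eq (fmorph_inj _)). Qed.

Lemma of_real_norm r : ofr `|r| = `|ofr r|.
Proof.
have [r0|r0] := leP 0 r.
  by rewrite !ger0_norm // of_real_ge0.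
rewrite (ltr0_norm r0) rmorphN ltr0_norm //.
by rewrite -(rmorph0 (of_real K)) ltr_of_real.
Qed.

Lemma sconj_real (x : K) : x \is Num.real -> conj x = x.
Proof.
move=> xr; have [->|x0] := eqVneq x 0; first by rewrite rmorph0.
by apply: (mulfI x0); rewrite sconjP -expr2 real_normK.
Qed.

Lemma normr_sconj (x : K) : `|conj x| = `|x|.
Proof.
have [->|x0] := eqVneq x 0; first by rewrite rmorph0.
apply: (@mulfI _ `|x|); first by rewrite normr_eq0.
by rewrite -normrM sconjP normrX normr_id.
Qed.

Definition to_real (x : K) : R := xget 0 [set r | x = ofr r].

Lemma to_realK x : x \is Num.real -> ofr (to_real x) = x.
Proof.
move=> /of_realP ex.
by rewrite /to_real; case: xgetP => [r _ /= -> //|]; case: ex => r xr /(_ r).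
Qed.

End Scalars.

Section Hilbert.
Variables (R : realType) (K : scalars R) (H : hilbert K).
Local Notation ofr := (of_real K).
Local Notation "'[ x , y ]" := (inner H x y) : ring_scope.
Implicit Types (x y z : H) (c : K) (r : R).

Lemma ipDl x y z : '[x + y, z] = '[x, z] + '[y, z].
Proof. exact: linearDl. Qed.
Lemma ipDr x y z : '[x, y + z] = '[x, y] + '[x, z].
Proof. exact: linearDr. Qed.
Lemma ipNl x y : '[- x, y] = - '[x, y].
Proof. exact: linearNl. Qed.
Lemma ipBl x y z : '[x - y, z] = '[x, z] - '[y, z].
Proof. exact: linearBl. Qed.
Lemma ipBr x y z : '[x, y - z] = '[x, y] - '[x, z].
Proof. exact: linearBr. Qed.
Lemma ipZl c x y : '[c *: x, y] = c * '[x, y].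
Proof. exact: linearZl_LR. Qed.
Lemma ipZr c x y : '[x, c *: y] = sconj K c * '[x, y].
Proof. exact: linearZr_LR. Qed.
Lemma ip0l x : '[0, x] = 0.
Proof. exact: linear0l. Qed.
Lemma ip0r x : '[x, 0] = 0.
Proof. exact: linear0r. Qed.
Lemma ip_suml I (s : seq I) (P : pred I) (F : I -> H) x :
  '[\sum_(i <- s | P i) F i, x] = \sum_(i <- s | P i) '[F i, x].
Proof. exact: linear_sumlz. Qed.
Lemma ip_sumr I (s : seq I) (P : pred I) (F : I -> H) x :
  '[x, \sum_(i <- s | P i) F i] = \sum_(i <- s | P i) '[x, F i].
Proof. exact: linear_sumr. Qed.

Lemma ipC x y : '[x, y] = sconj K '[y, x].
Proof. by rewrite (hermC (inner H)) expr0 mul1r. Qed.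

Lemma ip_eq0C x y : ('[x, y] == 0) = ('[y, x] == 0).
Proof. by rewrite ipC fmorph_eq0. Qed.

(** The norm of [H] has values in [K], whose order need not be total. This real copy gives access to
    maxima and to the order of [R]. *)
Definition rnorm x : R := to_real `|x|.

Lemma rnormE x : ofr (rnorm x) = `|x|.
Proof. by rewrite to_realK // normr_real. Qed.

Lemma rnorm_ge0 x : 0 <= rnorm x.
Proof. by rewrite -(of_real_ge0 K) rnormE. Qed.

Lemma rnorm_eq0 x : (rnorm x == 0) = (x == 0).
Proof. by rewrite -(fmorph_eq0 ofr) rnormE normr_eq0. Qed.

Lemma rnorm0 : rnorm 0 = 0.
Proof. by apply/eqP; rewrite rnorm_eq0. Qed.

Lemma ler_rnormD x y : rnorm (x + y) <= rnorm x + rnorm y.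
Proof. by rewrite -(ler_of_real K) rmorphD !rnormE ler_normD. Qed.

Lemma rnormN x : rnorm (- x) = rnorm x.
Proof. by apply: (fmorph_inj ofr); rewrite !rnormE normrN. Qed.

Lemma rnormC x y : rnorm (x - y) = rnorm (y - x).
Proof. by rewrite -rnormN opprB. Qed.

Lemma rnormZ r x : rnorm (ofr r *: x) = `|r| * rnorm x.
Proof.
by apply: (fmorph_inj ofr); rewrite rmorphM !rnormE normrZ of_real_norm.
Qed.

Lemma ip_rnorm x : '[x, x] = ofr (rnorm x ^+ 2).
Proof. by rewrite innerP rmorphXn rnormE. Qed.

Lemma rnorm_dist x y : `|rnorm x - rnorm y| <= rnorm (x - y).
Proof.
have h u v : rnorm u - rnorm v <= rnorm (u - v).
  by rewrite lerBlDr -{1}(subrK v u) ler_rnormD.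
by rewrite ler_norml h andbT lerNl opprB rnormC h.
Qed.

Lemma ip_unit_le x e : '[e, e] = 1 -> `|'[x, e]| <= `|x|.
Proof.
move=> e1; pose c := '[x, e].
have : 0 <= '[x - c *: e, x - c *: e] by rewrite innerP exprn_ge0.
rewrite ipBl !ipBr !ipZl !ipZr e1 mulr1 -/c (ipC e x) -/c.
rewrite [sconj K c * c]mulrC subrr subr0 subr_ge0 sconjP innerP.
by rewrite ler_pXn2r // nnegrE.
Qed.

Lemma cauchy_schwarz x y : `|'[x, y]| <= `|x| * `|y|.
Proof.
have [->|y0] := eqVneq y 0; first by rewrite ip0r !normr0 mulr0.
have ny0 : rnorm y != 0 by rewrite rnorm_eq0.
pose e := ofr (rnorm y)^-1 *: y.
have e1 : '[e, e] = 1.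
  rewrite ipZl ipZr sconj_real ?of_real_is_real // ip_rnorm -!rmorphM.
  by rewrite mulrA -expr2 -exprMn mulVf // expr1n rmorph1.
have ye : y = ofr (rnorm y) *: e.
  by rewrite /e scalerA -rmorphM mulfV // rmorph1 scale1r.
rewrite {1}ye ipZr normrM normr_sconj rnormE normr_id mulrC.
by rewrite ler_wpM2r // ip_unit_le.
Qed.

Lemma nbhs_rnormP x (B : set H) :
  nbhs x B <-> exists2 r : R, 0 < r & forall y, rnorm (x - y) < r -> B y.
Proof.
split.
  move=> /nbhs_normP [e /= e0 sub].
  have er : ofr (to_real e) = e by rewrite to_realK // gtr0_real.
  exists (to_real e); first by rewrite -(ltr_of_real K) er rmorph0.
  by move=> y yr; apply: sub; rewrite /= -er -rnormE ltr_of_real.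
case=> r r0 sub; apply/nbhs_normP; exists (ofr r) => /=.
  by rewrite -(rmorph0 ofr) ltr_of_real.
by move=> y /=; rewrite -rnormE ltr_of_real; exact: sub.
Qed.

Lemma rnorm_continuous : continuous rnorm.
Proof.
move=> x; apply/cvgrPdist_lt => e e0; apply/nbhs_rnormP.
exists e => // y; apply: le_lt_trans; exact: rnorm_dist.
Qed.

Lemma closure_rnormP (D : set H) y :
  closure D y <-> forall e : R, 0 < e -> exists2 x, D x & rnorm (y - x) < e.
Proof.
split=> [Dy e e0|Dy B /nbhs_rnormP [e e0 sub]].
  have [|x [Dx xe]] := Dy [set x | rnorm (y - x) < e].
    by apply/nbhs_rnormP; exists e.
  by exists x.
by have [x Dx xe] := Dy _ e0; exists x; split=> //; exact: sub.
Qed.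

(** Cauchy-Schwarz does the work of continuity: a point x of [D] close enough to y would give |<y,
    z>| = |<y - x, z>| < |<y, z>|. *)
Lemma ip_cont0 (D : set H) y z : closure D y ->
  (forall x, D x -> '[x, z] = 0) -> '[y, z] = 0.
Proof.
move=> Dy Dz; apply/eqP; rewrite -normr_eq0; apply: contraTT isT => nz.
have n0 : 0 < `|'[y, z]| by rewrite lt_def nz /=.
have zr0 : 0 < rnorm z + 1 by rewrite ltr_wpDl ?rnorm_ge0.
pose d : R := to_real `|'[y, z]|.
have dE : ofr d = `|'[y, z]| by rewrite to_realK ?normr_real.
have d0 : 0 < d by rewrite -(ltr_of_real K) dE rmorph0.
have [|x Dx] := (closure_rnormP _ _).1 Dy (d / (rnorm z + 1)).
  by rewrite divr_gt0.
rewrite ltr_pdivlMr // => lt.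
have : `|'[y - x, z]| <= `|y - x| * `|z| by exact: cauchy_schwarz.
rewrite ipBl (Dz _ Dx) subr0 -dE -!rnormE -rmorphM ler_of_real => le.
have le2 : rnorm (y - x) * rnorm z <= rnorm (y - x) * (rnorm z + 1).
  by rewrite ler_wpM2l ?rnorm_ge0 // lerDl.
by have := le_lt_trans (le_trans le le2) lt; rewrite ltxx.
Qed.

End Hilbert.

(** If m < k, the k x m matrix of coefficients has a nonzero row vector in its left kernel, and this
    vector is a nontrivial relation between the [g i]. *)
Lemma independent_leq_span (K : fieldType) (V : lmodType K) m k
    (e : 'I_m -> V) (g : 'I_k -> V) :
  (forall i, exists c : 'I_m -> K, g i = \sum_j c j *: e j) ->
  (forall c : 'I_k -> K, \sum_i c i *: g i = 0 -> forall i, c i = 0) ->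
  (k <= m)%N.
Proof.
move=> /choice [C gC] free_g; rewrite leqNgt; apply/negP => mk.
pose M : 'M[K]_(k, m) := \matrix_(i, j) C i j.
have : kermx M != 0.
  rewrite kermx_eq0; apply: contraTN mk => /eqP rM.
  by rewrite -leqNgt -rM rank_leq_col.
case/rowV0Pn => v vM /eqP; apply.
have {}vM : v *m M = 0 by apply/sub_kermxP.
apply/rowP => i; rewrite mxE; apply: (free_g (fun i => v 0 i)).
under eq_bigr => j _ do rewrite gC scaler_sumr.
rewrite exchange_big big1 //= => j _.
under eq_bigr => l _ do rewrite scalerA.
rewrite -scaler_suml; have /rowP/(_ j) := vM.
rewrite !mxE => vj; rewrite -[X in X *: _](_ : 0 = _) ?scale0r //.
by rewrite -[LHS]vj; apply: eq_bigr => l _; rewrite mxE.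
Qed.

Lemma has_dim_inj (R : realType) (K : scalars R) (V : lmodType K) (E : set V)
  m k : has_dim E m -> has_dim E k -> m = k.
Proof.
move=> [e [Ee fe se]] [g [Eg fg sg]]; apply/eqP; rewrite eqn_leq.
apply/andP; split.
  by apply: (independent_leq_span (e := g) (g := e)) => // i; exact: sg.
by apply: (independent_leq_span (e := e) (g := g)) => // i; exact: se.
Qed.

Section Orthonormal.
Variables (R : realType) (K : scalars R) (H : hilbert K).
Local Notation "'[ x , y ]" := (inner H x y) : ring_scope.

(** Eigenvectors will be indexed by the n with [0 < lam n], or by pairs of such indices; [D] is this
    index set, and [g] is unconstrained outside of it. *)
Definition orthonormal_on (J : eqType) (D : set J) (g : J -> H) :=
  forall i j, D i -> D j -> '[g i, g j] = (i == j)%:R.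

Lemma ip_orthonormal_sum (J : eqType) (D : set J) (g : J -> H) (s : seq J)
    (c : J -> K) j :
  orthonormal_on D g -> uniq s -> (forall i, i \in s -> D i) -> D j ->
  '[\sum_(i <- s) c i *: g i, g j] = if j \in s then c j else 0.
Proof.
move=> og us sI Ij; rewrite ip_suml.
case: ifPn => js.
  rewrite (bigD1_seq j) //= ipZl og // eqxx mulr1 big_seq_cond big1 ?addr0 //.
  by move=> i /andP[/sI Ii /negPf ij]; rewrite ipZl og // ij mulr0.
rewrite big_seq big1 // => i is_; rewrite ipZl og //; last exact: sI.
by case: eqP => [ij|_]; rewrite ?mulr0 //; rewrite -ij is_ in js.
Qed.

Lemma ip_pythagoras (x y : H) : '[x, y] = 0 ->
  '[x + y, x + y] = '[x, x] + '[y, y].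
Proof. by move=> xy; rewrite ipDl !ipDr xy (ipC y x) xy rmorph0 addr0 add0r. Qed.

Definition ortho_proj (J : eqType) (g : J -> H) (s : seq J) (x : H) : H :=
  \sum_(i <- s) '[x, g i] *: g i.

Lemma ortho_proj_ortho (J : eqType) (D : set J) (g : J -> H) (s : seq J) x j :
  orthonormal_on D g -> uniq s -> (forall i, i \in s -> D i) -> j \in s ->
  '[x - ortho_proj g s x, g j] = 0.
Proof.
move=> og us sI js; rewrite ipBl (ip_orthonormal_sum _ og) // ?js ?subrr //.
exact: sI.
Qed.

Lemma ortho_proj_norm (J : eqType) (D : set J) (g : J -> H) (s : seq J) x :
  orthonormal_on D g -> uniq s -> (forall i, i \in s -> D i) ->
  rnorm (x - ortho_proj g s x) <= rnorm x.
Proof.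
move=> og us sI; set r := x - _.
have r0 : '[r, ortho_proj g s x] = 0.
  rewrite ip_sumr big_seq big1 // => i is_; rewrite ipZr.
  by rewrite (ortho_proj_ortho _ og) // mulr0.
have : '[x, x] = '[r, r] + '[ortho_proj g s x, ortho_proj g s x].
  by rewrite -ip_pythagoras // subrK.
rewrite !ip_rnorm -rmorphD => /fmorph_inj xr.
rewrite -(@ler_pXn2r _ 2) ?nnegrE ?rnorm_ge0 // xr lerDl.
by rewrite exprn_ge0 // rnorm_ge0.
Qed.

(** The difference of x and its projection lies in [E] and is orthogonal to the family, hence
    vanishes; so the family spans. Any index set with m elements is allowed, because the tensor
    product will be indexed by pairs. *)
Lemma orthonormal_has_dim (J : pointedType) (D : set J) (E : set H) (g : J -> H) m :
  (forall c x y, E x -> E y -> E (c *: x + y)) ->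
  (D #= `I_m)%card -> (forall i, D i -> E (g i)) -> orthonormal_on D g ->
  (forall x, E x -> (forall i, D i -> '[x, g i] = 0) -> x = 0) ->
  has_dim E m.
Proof.
move=> lE /card_esym /card_set_bijP [f [fIn finjn fsurj]] Eg og cg.
have fI (i : 'I_m) : D (f i) by apply: fIn => /=.
have finj (i j : 'I_m) : f i = f j -> i = j.
  move=> fij; apply/val_inj => /=.
  by apply: finjn fij; rewrite in_setE /=.
have ogf : orthonormal_on setT (fun i : 'I_m => g (f i)).
  by move=> i j _ _; rewrite og // (inj_eq finj).
exists (fun i : 'I_m => g (f i)); split.
- by move=> i; exact: Eg.
- move=> c c0 j; have := ip_orthonormal_sum (s := index_enum 'I_m) c ogf.
  by move=> /(_ j (index_enum_uniq _) (fun _ _ => I) I); rewrite c0 ip0l mem_index_enum.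
- move=> x Ex; exists (fun i => '[x, g (f i)]).
  apply/eqP; rewrite -subr_eq0; apply/eqP; apply: cg.
    have : forall s : seq 'I_m, E (x - \sum_(i <- s) '[x, g (f i)] *: g (f i)).
      elim=> [|i s IH]; first by rewrite big_nil subr0.
      rewrite big_cons opprD addrCA -scaleNr; apply: lE => //; exact: Eg.
    exact.
  move=> i Ii.
  have [j jm <-] := fsurj _ Ii.
  have := ortho_proj_ortho (s := index_enum 'I_m) x ogf (index_enum_uniq _) (fun _ _ => I).
  by move=> /(_ (Ordinal jm) (mem_index_enum _)).
Qed.

(** Maximality replaces Gram-Schmidt: an orthonormal family in [E] has at most m members, one of
    maximal size k is complete because a vector orthogonal to it could be normalized and added, and
    k = m by uniqueness of the dimension. *)
Lemma has_dim_orthonormal (J : pointedType) (D : set J) (E : set H) m :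
  (forall c x y, E x -> E y -> E (c *: x + y)) ->
  (D #= `I_m)%card -> has_dim E m -> exists g : J -> H,
  [/\ forall i, D i -> E (g i), orthonormal_on D g &
  forall x, E x -> (forall i, D i -> '[x, g i] = 0) -> x = 0].
Proof.
move=> lE Im dE.
pose P k := `[< exists g : nat -> H,
  (forall i, `I_k i -> E (g i)) /\ orthonormal_on `I_k g >].
have exP : exists k, P k by exists 0%N; apply/asboolP; exists (fun=> 0); split.
have leP k : P k -> (k <= m)%N.
  move=> /asboolP [g [Eg og]]; have [e [Ee fe se]] := dE.
  apply: (independent_leq_span (e := e) (g := fun i : 'I_k => g i)).
    by move=> i; apply: se; apply: Eg => /=.
  have ogf : orthonormal_on setT (fun i : 'I_k => g i).
    by move=> i j _ _; rewrite og /=.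
  move=> c c0 j; have := ip_orthonormal_sum (s := index_enum 'I_k) c ogf.
  by move=> /(_ j (index_enum_uniq _) (fun _ _ => I) I); rewrite c0 ip0l mem_index_enum.
case: (ex_maxnP exP leP) => k /asboolP [g [Eg og]] kmax.
have cg x : E x -> (forall i, `I_k i -> '[x, g i] = 0) -> x = 0.
  move=> Ex x0; apply/eqP; apply: contraT => nx.
  have rx : rnorm x != 0 by rewrite rnorm_eq0.
  suff : P k.+1 by move=> /kmax; rewrite ltnn.
  pose u := of_real K (rnorm x)^-1 *: x.
  have E0 : E 0 by rewrite -(subrr x) addrC -scaleN1r; exact: lE.
  have u1 : '[u, u] = 1.
    rewrite ipZl ipZr sconj_real ?of_real_is_real // ip_rnorm -!rmorphM.
    by rewrite mulrA -expr2 -exprMn mulVf // expr1n rmorph1.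
  have u0 i : (i < k)%N -> '[u, g i] = 0 by move=> ik; rewrite ipZl x0 ?mulr0.
  apply/asboolP; exists (fun i => if i == k then u else g i); split.
    move=> i /= ik; case: eqP => [_|/eqP nik].
      by rewrite /u -[_ *: _]addr0; exact: lE.
    by apply: Eg => /=; rewrite ltn_neqAle nik.
  move=> i j /=; rewrite !ltnS => ik jk.
  have [ei|ni] := eqVneq i k; have [ej|nj] := eqVneq j k.
  - by rewrite u1 ei ej eqxx.
  - rewrite u0 ?ltn_neqAle ?nj // ei; by rewrite eq_sym (negPf nj).
  - by rewrite ipC u0 ?ltn_neqAle ?ni // rmorph0 ej (negPf ni).
  - by apply: og => /=; rewrite ltn_neqAle ?ni ?nj.
have km : m = k.
  apply: (has_dim_inj dE); apply: (orthonormal_has_dim _ (card_eqxx _) Eg og cg).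
  exact: lE.
move: Im; rewrite km => /card_set_bijP [f [fI finj fsurj]].
exists (fun i => g (f i)); split.
- by move=> i Ii; apply: Eg; exact: fI.
- move=> i j Ii Ij; rewrite og; [|exact: fI|exact: fI].
  congr (nat_of_bool _)%:R; apply/eqP/eqP => [|-> //].
  by apply: finj; rewrite in_setE.
- move=> x Ex x0; apply: cg => // j jk.
  by have [i Ii <-] := fsurj _ jk; exact: x0.
Qed.

End Orthonormal.

(** * Compact operators *)

Section Spectral.
Variables (R : realType) (K : scalars R) (H : hilbert K).
Local Notation ofr := (of_real K).
Local Notation "'[ x , y ]" := (inner H x y) : ring_scope.
Variable A : {linear H -> H}.
Hypothesis A_compact : compact_operator A.
Hypothesis A_nonneg : nonneg_self_adjoint A.

Definition lin_closed (M : set H) := forall c x y, M x -> M y -> M (c *: x + y).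

Lemma lin_closedZ M c x : lin_closed M -> M 0 -> M x -> M (c *: x).
Proof. by move=> lM M0 Mx; rewrite -[_ *: _]addr0; exact: lM. Qed.

Lemma lin_closedB M x y : lin_closed M -> M x -> M y -> M (x - y).
Proof. by move=> lM Mx My; rewrite addrC -scaleN1r; exact: lM. Qed.

(** The closed image of the unit ball of [M] is compact, so the norm has a maximum on it. The
    maximizer y is a limit of vectors A x and need not be one of them; this is why the next proof
    works with approximations. *)
Lemma restricted_norm_attained (M : set H) : lin_closed M -> M 0 ->
  exists2 y, closure (A @` [set x | M x /\ rnorm x <= 1]) y &
    forall x, M x -> rnorm (A x) <= rnorm y * rnorm x.
Proof.
move=> lM M0; set D := [set x | M x /\ rnorm x <= 1].
have D0 : D 0 by split=> //; rewrite rnorm0.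
have cD : compact (closure (A @` D)).
  rewrite -precompactE; apply: precompact_subset A_compact.
  move=> _ [x [Mx x1] <-]; exists x => //=.
  by rewrite -rnormE -(rmorph1 ofr) ler_of_real.
have nD : closure (A @` D) !=set0.
  by exists (A 0); apply: subset_closure; exists 0.
have [|y yD ymax] := compact_EVT_max nD cD (f := @rnorm R K H).
  exact/continuous_subspaceT/rnorm_continuous.
exists y; first by rewrite in_setE in yD.
move=> x Mx; have [->|x0] := eqVneq x 0; first by rewrite raddf0 !rnorm0 mulr0.
have rx0 : 0 < rnorm x by rewrite lt_def rnorm_ge0 rnorm_eq0 x0.
rewrite -ler_pdivrMr // mulrC.
have := ymax (A (ofr (rnorm x)^-1 *: x)).
rewrite linearZ_LR rnormZ ger0_norm ?invr_ge0 ?(ltW rx0) //.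
apply.
rewrite in_setE; apply: subset_closure; exists (ofr (rnorm x)^-1 *: x).
  split; first exact: lin_closedZ.
  by rewrite rnormZ ger0_norm ?invr_ge0 ?(ltW rx0) // mulVf // gt_eqF.
by rewrite linearZ_LR.
Qed.

(* The norm attains its supremum c over the closure of the image of the unit
   ball of M, at some y; then A (A y) = c^2 y, so that A y + c y is an
   eigenvector for c, nonzero by nonnegativity. *)
Lemma top_eigenvector (M : set H) (lM : lin_closed M) (M0 : M 0)
    (AM : forall x, M x -> M (A x)) (cM : closure M `<=` M) :
  exists2 c : R, forall x, M x -> rnorm (A x) <= c * rnorm x &
    c = 0 \/ [/\ 0 < c & exists w, [/\ M w, w != 0 & A w = ofr c *: w]].
Proof.
have [y yD ymax] := restricted_norm_attained lM M0.
exists (rnorm y) => //; set c := rnorm y in ymax *.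
have [/eqP c0|c0] := eqVneq c 0; [by left; apply/eqP|right].
have {}c0 : 0 < c by rewrite lt_def c0 rnorm_ge0.
have My : M y.
  apply: cM; apply: closure_subset yD => _ [x [Mx _] <-]; exact: AM.
split=> //.
pose z := A (A y) - ofr (c ^+ 2) *: y.
have z0 : z = 0.
  apply/eqP; rewrite -rnorm_eq0; apply: contraT => nz.
  have {}nz : 0 < rnorm z by rewrite lt_def nz rnorm_ge0.
  set t := rnorm z in nz.
  (* [e] is the tolerance in approximating y by A x, and [h] will bound the norm of [u]: its square
     is at most c^2 (c^2 - |A x|^2) <= 2 c^3 e <= h^2. Then t <= 2 c^2 e + c h <= t/4 + t/4, a
     contradiction. *)
  pose h := t / (4 * c); pose e := Num.min (h ^+ 2 / (2 * c ^+ 3)) (t / (8 * c ^+ 2)).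
  have h0 : 0 < h by rewrite divr_gt0 // mulr_gt0.
  have p1 : 0 < 2 * c ^+ 3 by rewrite mulr_gt0 // exprn_gt0.
  have p2 : 0 < 8 * c ^+ 2 by rewrite mulr_gt0 // exprn_gt0.
  have e0 : 0 < e by rewrite lt_min (divr_gt0 (exprn_gt0 2 h0) p1) divr_gt0.
  have e1 : 2 * c ^+ 3 * e <= h ^+ 2.
    by rewrite mulrC -ler_pdivlMr // ge_min lexx.
  have e2 : 8 * c ^+ 2 * e <= t.
    by rewrite mulrC -ler_pdivlMr // ge_min lexx orbT.
  have [_ [x [Mx x1] <-] xe] := (closure_rnormP _ _).1 yD _ e0.
  have Ax : rnorm (A x) <= c.
    by apply: le_trans (ymax _ Mx) _; rewrite ler_piMr // ltW.
  have Ax' : c - e <= rnorm (A x).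
    have := le_trans (ler_norm _) (rnorm_dist y (A x)).
    by rewrite -/c; move: (rnorm _) (rnorm _) xe => a b; lra.
  have AAx : rnorm (A (A x)) <= c * rnorm (A x) by apply: ymax; exact: AM.
  pose u := A (A x) - ofr (c ^+ 2) *: x.
  have uE : rnorm u ^+ 2 =
      rnorm (A (A x)) ^+ 2 - 2 * c ^+ 2 * rnorm (A x) ^+ 2 + c ^+ 4 * rnorm x ^+ 2.
    apply: (fmorph_inj ofr); rewrite -ip_rnorm.
    rewrite ipBl !ipBr !ipZl !ipZr sconj_real ?of_real_is_real //.
    rewrite (A_nonneg.1 (A x) x) -(A_nonneg.1 x (A x)) !ip_rnorm.
    by rewrite -!(rmorphM, rmorphB) /=; congr (ofr _); ring.
  have uh : rnorm u <= h.
    rewrite -(@ler_pXn2r _ 2) ?nnegrE ?rnorm_ge0 ?(ltW h0) // (le_trans _ e1) // uE.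
    have := rnorm_ge0 (A (A x)); have := rnorm_ge0 (A x); have := rnorm_ge0 x.
    move: AAx Ax Ax' x1 e0 c0; move: (rnorm x) (rnorm (A x)) (rnorm (A (A x))) => a b d.
    move=> h1 h2 h3 h4 h5 h6 h7 h8 h9.
    have d2 : d ^+ 2 <= c ^+ 2 * b ^+ 2 by rewrite -exprMn ler_pXn2r ?nnegrE // mulr_ge0 // ltW.
    have a2 : c ^+ 4 * a ^+ 2 <= c ^+ 4.
      apply: ler_piMr; first by rewrite exprn_ge0 // ltW.
      by rewrite expr_le1.
    have b2 : c ^+ 2 - b ^+ 2 <= 2 * c * e.
      rewrite subr_sqr; apply: (@le_trans _ _ (e * (c + b))).
        by rewrite ler_wpM2r //; lra.
      by rewrite [_ * e]mulrC ler_wpM2l ?(ltW h5) //; lra.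
    have : c ^+ 2 * (c ^+ 2 - b ^+ 2) <= c ^+ 2 * (2 * c * e).
      by rewrite ler_wpM2l // exprn_ge0 // ltW.
    lra.
  (* The defect of A^2 - c^2 at y is its defect at y - A x, which is small because A x is close to
     y, plus the image under A of its defect [u] at x, which is small because A x nearly has the
     maximal norm. *)
  have zE : z = A (A (y - A x)) - ofr (c ^+ 2) *: (y - A x) + A u.
    have -> : A (A (y - A x)) = A (A y) - A (A (A x)) by rewrite !linearB.
    have -> : A u = A (A (A x)) - ofr (c ^+ 2) *: A x.
      by rewrite /u [LHS]linearB linearZ_LR.
    by rewrite /z scalerBr opprB addrAC !addrA !subrK.
  have MyAx : M (y - A x) by apply: lin_closedB => //; exact: AM.
  have t1 : rnorm (A (A (y - A x))) <= c ^+ 2 * rnorm (y - A x).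
    rewrite expr2 -mulrA; apply: le_trans (ymax _ (AM _ MyAx)) _.
    by rewrite ler_wpM2l ?(ltW c0) // ymax.
  have t2 : rnorm (A u) <= c * h.
    apply: le_trans (ymax _ _) _; last by rewrite ler_wpM2l // ltW.
    by apply: lin_closedB => //; [exact/AM/AM | exact: lin_closedZ].
  have : t <= c ^+ 2 * e + c ^+ 2 * e + c * h.
    rewrite /t zE; apply: le_trans (ler_rnormD _ _) _; apply: lerD => //.
    apply: le_trans (ler_rnormD _ _) _; apply: lerD.
      by apply: le_trans t1 _; rewrite ler_wpM2l ?exprn_ge0 ?(ltW c0) ?(ltW xe).
    by rewrite rnormN rnormZ ger0_norm ?exprn_ge0 ?(ltW c0) // ler_wpM2l ?exprn_ge0 ?(ltW c0) ?(ltW xe).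
  have -> : c * h = t / 4 by rewrite /h; field; rewrite gt_eqF.
  lra.
have AAy : A (A y) = ofr (c ^+ 2) *: y by apply/eqP; rewrite -subr_eq0 -/z z0.
exists (A y + ofr c *: y); split.
- by rewrite addrC; apply: lM => //; exact: AM.
- apply/eqP => w0; have yE : A y = - (ofr c *: y) by apply/eqP; rewrite -addr_eq0 w0.
  have := A_nonneg.2 y; rewrite yE ipNl ipZl ip_rnorm -rmorphM -rmorphN of_real_ge0.
  by rewrite oppr_ge0 leNgt mulr_gt0 ?exprn_gt0.
- by rewrite linearD /= AAy linearZ_LR scalerDr scalerA -rmorphM -expr2 addrC.
Qed.

Lemma eigenspace_lin_closed (mu : R) : lin_closed (Defs.eigenspace A mu).
Proof.
move=> c x y; rewrite /Defs.eigenspace /= => xE yE.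
by rewrite linearP xE yE scalerDr !scalerA mulrC.
Qed.

Lemma eigenvectors_orthogonal a b x y : a != b ->
  Defs.eigenspace A a x -> Defs.eigenspace A b y -> '[x, y] = 0.
Proof.
rewrite /Defs.eigenspace /= => ab xE yE; have := A_nonneg.1 x y.
rewrite xE yE ipZl ipZr sconj_real ?of_real_is_real // => /eqP.
rewrite -subr_eq0 -mulrBl -rmorphB mulf_eq0 fmorph_eq0 subr_eq0 (negPf ab) /=.
by move=> /eqP.
Qed.

Section Eigenbasis.
Variable lam : nat -> R.
Hypothesis lamP : enumerates_eigenvalues A lam.

(** The last clause is completeness inside each eigenspace of a positive eigenvalue. Nothing is said
    about the kernel of [A]. *)
Definition eigenbasis (e : nat -> H) :=
  [/\ forall n, 0 < lam n -> A (e n) = ofr (lam n) *: e n,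
      orthonormal_on [set n | 0 < lam n] e &
      forall mu, 0 < mu -> forall x, Defs.eigenspace A mu x ->
        (forall n, lam n = mu -> '[x, e n] = 0) -> x = 0].

(** The basis of each eigenspace is indexed by the fiber of [lam] itself, so the bases are glued
    without renumbering; distinct fibers are orthogonal by self-adjointness. *)
Lemma eigenbasis_exists : exists e, eigenbasis e.
Proof.
case: lamP => lam0 lamd lamE.
have /choice [g gP] : forall mu, exists g : nat -> H, 0 < mu ->
    [/\ forall i, lam i = mu -> Defs.eigenspace A mu (g i),
      orthonormal_on [set n | lam n = mu] g &
      forall x, Defs.eigenspace A mu x -> (forall i, lam i = mu -> '[x, g i] = 0) -> x = 0].
  move=> mu; have [mu0|mu0] := ltP 0 mu; last by exists (fun=> 0).
  have [m Im Em] := lamE _ mu0.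
  have [g gE] := has_dim_orthonormal (@eigenspace_lin_closed mu) Im Em.
  by exists g.
exists (fun n => g (lam n) n); split.
- by move=> n n0; have [gE _ _] := gP _ n0; exact: gE.
- move=> i j /= i0 j0.
  have [ij|ij] := eqVneq (lam i) (lam j).
    by have [_ og _] := gP _ i0; rewrite -ij og.
  have [gi _ _] := gP _ i0; have [gj _ _] := gP _ j0.
  rewrite (eigenvectors_orthogonal ij (gi _ erefl) (gj _ erefl)).
  by case: eqP => // eij; rewrite eij eqxx in ij.
- move=> mu mu0 x Ex x0; have [_ _ cg] := gP _ mu0; apply: cg => // i li.
  by have := x0 _ li; rewrite li.
Qed.

Variable e : nat -> H.
Hypothesis eP : eigenbasis e.

(** The complement [M] of the first N eigenvectors is closed and invariant. If its top eigenvalue c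
    exceeded [lam N], all n with [lam n = c] would be below N, so the top eigenvector would be
    orthogonal to a complete family of its own eigenspace. *)
Lemma eigenbasis_tail N x :
  (forall i, (i < N)%N -> 0 < lam i -> '[x, e i] = 0) ->
  rnorm (A x) <= lam N * rnorm x.
Proof.
case: eP => Ae _ ce; case: lamP => lam0 lamd _.
pose M := [set x | forall i, (i < N)%N -> 0 < lam i -> '[x, e i] = 0].
have lM : lin_closed M.
  by move=> c u v Mu Mv i iN i0; rewrite ipDl ipZl Mu // Mv // mulr0 addr0.
have M0 : M 0 by move=> i _ _; rewrite ip0l.
have AM u : M u -> M (A u).
  move=> Mu i iN i0; rewrite A_nonneg.1 Ae // ipZr.
  by rewrite Mu // mulr0.
have cM : closure M `<=` M.
  by move=> u Mu i iN i0; apply: (ip_cont0 Mu) => v Mv; exact: Mv.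
have [c cle cP] := top_eigenvector lM M0 AM cM.
move=> Mx; apply: le_trans (cle _ Mx) _.
rewrite ler_wpM2r ?rnorm_ge0 //.
case: cP => [->//|[c0 [w [Mw w0 Aw]]]].
rewrite leNgt; apply/negP => Nc; move/eqP: w0; apply.
apply: (ce _ c0) => // n nc; apply: Mw; last by rewrite nc.
by rewrite ltnNge; apply/negP => /lamd; rewrite nc leNgt Nc.
Qed.

Hypothesis lam_fin : forall t, 0 < t -> finite_set [set n | t < lam n].

(** Subtracting from x its projection on the first eigenvectors leaves a vector that [A] contracts
    by [lam N], and [lam N] is as small as desired because the level sets are finite. The part of x
    in the kernel disappears under [A]. *)
Lemma eigenbasis_range_dense (Z : set H) x : lin_closed Z -> Z 0 ->
  (forall n, 0 < lam n -> Z (e n)) -> closure Z (A x).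
Proof.
move=> lZ Z0 Ze; case: eP => Ae oe ce; apply/closure_rnormP => r r0.
have rx : 0 < rnorm x + 1 by rewrite ltr_wpDl ?rnorm_ge0.
have t0 : 0 < r / (rnorm x + 1) by rewrite divr_gt0.
have [N lN] : exists N, lam N <= r / (rnorm x + 1).
  apply: contrapT => nN; apply: infinite_nat.
  suff -> : [set: nat] = [set n | r / (rnorm x + 1) < lam n] by exact: lam_fin.
  by apply/esym/seteqP; split=> // n _ /=; rewrite ltNge; apply/negP => ?; apply: nN; exists n.
pose s := [seq n <- iota 0 N | 0 < lam n].
have us : uniq s by rewrite filter_uniq // iota_uniq.
have sP n : n \in s -> 0 < lam n by rewrite mem_filter => /andP[].
exists (A (ortho_proj e s x)).
  rewrite /ortho_proj raddf_sum; elim: s us sP => [|n s IH] /=; first by rewrite big_nil.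
  move=> /andP[_ us] sP; rewrite big_cons /= linearZ_LR Ae ?sP ?mem_head // scalerA.
  apply: lZ; last by apply: IH => // i is_; apply: sP; rewrite in_cons is_ orbT.
  by apply: Ze; rewrite sP ?mem_head.
rewrite -raddfB; apply: le_lt_trans (@eigenbasis_tail N _ _) _.
  move=> i iN i0; apply: (ortho_proj_ortho _ oe) => //.
  by rewrite mem_filter i0 mem_iota.
have pn : rnorm (x - ortho_proj e s x) <= rnorm x by exact: (ortho_proj_norm _ oe).
apply: (@le_lt_trans _ _ (r / (rnorm x + 1) * rnorm x)).
  by apply: ler_pM => //; [case: lamP | exact: rnorm_ge0].
by rewrite mulrAC ltr_pdivrMr // ltr_pM2l // ltrDl.
Qed.

End Eigenbasis.
End Spectral.

(** * Tensor products *)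

Section Tensor.
Variables (R : realType) (K : scalars R) (H1 H2 : hilbert K).
Variable H : hilbert_tensor H1 H2.
Local Notation ofr := (of_real K).
Local Notation "'[ x , y ]" := (inner _ x y) : ring_scope.
Local Notation "x ⊗ y" := (tens H x y) (at level 40).
Variables (A1 : {linear H1 -> H1}) (A2 : {linear H2 -> H2}) (A : {linear H -> H}).
Hypotheses (A1_compact : compact_operator A1) (A1_nonneg : nonneg_self_adjoint A1)
  (A2_compact : compact_operator A2) (A2_nonneg : nonneg_self_adjoint A2)
  (A_tensor : tensor_operator A1 A2 A).

Lemma tensDl x x' y : (x + x') ⊗ y = x ⊗ y + x' ⊗ y.
Proof. exact: linearDl. Qed.
Lemma tensDr x y y' : x ⊗ (y + y') = x ⊗ y + x ⊗ y'.
Proof. exact: linearDr. Qed.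
Lemma tensZl c x y : (c *: x) ⊗ y = c *: (x ⊗ y).
Proof. exact: linearZl_LR. Qed.
Lemma tensZr c x y : x ⊗ (c *: y) = c *: (x ⊗ y).
Proof. exact: linearZr_LR. Qed.
Lemma tensBl x x' y : (x - x') ⊗ y = x ⊗ y - x' ⊗ y.
Proof. exact: linearBl. Qed.
Lemma tensBr x y y' : x ⊗ (y - y') = x ⊗ y - x ⊗ y'.
Proof. exact: linearBr. Qed.
Lemma tens0l y : 0 ⊗ y = 0.
Proof. exact: linear0l. Qed.
Lemma tens0r x : x ⊗ 0 = 0.
Proof. exact: linear0r. Qed.

Lemma rnorm_tens x y : rnorm (x ⊗ y) = rnorm x * rnorm y.
Proof.
apply/eqP; rewrite -(@eqrXn2 _ 2) ?mulr_ge0 ?rnorm_ge0 //; apply/eqP.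
apply: (fmorph_inj ofr); rewrite -ip_rnorm tens_inner !ip_rnorm -rmorphM.
by rewrite exprMn.
Qed.

Lemma closure_tensl (Z : set H1) x y : closure Z x ->
  closure ((fun z => z ⊗ y) @` Z) (x ⊗ y).
Proof.
move=> /closure_rnormP Zx; apply/closure_rnormP => e e0.
have y0 : 0 < rnorm y + 1 by rewrite ltr_wpDl ?rnorm_ge0.
have [z Zz xz] := Zx _ (divr_gt0 e0 y0).
exists (z ⊗ y); first by exists z.
rewrite -tensBl rnorm_tens; move: xz; rewrite ltr_pdivlMr // => xz.
by apply: le_lt_trans xz; rewrite ler_wpM2l ?rnorm_ge0 // lerDl.
Qed.

Lemma closure_tensr (Z : set H2) x y : closure Z y ->
  closure ((fun z => x ⊗ z) @` Z) (x ⊗ y).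
Proof.
move=> /closure_rnormP Zy; apply/closure_rnormP => e e0.
have x0 : 0 < rnorm x + 1 by rewrite ltr_wpDl ?rnorm_ge0.
have [z Zz yz] := Zy _ (divr_gt0 e0 x0).
exists (x ⊗ z); first by exists z.
rewrite -tensBr rnorm_tens; move: yz; rewrite ltr_pdivlMr // mulrC => yz.
by apply: le_lt_trans yz; rewrite ler_wpM2r ?rnorm_ge0 // lerDl.
Qed.

Lemma closure_pure (z : H) : closure [set z : H |
    exists n (x : 'I_n -> H1) (y : 'I_n -> H2), z = \sum_(i < n) tens H (x i) (y i)] z.
Proof.
move=> B Bz; have [u [Bu Su]] : interior B `&` [set z : H |
    exists n (x : 'I_n -> H1) (y : 'I_n -> H2), z = \sum_(i < n) tens H (x i) (y i)] !=set0.
  apply: tens_dense; last exact: open_interior.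
  by exists z; exact: Bz.
by exists u; split=> //; exact: interior_subset.
Qed.

Lemma ip_pure_eq0 (z : H) : (forall x y, '[x ⊗ y, z] = 0) -> z = 0.
Proof.
move=> z0; apply/eqP; rewrite -rnorm_eq0 -sqrf_eq0 -(fmorph_eq0 ofr) -ip_rnorm.
apply/eqP; apply: (ip_cont0 (@closure_pure z)) => _ [n [x [y ->]]].
by rewrite ip_suml big1.
Qed.

(** For finite sums of pure tensors this is the self-adjointness of the factors. Such a sum u is
    then chosen near z, with A u near A z by continuity, so that the two sides differ by less than
    any positive amount. *)
Lemma tensor_operator_adjoint (z : H) x y :
  '[A z, x ⊗ y] = '[z, A1 x ⊗ A2 y].
Proof.
case: A_tensor => cA At.
suff : '[z, A1 x ⊗ A2 y] - '[A z, x ⊗ y] == 0.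
  by rewrite subr_eq0 => /eqP ->.
(* Both errors will be below t / C, so the difference is at most (C - 1) t / C; the summand 1 makes
   this smaller than t. *)
set d := _ - _; pose C := rnorm (A1 x ⊗ A2 y) + rnorm (x ⊗ y) + 1.
have C0 : 0 < C by rewrite ltr_wpDl // addr_ge0 ?rnorm_ge0.
rewrite -normr_eq0; apply: contraT => nd.
pose t : R := to_real `|d|.
have tE : ofr t = `|d| by rewrite to_realK ?normr_real.
have t0 : 0 < t by rewrite -(ltr_of_real K) tE rmorph0 lt_def nd /=.
have e0 : 0 < t / C by rewrite divr_gt0.
have : nbhs (A z) [set v | rnorm (A z - v) < t / C].
  by apply/nbhs_rnormP; exists (t / C).
move=> /(cA z) /nbhs_rnormP [r r0 rA].
have m0 : 0 < Num.min r (t / C) by rewrite lt_min r0.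
have [u [n [a [b uE]]]] := (closure_rnormP _ _).1 (@closure_pure z) _ m0.
rewrite lt_min => /andP[ur ue].
have Au : '[A u, x ⊗ y] = '[u, A1 x ⊗ A2 y].
  rewrite uE raddf_sum !ip_suml; apply: eq_bigr => i _.
  by rewrite /= At !tens_inner A1_nonneg.1 A2_nonneg.1.
have dE : d = '[z - u, A1 x ⊗ A2 y] - '[A z - A u, x ⊗ y].
  by rewrite !ipBl Au opprB addrA subrK.
have : t <= rnorm (z - u) * rnorm (A1 x ⊗ A2 y) + rnorm (A z - A u) * rnorm (x ⊗ y).
  rewrite -(ler_of_real K) tE dE rmorphD !rmorphM !rnormE.
  by apply: le_trans (ler_normB _ _) _; apply: lerD; exact: cauchy_schwarz.
have /= uA := rA _ ur.
have -> : t = t / C * C by rewrite divfK // gt_eqF.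
move: (ler_wpM2r (rnorm_ge0 (A1 x ⊗ A2 y)) (ltW ue)).
move: (ler_wpM2r (rnorm_ge0 (x ⊗ y)) (ltW uA)); rewrite /C.
move: e0; rewrite /C; move: (t / _) (rnorm _ * _) (rnorm _ * _) => q m1 m2; lra.
Qed.

Variables (lam mu : nat -> R).
Hypotheses (lamP : enumerates_eigenvalues A1 lam) (muP : enumerates_eigenvalues A2 mu)
  (lam_fin : forall t, 0 < t -> finite_set [set n | t < lam n])
  (mu_fin : forall t, 0 < t -> finite_set [set n | t < mu n]).

Let w (k : nat * nat) : R := lam k.1 * mu k.2.

Lemma product_eigenvalue_gt0 k : (0 < w k) = (0 < lam k.1) && (0 < mu k.2).
Proof.
case: lamP muP => lam0 _ _ [mu0 _ _].
apply/idP/andP => [|[a b]]; last exact: mulr_gt0.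
rewrite /w !lt_def mulf_eq0 negb_or => /andP[/andP[-> ->] _].
by rewrite lam0 mu0.
Qed.

(** The issue is completeness of the tensors [g k] with [w k = nu]. An eigenvector z orthogonal to
    them is orthogonal to every other [g k] as well, since the eigenvalues differ; by density of the
    eigenvectors in the ranges, taken in one factor at a time, it is orthogonal to all A1 x ⊗ A2 y.
    By the adjoint formula A z is orthogonal to all pure tensors, so nu z = A z = 0. *)
Lemma tensor_eigenspace_dim nu m : 0 < nu ->
  ([set k | w k = nu] #= `I_m)%card -> has_dim (Defs.eigenspace A nu) m.
Proof.
move=> nu0 card_m; case: (A_tensor) => cA At.
have [e eP] := eigenbasis_exists A1_nonneg lamP.
have [f fP] := eigenbasis_exists A2_nonneg muP.
pose g (k : nat * nat) : H := e k.1 ⊗ f k.2.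
have [Ae oe _] := eP; have [Af of_ _] := fP.
have og : orthonormal_on [set k | 0 < w k] g.
  move=> i j /=; rewrite !product_eigenvalue_gt0 => /andP[i1 i2] /andP[j1 j2].
  rewrite tens_inner oe // of_ // -natrM mulnb; congr (nat_of_bool _)%:R.
have Ag k : 0 < w k -> A (g k) = ofr (w k) *: g k.
  rewrite product_eigenvalue_gt0 => /andP[k1 k2].
  by rewrite At Ae // Af // tensZl tensZr scalerA rmorphM.
have Aip k z : 0 < w k -> '[A z, g k] = ofr (w k) * '[z, g k].
  move=> wk; rewrite tensor_operator_adjoint -At Ag // ipZr sconj_real //.
  exact: of_real_is_real.
apply: (orthonormal_has_dim (g := g) (@eigenspace_lin_closed _ _ _ _ _) card_m).
- by move=> k /= wk; rewrite /Defs.eigenspace /= Ag wk.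
- by move=> i j /= wi wj; apply: og; rewrite /= ?wi ?wj.
- move=> z Az z0; rewrite /Defs.eigenspace /= in Az.
  have zg k : 0 < lam k.1 -> 0 < mu k.2 -> '[z, g k] = 0.
    move=> k1 k2; have wk : 0 < w k by rewrite product_eigenvalue_gt0 k1.
    have [/z0 //|wn] := eqVneq (w k) nu.
    have := Aip k z wk; rewrite Az ipZl => /eqP.
    rewrite -subr_eq0 -mulrBl -rmorphB mulf_eq0 fmorph_eq0 subr_eq0 eq_sym.
    by rewrite (negPf wn) /= => /eqP.
  have z1 n x : 0 < mu n -> '[A1 x ⊗ f n, z] = 0.
    move=> n0; pose Z := [set u : H1 | '[u ⊗ f n, z] = 0].
    have lZ : lin_closed Z.
      by move=> c u v; rewrite /Z /= => u0 v0; rewrite tensDl tensZl ipDl ipZl u0 v0 mulr0 addr0.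
    have Ze k : 0 < lam k -> Z (e k).
      by move=> k0; apply/eqP; rewrite ip_eq0C; apply/eqP; exact: (zg (k, n)).
    have Z0 : Z 0 by rewrite /Z /= tens0l ip0l.
    have cZ : closure Z (A1 x).
      exact: (eigenbasis_range_dense A1_compact A1_nonneg lamP eP lam_fin lZ Z0 Ze).
    by apply: (ip_cont0 (closure_tensl (y := f n) cZ)) => _ [u Zu <-].
  have z2 x y : '[A1 x ⊗ A2 y, z] = 0.
    pose Z := [set v : H2 | '[A1 x ⊗ v, z] = 0].
    have lZ : lin_closed Z.
      by move=> c u v; rewrite /Z /= => u0 v0; rewrite tensDr tensZr ipDl ipZl u0 v0 mulr0 addr0.
    have Z0 : Z 0 by rewrite /Z /= tens0r ip0l.
    have Zf n : 0 < mu n -> Z (f n) by exact: z1.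
    have cZ : closure Z (A2 y).
      exact: (eigenbasis_range_dense A2_compact A2_nonneg muP fP mu_fin lZ Z0 Zf).
    by apply: (ip_cont0 (closure_tensr (x := A1 x) cZ)) => _ [u Zu <-].
  have : A z = 0.
    apply: ip_pure_eq0 => x y; apply/eqP; rewrite ip_eq0C tensor_operator_adjoint.
    by rewrite ip_eq0C z2.
  rewrite Az => /eqP; rewrite scaler_eq0 fmorph_eq0 gt_eqF //=.
  by move=> /eqP.
Qed.

End Tensor.

(** * Nonincreasing rearrangement of a family with finite level sets *)

Section Rearrangement.
Variable R : realType.
Implicit Types t mu : R.

(** One bijection is chosen for each level, and the glued map sends i to [F (u i) i]. *)
Lemma card_eq_fibers (I J : pointedType) (u : I -> R) (v : J -> R) t :
  (forall mu, t < mu -> ([set i | u i = mu] #= [set j | v j = mu])%card) ->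
  ([set i | (t < u i)%R] #= [set j | (t < v j)%R])%card.
Proof.
move=> fib.
have /choice [F FP] : forall mu, exists f : I -> J, t < mu ->
    set_bij [set i | u i = mu] [set j | v j = mu] f.
  move=> mu; have [/fib /card_set_bijP [f fb]|_] := boolP (t < mu)%R.
    by exists f.
  by exists (fun=> point).
apply/card_set_bijP; exists (fun i => F (u i) i); split.
- by move=> i /= ti; have [/(_ i erefl) /= -> _ _] := FP _ ti.
- move=> i j; rewrite !in_setE /= => ti tj eF.
  have [Fi inji _] := FP _ ti; have [Fj _ _] := FP _ tj.
  have uij : u i = u j by rewrite -(Fi i erefl) -(Fj j erefl) eF.
  by apply: inji; rewrite ?in_setE //= eF uij.
- move=> j /= tj; have [_ _ /(_ j erefl) [i /= ui <-]] := FP _ tj.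
  by exists i; rewrite /= ui.
Qed.

(** Makes a counting function constant just to the right of t. This yields the strict inequality
    [t < lam n] although [lam n] is a supremum. *)
Lemma finite_gap_above (X : set R) t : finite_set X ->
  exists2 t', t < t' & forall x, X x -> t < x -> t' < x.
Proof.
move=> /finite_seqP [s ->]; elim: s => [|a s [t' tt' sP]].
  by exists (t + 1); rewrite ?ltrDl.
have [ta|at_] := ltP t a; last first.
  exists t' => // x /=; rewrite in_cons => /orP[/eqP ->|/sP //].
  by rewrite ltNge at_.
exists (Num.min t' ((t + a) / 2)); first by rewrite lt_min tt' /= midf_lt.
move=> x /=; rewrite in_cons gt_min => /orP[/eqP -> _|xs tx].
  by rewrite (midf_lt ta).2 orbT.
by rewrite sP.
Qed.

Lemma finite_gap_below (X : set R) mu : finite_set X -> 0 < mu ->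
  exists2 t, 0 < t < mu & forall x, X x -> x < mu -> x <= t.
Proof.
move=> /finite_seqP [s ->] mu0; elim: s => [|a s [t /andP[t0 tm] sP]].
  by exists (mu / 2) => //; rewrite divr_gt0 //= ltr_pdivrMr // ltr_pMr // ltr1n.
have [am|ma] := ltP a mu; last first.
  exists t; first by rewrite t0.
  by move=> x /=; rewrite in_cons => /orP[/eqP ->|/sP //]; rewrite ltNge ma.
exists (Num.max t a); first by rewrite lt_max t0 gt_max tm.
move=> x /=; rewrite in_cons le_max => /orP[/eqP -> _|xs xm].
  by rewrite lexx orbT.
by rewrite sP.
Qed.

Variables (J : pointedType) (w : J -> R).
Hypothesis w_fin : forall t, 0 < t -> finite_set [set k | t < w k].

Let N t : nat := #|` fset_set [set k | (t < w k)%R]|.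
(** The generalized inverse of the counting function [N]. The level 0 keeps the set nonempty and
    continues the sequence by 0 when there are finitely many positive values. *)
Let lam (n : nat) : R := sup [set t | t = 0 \/ 0 < t /\ (n < N t)%N].

Let N_anti t t' : 0 < t -> t <= t' -> (N t' <= N t)%N.
Proof.
move=> t0 tt'; apply: fsubset_leq_card; rewrite -fset_set_sub.
- by move=> k /=; apply: le_lt_trans.
- exact/w_fin/(lt_le_trans t0).
- exact: w_fin.
Qed.

Let N_const t t' : 0 < t -> 0 < t' -> (forall k, (t < w k) = (t' < w k)) -> N t = N t'.
Proof.
by move=> t0 t'0 e; congr (#|` fset_set _|)%N; apply/seteqP; split=> k /=; rewrite e.
Qed.

Let fin_val t : 0 < t -> finite_set (w @` [set k | t < w k]).
Proof. by move=> t0; apply: finite_image; exact: w_fin. Qed.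

Let lam_sup n : has_sup [set t | t = 0 \/ 0 < t /\ (n < N t)%N].
Proof.
split; first by exists 0; left.
have [s wE] := (finite_seqP _).1 (fin_val ltr01).
exists (1 + \sum_(x <- s) `|x|) => t /= [->|[t0 nN]].
  by rewrite addr_ge0 // sumr_ge0.
have [k tk] : [set k | t < w k] !=set0.
  apply/set0P/eqP => e; move: nN.
  by rewrite /N e fset_set0 cardfs0.
have [w1|w1] := leP (w k) 1.
  rewrite (le_trans (ltW tk)) // (le_trans w1) // lerDl sumr_ge0 //.
have : (w @` [set k | 1 < w k]) (w k) by exists k.
rewrite wE /= => ks; rewrite (le_trans (ltW tk)) //.
rewrite (big_rem _ ks) /= addrCA ler_wpDr ?ler_norm // addr_ge0 // sumr_ge0 //.
Qed.

Let lam_gtP n t : 0 < t -> (t < lam n) = (n < N t)%N.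
Proof.
move=> t0; apply/idP/idP => [|nN].
  move=> /(sup_gt (lam_sup n).1) [t' /= [->|[t'0 nN]] tt'].
    by rewrite ltNge ltW in tt'.
  by apply: (leq_trans nN); apply: N_anti => //; exact: ltW.
have [t' tt' t'P] := finite_gap_above t (fin_val t0).
apply: (lt_le_trans tt'); apply: sup_upper_bound => //=; right.
have t'0 := lt_trans t0 tt'; split=> //; rewrite -(@N_const t t') // => k.
apply/idP/idP => [tk|]; last exact: lt_trans.
by apply: t'P => //; exists k.
Qed.

Lemma nonincreasing_rearrangement : exists lam : nat -> R,
  [/\ forall n, 0 <= lam n, {homo lam : m n / (m <= n)%N >-> n <= m} &
    forall mu, 0 < mu -> ([set n | lam n = mu] #= [set k | w k = mu])%card].
Proof.
exists lam; split.
- by move=> n; apply: sup_upper_bound => //=; left.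
- move=> m n mn; rewrite leNgt; apply/negP => lt.
  have l0 : 0 <= lam m by apply: sup_upper_bound => //=; left.
  have [tm tn] := midf_lt lt.
  have t0 := le_lt_trans l0 tm.
  move: tn tm; rewrite lam_gtP // => nN /ltW; rewrite leNgt lam_gtP //.
  by rewrite (leq_ltn_trans mn nN).
- move=> mu mu0.
  have h0 : 0 < mu / 2 by rewrite divr_gt0.
  have [t0 /andP[t00 t0m] t0P] := finite_gap_below (fin_val h0) mu0.
  (* [t0] comes from the finite set of values above mu / 2, so it separates only these from mu; the
     maximum with mu / 2 leaves no value of [w] strictly between [t1] and mu. *)
  pose t1 := Num.max t0 (mu / 2).
  have t1m : t1 < mu by rewrite gt_max t0m /= ltr_pdivrMr // ltr_pMr // ltr1n.
  have t10 : 0 < t1 by rewrite lt_max t00.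
  have t1P k : t1 < w k -> mu <= w k.
    rewrite gt_max => /andP[tk hk]; rewrite leNgt; apply/negP => km.
    have : w k <= t0 by apply: t0P => //; exists k.
    by rewrite leNgt tk.
  have -> : [set k | w k = mu] = [set k | t1 < w k] `\` [set k | mu < w k].
    apply/seteqP; split=> k /=; first by move=> ->; rewrite t1m ltxx.
    by move=> [/t1P mk /negP]; rewrite -leNgt => km; apply/le_anti; rewrite mk km.
  have -> : [set n | lam n = mu] = `I_(N t1) `\` `I_(N mu).
    apply/seteqP; split=> n /=; first by move=> ln; rewrite -!lam_gtP // ln t1m ltxx.
    move=> [n1 /negP]; rewrite -lam_gtP // -leNgt => lm.
    apply/le_anti; rewrite lm leNgt; apply/negP => lt.
    have l0 : t1 < lam n by rewrite lam_gtP.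
    have [h1 h2] := midf_lt lt.
    have p0 := lt_trans (lt_trans t10 l0) h1.
    move: (ltW h1); rewrite leNgt lam_gtP // => /negP; apply.
    rewrite -(@N_const t1) // => k.
    apply/idP/idP => [/t1P|]; first exact: lt_le_trans.
    by apply: lt_trans; apply: lt_trans h1.
  apply: card_eq_trans card_IID _; rewrite card_eq_sym.
  have [n An] := (finite_setP _).1 (w_fin t10).
  have fD : finite_set ([set k | t1 < w k] `\` [set k | mu < w k]).
    by apply: finite_setD; exact: w_fin.
  have [m Dm] := (finite_setP _).1 fD.
  rewrite (_ : (N t1 - N mu)%N = m) //; rewrite -(card_fset_set Dm).
  rewrite fset_setD; [|exact: w_fin|exact: w_fin].
  rewrite cardfsD -fset_setI; [|exact: w_fin|exact: w_fin].
  congr (_ - #|` fset_set _|)%N; apply/seteqP; split=> k /=; last by case.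
  by move=> mk; split=> //; exact: lt_trans mk.
Qed.

End Rearrangement.

(** * Counting function of the tensor product *)

Section TensorCounting.
Variables (R : realType) (K : scalars R) (H1 H2 : hilbert K).
Variable H : hilbert_tensor H1 H2.
Variables (A1 : {linear H1 -> H1}) (A2 : {linear H2 -> H2}) (A : {linear H -> H}).
Hypotheses (A1_compact : compact_operator A1) (A1_nonneg : nonneg_self_adjoint A1)
  (A2_compact : compact_operator A2) (A2_nonneg : nonneg_self_adjoint A2)
  (A_tensor : tensor_operator A1 A2 A).
Variables (lam mu : nat -> R).
Hypotheses (lamP : enumerates_eigenvalues A1 lam) (muP : enumerates_eigenvalues A2 mu)
  (lam_fin : forall t, 0 < t -> finite_set [set n | t < lam n])
  (mu_fin : forall t, 0 < t -> finite_set [set n | t < mu n]).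

Let w (k : nat * nat) : R := lam k.1 * mu k.2.

Lemma finite_product_level t : 0 < t -> finite_set [set k | t < w k].
Proof.
case: lamP muP => lam0 lamd _ [mu0 mud _] t0.
have l0 : 0 < lam 0%N + 1 by rewrite ltr_wpDl.
have m0 : 0 < mu 0%N + 1 by rewrite ltr_wpDl.
apply: (@sub_finite_set _ _ ([set n | t / (mu 0%N + 1) < lam n] `*`
    [set n | t / (lam 0%N + 1) < mu n])).
  move=> [i j] /= tij; split; rewrite /= ltr_pdivrMr //; apply: (lt_le_trans tij).
    by rewrite /w /= ler_wpM2l // ler_wpDr // mud.
  by rewrite /w /= mulrC ler_wpM2l // ler_wpDr // lamd.
by apply: finite_setX; [apply: lam_fin|apply: mu_fin]; rewrite divr_gt0.
Qed.

(** [eigenvalues A] is a chosen enumeration. The rearranged products show that one exists, so the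
    default is not taken; uniqueness of the dimension of each eigenspace then gives its fibers the
    same cardinalities as those of [w]. *)
Lemma counting_function_tensor t : 0 < t ->
  counting_function A t = #|` fset_set [set k | t < w k]|%:R.
Proof.
case: (lamP) (muP) => lam0 _ _ [mu0 _ _] t0.
have dimA := tensor_eigenspace_dim A1_compact A1_nonneg A2_compact A2_nonneg
  A_tensor lamP muP lam_fin mu_fin.
have fib_fin nu : 0 < nu -> finite_set [set k | w k = nu].
  move=> nu0; apply: sub_finite_set (finite_product_level (_ : 0 < nu / 2)).
    by move=> k /= ->; rewrite ltr_pdivrMr // ltr_pMr // ltr1n.
  by rewrite divr_gt0.
have enumA : enumerates_eigenvalues A (eigenvalues A).
  rewrite /eigenvalues; case: xgetP => // /=.
  have [nul [nul0 nuld nulE]] := nonincreasing_rearrangement finite_product_level.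
  move=> /(_ nul) []; split=> // nu nu0.
  have [m wm] := (finite_setP _).1 (fib_fin _ nu0).
  by exists m; [exact: card_eq_trans (nulE _ nu0) wm | exact: dimA].
case: enumA => e0 ed eE.
have fibs nu : t < nu ->
    ([set n | eigenvalues A n = nu] #= [set k | w k = nu])%card.
  move=> tnu; have nu0 := lt_trans t0 tnu.
  have [m em Em] := eE _ nu0; have [m' wm'] := (finite_setP _).1 (fib_fin _ nu0).
  have mm' : m = m' by apply: has_dim_inj Em _; exact: dimA.
  by rewrite (card_eql em) card_eq_sym mm'.
have cA := card_eq_fibers fibs.
congr (_%:R); apply/fcard_eq => //.
  by rewrite (eq_finite_set cA); exact: finite_product_level.
exact: finite_product_level.
Qed.

End TensorCounting.

(** * Real-valued cardinalities and counting of pairs *)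

Section CardReal.
Variable R : realType.

Definition cardr (T : choiceType) (X : set T) : R := #|` fset_set X|%:R.

Lemma cardr_ge0 (T : choiceType) (X : set T) : 0 <= cardr X.
Proof. exact: ler0n. Qed.

Lemma ler_cardr (T : choiceType) (X Y : set T) :
  finite_set Y -> X `<=` Y -> cardr X <= cardr Y.
Proof.
move=> fY XY; rewrite ler_nat; apply: fsubset_leq_card; rewrite -fset_set_sub //.
exact: sub_finite_set fY.
Qed.

Lemma cardrD (T : choiceType) (X Y : set T) : finite_set Y -> X `<=` Y ->
  cardr (Y `\` X) = cardr Y - cardr X.
Proof.
move=> fY XY; have fX := sub_finite_set XY fY.
rewrite /cardr fset_setD // cardfsD -fset_setI // (setIidr XY) natrB //.
by apply: fsubset_leq_card; rewrite -fset_set_sub.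
Qed.

Lemma cardrX (T U : choiceType) (X : set T) (Y : set U) :
  finite_set X -> finite_set Y -> cardr (X `*` Y) = cardr X * cardr Y.
Proof.
move=> fX fY; rewrite /cardr fset_setX // -natrM; congr _%:R.
set x := fset_set X; set y := fset_set Y.
rewrite -(size_allpairs pair x y); apply/perm_size/uniq_perm.
- exact: fset_uniq.
- by apply: allpairs_uniq => // [[? ?] [? ?]].
- move=> [a b]; rewrite inE /=; apply/andP/allpairsP => [[ax bY]|].
    by exists (a, b).
  by move=> [[u v] /= [ux vy [-> ->]]].
Qed.

End CardReal.

Section Hyperbola.
Variables (R : realType) (lam mu : nat -> R).
Hypotheses (lam_ge0 : forall n, 0 <= lam n) (mu_ge0 : forall n, 0 <= mu n)
  (lam_max : forall n, lam n <= lam 0%N) (mu_max : forall n, mu n <= mu 0%N)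
  (lam_fin : forall t, 0 < t -> finite_set [set n | t < lam n])
  (mu_fin : forall t, 0 < t -> finite_set [set n | t < mu n])
  (prod_fin : forall t, 0 < t -> finite_set [set k | t < lam k.1 * mu k.2]).

Let f1 x : R := cardr R [set n | expR (- x) < lam n].
Let f2 x : R := cardr R [set n | expR (- x) < mu n].
Let f x : R := cardr R [set k | expR (- x) < lam k.1 * mu k.2].

(* [G x a] counts the pairs whose second factor exceeds [expR (- a)]. *)
Lemma product_counting_split : exists (c : R) (G : R -> R -> R),
  [/\ forall x a b, a <= b -> f1 (x - b) * (f2 b - f2 a) <= G x b - G x a,
      forall x a b, a <= b -> G x b - G x a <= f1 (x - a) * (f2 b - f2 a),
      forall x a, 0 <= G x a <= f1 (x + c) * f2 a &
      forall x a, 0 <= f x - G x a <= f1 (x - a) * f2 (x + c)].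
Proof.
(* Since e^c >= 1 + c, all eigenvalues of both factors are at most e^c. A product above e^(-x)
   therefore has both factors above e^(-(x + c)). *)
pose c := lam 0%N + mu 0%N.
have lamc n : lam n <= expR c.
  rewrite (le_trans (lam_max n)) //; apply: le_trans (expR_ge1Dx c).
  by rewrite /c; have := mu_ge0 0%N; lra.
have muc n : mu n <= expR c.
  rewrite (le_trans (mu_max n)) //; apply: le_trans (expR_ge1Dx c).
  by rewrite /c; have := lam_ge0 0%N; lra.
have key (x y l m : R) : 0 <= l -> m <= expR y -> expR (- x) < l * m -> expR (- (x + y)) < l.
  move=> l0 my lt; rewrite opprD expRD (expRN y) ltr_pdivrMr ?expR_gt0 //.
  by apply: lt_le_trans lt _; exact: ler_wpM2l.
pose L x := [set n | expR (- x) < lam n].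
pose M x := [set n | expR (- x) < mu n].
pose P x := [set k : nat * nat | expR (- x) < lam k.1 * mu k.2].
have fL x : finite_set (L x) by apply: lam_fin; exact: expR_gt0.
have fM x : finite_set (M x) by apply: mu_fin; exact: expR_gt0.
have fP x : finite_set (P x) by apply: prod_fin; exact: expR_gt0.
have Mab a b : a <= b -> M a `<=` M b.
  by move=> ab n /=; apply: le_lt_trans; rewrite ler_expR lerN2.
have fPM x a : finite_set (P x `&` [set k | M a k.2]) by exact: finite_setIl.
have eM a b : a <= b -> f2 b - f2 a = cardr R (M b `\` M a).
  by move=> ab; rewrite cardrD //; exact: Mab.
have eG x a b : a <= b -> cardr R (P x `&` [set k | M b k.2]) -
    cardr R (P x `&` [set k | M a k.2]) =
    cardr R ((P x `&` [set k | M b k.2]) `\` (P x `&` [set k | M a k.2])).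
  move=> ab; rewrite cardrD //.
  by move=> k [Pk Mk]; split=> //; exact: (Mab a b).
exists c, (fun x a => cardr R (P x `&` [set k | M a k.2])); split.
(* When e^(-b) < mu_j <= e^(-a), the pair is counted if lam_i > e^(-(x - b)), and only if lam_i >
   e^(-(x - a)). These two rectangles enclose the strip, one in each of the first two bounds. *)
- move=> x a b ab; rewrite (eM a b ab) (eG x a b ab) -cardrX; [|exact: fL|by apply: finite_setD; exact: fM].
  apply: ler_cardr; first by apply: finite_setD; exact: fPM.
  move=> [i j] [/= Li [Mj nMj]]; split; last by move=> [].
  split=> //; rewrite /P /=.
  have -> : - x = - (x - b) + - b by rewrite opprB addrAC subrr add0r.
  rewrite expRD; apply: ltr_pM => //; exact: expR_ge0.
- move=> x a b ab; rewrite (eM a b ab) (eG x a b ab) -cardrX; [|exact: fL|by apply: finite_setD; exact: fM].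
  apply: ler_cardr; first by apply: finite_setX; [exact: fL|by apply: finite_setD; exact: fM].
  move=> [i j] [/= [Pk Mj] nMj].
  have {}nMj : ~ M a j by move=> Maj; apply: nMj; split.
  split=> //=; move/negP: nMj; rewrite -leNgt => nMj.
  exact: (key x (- a) _ _ (lam_ge0 _) nMj Pk).
- move=> x a; rewrite cardr_ge0 /= -cardrX; [apply: ler_cardr|exact: fL|exact: fM].
    by apply: finite_setX; [exact: fL|exact: fM].
  move=> [i j] [/= Pk Mj]; split=> //.
  by have := key x c _ _ (lam_ge0 _) (muc j) Pk.
- move=> x a; rewrite -cardrD; [|exact: fP|by move=> k []].
  rewrite cardr_ge0 /= -cardrX; [apply: ler_cardr|exact: fL|exact: fM].
    by apply: finite_setX; [exact: fL|exact: fM].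
  move=> [i j] [/= Pk nPM].
  have nMj : ~ M a j by move=> Maj; apply: nPM; split.
  split=> /=.
    by apply: (key x (- a) _ _ (lam_ge0 _) _ Pk); move/negP: nMj; rewrite -leNgt.
  by apply: (key x c _ _ (mu_ge0 _) (lamc i)); rewrite mulrC.
Qed.

End Hyperbola.

(** * Integrals over segments *)

Lemma continuous_reflect (R : realType) (u : R -> R) (x : R) :
  continuous u -> continuous (fun y => u (x - y)).
Proof.
move=> cu y; apply: continuous_comp; last exact: cu.
by apply: cvgB; [exact: cvg_cst|exact: cvg_id].
Qed.

Lemma continuous_translate (R : realType) (u : R -> R) (x : R) :
  continuous u -> continuous (fun y => u (y + x)).
Proof.
move=> cu y; apply: continuous_comp; last exact: cu.
by apply: cvgD; [exact: cvg_id|exact: cvg_cst].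
Qed.

Section SegmentIntegral.
Variable R : realType.
Implicit Types (a b c x : R) (f g : R -> R).
Local Notation mu := (@lebesgue_measure R).

(** Continuity is two-sided at the end points too, so that it passes to subsegments without boundary
    conditions. *)
Definition continuous_on a b g := forall x, a <= x <= b -> {for x, continuous g}.

Definition segint a b g : R := \int[mu]_(x in `[a, b]) g x.

Lemma continuous_onS a b a' b' g : a <= a' -> b' <= b ->
  continuous_on a b g -> continuous_on a' b' g.
Proof.
by move=> aa bb cg x /andP[ax xb]; apply: cg; rewrite (le_trans aa) // (le_trans xb).
Qed.

Lemma continuous_on_within a b g : continuous_on a b g ->
  {within `[a, b], continuous g}.
Proof.
move=> cg; apply: continuous_in_subspaceT => x.
by rewrite inE /= in_itv /= => /cg.
Qed.

Lemma continuous_on_integrable a b g : continuous_on a b g ->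
  mu.-integrable `[a, b] (EFin \o g).
Proof.
move=> cg; apply: continuous_compact_integrable; first exact: segment_compact.
exact: continuous_on_within.
Qed.

Lemma segint_split a c b g : a <= c <= b -> continuous_on a b g ->
  segint a b g = segint a c g + segint c b g.
Proof.
move=> /andP[ac cb] cg.
have h : segint a b g - segint a c g = \int[mu]_(x in `]c, b]) g x.
  by apply: Rintegral_itvB; [exact: continuous_on_integrable|rewrite bnd_simp..].
have -> : segint c b g = \int[mu]_(x in `]c, b]) g x.
  symmetry; apply: Rintegral_itv_obnd_cbnd.
  apply: integrableS (continuous_on_integrable cg) => //.
  move=> x /=; rewrite !in_itv /= => /andP[cx ->].
  by rewrite andbT (le_trans ac) // ltW.
by rewrite -h addrC subrK.
Qed.

Lemma ler_segint a b f g : continuous_on a b f -> continuous_on a b g ->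
  (forall x, a <= x <= b -> f x <= g x) -> segint a b f <= segint a b g.
Proof.
move=> cf cg fg; apply: le_Rintegral; [by []|exact: continuous_on_integrable|exact: continuous_on_integrable|].
by move=> x /=; rewrite in_itv /= => /fg.
Qed.

Lemma eq_segint a b f g : (forall x, a <= x <= b -> f x = g x) ->
  segint a b f = segint a b g.
Proof.
by move=> fg; apply: eq_Rintegral => x; rewrite inE /= in_itv /= => /fg.
Qed.

Lemma segint_ge0 a b g : (forall x, a <= x <= b -> 0 <= g x) -> 0 <= segint a b g.
Proof. by move=> g0; apply: Rintegral_ge0 => x /=; rewrite in_itv /= => /g0. Qed.

Lemma segint_cst a b c : a <= b -> segint a b (fun=> c) = c * (b - a).
Proof.
move=> ab; rewrite /segint Rintegral_cst //= lebesgue_measure_itv /= lte_fin.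
by case: ltgtP ab => [| |->]; rewrite ?subrr.
Qed.

Lemma segintB a b f g : continuous_on a b f -> continuous_on a b g ->
  segint a b (fun x => f x - g x) = segint a b f - segint a b g.
Proof.
by move=> cf cg; apply: RintegralB => //; exact: continuous_on_integrable.
Qed.

Lemma segintZ a b k g : continuous_on a b g ->
  segint a b (fun x => k * g x) = k * segint a b g.
Proof. by move=> cg; apply: RintegralZl => //; exact: continuous_on_integrable. Qed.

Lemma segint_FTC a b (G g : R -> R) : a <= b -> continuous_on a b g ->
  (forall x, a <= x <= b -> is_derive x 1 G (g x)) -> segint a b g = G b - G a.
Proof.
rewrite le_eqVlt => /predU1P[-> _ _|ab cg dG].
  by rewrite subrr /segint set_itv1 Rintegral_set1.
have cG x : a <= x <= b -> {for x, continuous G}.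
  by move=> xab; apply: differentiable_continuous; apply/derivable1_diffP; case: (dG _ xab).
rewrite /segint /Rintegral (@continuous_FTC2 _ g G) //.
- exact: continuous_on_within.
- split.
  + by move=> x /[!in_itv] /= /andP[ax xb]; case: (dG x _); rewrite ?ltW.
  + by apply: cvg_at_right_filter; apply: cG; rewrite lexx ltW.
  + by apply: cvg_at_left_filter; apply: cG; rewrite lexx ltW.
- move=> x /[!in_itv] /= /andP[ax xb]; rewrite derive1E.
  by have /@derive_val -> := dG x (introT andP (conj (ltW ax) (ltW xb))).
Qed.

(** The base point lies strictly to the left of a, and the integral reaches strictly beyond b, so
    that the derivative is two-sided on all of [a, b]. *)
Lemma antiderivative l u a b g : l < a -> b < u ->
  (forall x, l < x < u -> {for x, continuous g}) ->
  exists G, forall x, a <= x <= b -> is_derive x 1 G (g x).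
Proof.
move=> la bu cg; pose l' := (l + a) / 2; pose u' := (b + u) / 2.
have [ll' l'a] := midf_lt la; have [bu' u'u] := midf_lt bu.
exists (fun x => segint l' x g) => x /andP[ax xb].
have cg' : continuous_on l' u' g.
  by move=> y /andP[y1 y2]; apply: cg; rewrite (lt_le_trans ll') // (le_lt_trans y2).
have [| |d dE] := @continuous_FTC1_closed _ g l' x u' (le_lt_trans xb bu')
   (continuous_on_integrable cg').
- exact: lt_le_trans ax.
- by apply: cg; rewrite (lt_le_trans la) // (le_lt_trans xb).
- by apply: DeriveDef => //; rewrite -derive1E.
Qed.

(** Both sides are differences of an antiderivative of [g] at [h a] and [h b], so [h] may be
    non-monotone. The two conclusions are the two orientations, because [segint] has none. *)
Lemma segint_subst l u a b (h dh g : R -> R) : a <= b ->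
  (forall x, l < x < u -> {for x, continuous g}) ->
  (forall x, a <= x <= b -> l < h x < u) ->
  (forall x, a <= x <= b -> is_derive x 1 h (dh x)) ->
  continuous_on a b dh ->
  (h a <= h b -> segint (h a) (h b) g = segint a b (fun x => g (h x) * dh x)) /\
  (h b <= h a -> segint (h b) (h a) g = - segint a b (fun x => g (h x) * dh x)).
Proof.
move=> ab cg lhu dhE cdh.
have ch : continuous_on a b h.
  by move=> x xab; apply: differentiable_continuous; apply/derivable1_diffP; case: (dhE _ xab).
have [p pab pmin] := EVT_min ab (continuous_on_within ch).
have [q qab qmax] := EVT_max ab (continuous_on_within ch).
have pb x : a <= x <= b -> h p <= h x <= h q.
  by move=> xab; rewrite pmin ?qmax // in_itv.
move: pab qab; rewrite !in_itv /= => /lhu /andP[lp _] /lhu /andP[_ qu].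
have [G GP] := antiderivative lp qu cg.
have ci : continuous_on a b (fun x => g (h x) * dh x).
  move=> x xab; apply: cvgM; last exact: cdh.
  apply: continuous_comp; first exact: ch.
  by apply: cg; exact: lhu.
have -> : segint a b (fun x => g (h x) * dh x) = G (h b) - G (h a).
  apply: (@segint_FTC _ _ (G \o h)) => // x xab.
  have Gh := GP _ (pb _ xab); have dh' := dhE _ xab.
  exact: is_derive1_comp.
have pa := pb a _; have pb' := pb b _.
have cgs : continuous_on (h p) (h q) g.
  by move=> x /andP[px xq]; apply: cg; rewrite (lt_le_trans lp) // (le_lt_trans xq).
move: (pa) (pb'); rewrite !lexx ab => /(_ isT) /andP[pa1 pa2] /(_ isT) /andP[pb1 pb2].
split=> hab.
  apply: segint_FTC => //; first exact: continuous_onS cgs.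
  by move=> x /andP[x1 x2]; apply: GP; rewrite (le_trans pa1) // (le_trans x2).
rewrite opprB; apply: segint_FTC => //; first exact: continuous_onS cgs.
by move=> x /andP[x1 x2]; apply: GP; rewrite (le_trans pb1) // (le_trans x2).
Qed.

Lemma segint_shift a b c g : a <= b -> continuous g ->
  segint a b (fun x => g (x + c)) = segint (a + c) (b + c) g.
Proof.
move=> ab cg; have [| | | |h _] := @segint_subst (a + c - 1) (b + c + 1) a b
   (fun x => x + c) (fun=> 1) g ab.
- by move=> x _; exact: cg.
- by move=> x; lra.
- by move=> x _; rewrite -[X in is_derive _ _ _ X]addr0; apply: is_deriveD.
- by move=> x _; exact: cvg_cst.
by rewrite h ?lerD2r //; apply: eq_segint => x _; rewrite mulr1.
Qed.

End SegmentIntegral.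

Section UniformContinuity.
Variable R : realType.

(** Only x is confined to the segment, while y may leave it; this spares boundary cases in the mesh
    estimates. *)
Lemma heine_segment (f : R -> R) (a b e : R) : continuous f -> 0 < e ->
  exists2 d, 0 < d & forall x y, a <= x <= b -> `|x - y| < d -> `|f x - f y| < e.
Proof.
move=> cf e0.
have /compact_near_coveringP cab := @segment_compact R a b.
have := cab R (0 : R)^'+ (fun d x => forall y, `|x - y| < d -> `|f x - f y| < e).
have h : forall x, `[a, b]%classic x -> \forall x' \near x & d \near (0 : R)^'+,
    forall y, `|x' - y| < d -> `|f x' - f y| < e.
  move=> x _; have e20 : 0 < e / 2 by rewrite divr_gt0.
  have /cvgrPdist_lt /(_ _ e20) /nbhs_ballP [r /= r0 rP] := cf x.
  have r20 : 0 < r / 2 by rewrite divr_gt0.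
  exists (ball x (r / 2), [set d | 0 < d < r / 2]) => /=.
    split; first exact: nbhsx_ballx.
    exists (r / 2) => //= d; rewrite /ball_ /= sub0r normrN => dr d0.
    by rewrite d0 /= (le_lt_trans (ler_norm _)).
  move=> [x' d] /= [xx' /andP[d0 dr]] y x'y.
  rewrite /ball /= in xx'.
  have h1 : `|f x - f x'| < e / 2.
    by apply: rP; rewrite /ball /= (lt_trans xx') // ltr_pdivrMr // ltr_pMr // ltr1n.
  have h2 : `|f x - f y| < e / 2.
    apply: rP; rewrite /ball /= -(subrKA x') (le_lt_trans (ler_normD _ _)) //.
    by rewrite [ltRHS](splitr r) ltrD // (lt_trans x'y).
  rewrite -(subrKA (f x)) (le_lt_trans (ler_normD _ _)) // [ltRHS](splitr e).
  by rewrite ltrD // distrC.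
move=> /(_ _ h) [d /= d0 dP]; have d20 : 0 < d / 2 by rewrite divr_gt0.
exists (d / 2) => // x y xab xy.
apply: (dP (d / 2)) xy => //=.
  by rewrite /ball_ /= sub0r normrN gtr0_norm // ltr_pdivrMr // ltr_pMr // ltr1n.
Qed.

End UniformContinuity.

(** * Riemann-Stieltjes sums over a uniform mesh *)

Section StieltjesSums.
Variables (R : realType) (f g : R -> R) (T : R).
Hypotheses (f_cont : continuous f) (g_cont : continuous g)
  (f_nd : nondecreasing f) (g_nd : nondecreasing g) (T_gt0 : 0 < T).
Implicit Types (x y e : R) (n l : nat).

Definition mesh n l : R := l%:R * (T / n%:R).

(** On a cell, [f (x - .)] is nonincreasing, so its largest value is at the left node. *)
Definition upper_sum n x : R :=
  \sum_(l < n) f (x - mesh n l) * (g (mesh n l.+1) - g (mesh n l)).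

Definition lower_sum n x : R :=
  \sum_(l < n) f (x - mesh n l.+1) * (g (mesh n l.+1) - g (mesh n l)).

Lemma mesh0 n : mesh n 0 = 0. Proof. by rewrite /mesh mul0r. Qed.

Lemma meshn n : (0 < n)%N -> mesh n n = T.
Proof. by move=> n0; rewrite /mesh mulrC divfK // pnatr_eq0 -lt0n. Qed.

Lemma mesh_le n k l : (k <= l)%N -> mesh n k <= mesh n l.
Proof.
by move=> kl; rewrite /mesh ler_wpM2r ?ler_nat // divr_ge0 // ltW.
Qed.

Lemma mesh_ge0 n l : 0 <= mesh n l.
Proof. by rewrite -(mesh0 n) mesh_le. Qed.

Lemma mesh_leT n l : (l <= n)%N -> mesh n l <= T.
Proof.
case: n => [|n] ln; last by rewrite -[leRHS](@meshn n.+1) // mesh_le.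
by move: ln; rewrite leqn0 => /eqP ->; rewrite mesh0 ltW.
Qed.

Lemma g_mesh_ge0 n l : 0 <= g (mesh n l.+1) - g (mesh n l).
Proof. by rewrite subr_ge0; apply: g_nd; rewrite mesh_le. Qed.

Lemma sum_g_mesh n : (0 < n)%N ->
  \sum_(l < n) (g (mesh n l.+1) - g (mesh n l)) = g T - g 0.
Proof.
move=> n0; rewrite -(big_mkord xpredT (fun l => g (mesh n l.+1) - g (mesh n l))) telescope_sumr //.
by rewrite meshn // mesh0.
Qed.

Lemma upper_lower_gap n x w : (0 < n)%N ->
  (forall l, (l < n)%N -> f (x - mesh n l) - f (x - mesh n l.+1) <= w) ->
  upper_sum n x - lower_sum n x <= w * (g T - g 0).
Proof.
move=> n0 fw; rewrite /upper_sum /lower_sum -sumrB -(sum_g_mesh n0) mulr_sumr.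
apply: ler_sum => l _; rewrite -mulrBl.
by rewrite ler_wpM2r ?g_mesh_ge0 // fw.
Qed.

Lemma upper_lower_cvg x e : 0 < e ->
  exists2 n, (0 < n)%N & upper_sum n x - lower_sum n x <= e.
Proof.
move=> e0; have D0 : 0 <= g T - g 0 by rewrite subr_ge0; apply: g_nd; exact: ltW.
have e'0 : 0 < e / (g T - g 0 + 1) by rewrite divr_gt0 // ltr_wpDl.
have [d d0 dP] := heine_segment (x - T) x f_cont e'0.
pose n := (Num.truncn (T / d)).+1.
have nT : T / n%:R < d.
  by rewrite ltr_pdivrMr ?ltr0n // mulrC -ltr_pdivrMr // truncnS_gt.
exists n => //; apply: le_trans (upper_lower_gap (w := e / (g T - g 0 + 1)) _ _) _ => //.
  move=> l ln; apply: le_trans (ler_norm _) (ltW _); apply: dP.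
    apply/andP; split; first by rewrite lerD2l lerN2 mesh_leT // ltnW.
    by rewrite lerBlDr lerDl mesh_ge0.
  rewrite opprB addrC subrKA /mesh -mulrBl -natr1 addrAC subrr add0r mul1r.
  by rewrite gtr0_norm // divr_gt0 // ltr0n.
by rewrite -mulrAC ler_pdivrMr ?ltr_wpDl // ler_pM2l // lerDl.
Qed.

End StieltjesSums.

(** * Derivative of the convolution of quasi-periodic functions *)

Section QuasiPeriodicConvolution.
Variables (R : realType) (f g : R -> R) (T q : R).
Hypotheses (f_cont : continuous f) (g_cont : continuous g)
  (f_nd : nondecreasing f) (g_nd : nondecreasing g) (T_gt0 : 0 < T).
Hypotheses (q_gt0 : 0 < q) (fT : forall x, f (x + T) = q * f x)
  (gT : forall x, g (x + T) = q * g x).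
Implicit Types (x y e h : R) (n l : nat).

Let continuous_onW (u : R -> R) a b : continuous u -> continuous_on a b u.
Proof. by move=> cu x _; exact: cu. Qed.

Lemma segint_periodic (k : R -> R) a b : continuous k -> periodic k T ->
  segint a (a + T) k = segint b (b + T) k.
Proof.
move=> ck pk; wlog ab : a b / a <= b.
  by move=> h; have [/h //|/ltW /h ->] := leP a b.
have T0 := ltW T_gt0.
have := @segint_split _ a b (b + T) k _ (continuous_onW ck).
rewrite ab lerDl T0 => /(_ isT) e1.
have := @segint_split _ a (a + T) (b + T) k _ (continuous_onW ck).
rewrite lerDl T0 lerD2r ab => /(_ isT); rewrite e1 -(segint_shift _ ab ck).
have -> : segint a b (fun x => k (x + T)) = segint a b k.
  by apply: eq_segint => x _; rewrite pk.
by rewrite addrC => /addIr.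
Qed.

Let shift_cont h : continuous (fun y => g (y + h)).
Proof. exact: continuous_translate. Qed.

Let refl_cont x : continuous (fun y => f (x - y)).
Proof. exact: continuous_reflect. Qed.

Let contM (u v : R -> R) : continuous u -> continuous v -> continuous (fun y => u y * v y).
Proof. by move=> cu cv y; apply: cvgM; [exact: cu|exact: cv]. Qed.

Definition conv_segment x : R := segint 0 T (fun y => f (x - y) * g y).

Lemma conv_segment_shift x h :
  conv_segment (x + h) = segint 0 T (fun y => f (x - y) * g (y + h)).
Proof.
pose k y := f (x + h - y) * g y.
(* When y moves by T, [g y] gains the factor q and [f (x + h - y)] loses it. *)
have pk : periodic k T.
  move=> y; rewrite /k gT; have := fT (x + h - (y + T)).
  by rewrite opprD addrA subrK => ->; rewrite mulrCA mulrA.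
have ck : continuous k by apply: contM.
have -> : segint 0 T (fun y => f (x - y) * g (y + h)) =
    segint 0 T (fun y => k (y + h)).
  by apply: eq_segint => y _; rewrite /k opprD addrACA subrr addr0.
rewrite segint_shift ?(ltW T_gt0) // add0r [T + h]addrC.
by rewrite (segint_periodic h 0 ck pk) add0r.
Qed.

Lemma segint_mesh n (k : R -> R) : (0 < n)%N -> continuous k ->
  segint 0 T k = \sum_(l < n) segint (mesh T n l) (mesh T n l.+1) k.
Proof.
move=> n0 ck.
have H : forall m, (m <= n)%N ->
    segint 0 (mesh T n m) k = \sum_(l < m) segint (mesh T n l) (mesh T n l.+1) k.
  elim=> [|m IH] mn; first by rewrite big_ord0 mesh0 /segint set_itv1 Rintegral_set1.
  rewrite big_ord_recr /= -IH ?(ltnW mn) //; apply: segint_split.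
    by rewrite mesh_ge0 // mesh_le.
  exact: continuous_onW.
by have := H n (leqnn n); rewrite meshn.
Qed.

(** [J] will be the Stieltjes integral of f (x - .) against g. The squeeze between the sums is all
    that the derivative requires, so no measure enters here. *)
Variable J : R -> R.
Hypothesis J_between : forall n x, (0 < n)%N ->
  lower_sum f g T n x <= J x <= upper_sum f g T n x.

(* The difference quotient is the integral of f (x - y) against
   (g (y + h) - g y) / h dy, whose mass on a cell of the mesh tends to the
   increment of g; hence all its limit values lie between the two sums. *)
Lemma is_derive_conv_segment x : is_derive x 1 conv_segment (J x).
Proof.
(* Integrating (g (y + h) - g y) / h over a cell gives the difference of the difference quotients of
   the primitive [P] at its two nodes; so its limit is an increment of g although g has no
   derivative. The margin 1 around [0, T] leaves room for shifts |h| < 1. *)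
have [P PP] : exists P, forall y, -1 <= y <= T + 1 -> is_derive y 1 P (g y).
  by apply: (@antiderivative _ (-2) (T + 2)); [lra|lra|move=> y _; exact: g_cont].
have FTC u v : -1 <= u -> u <= v -> v <= T + 1 -> segint u v g = P v - P u.
  move=> u1 uv vT; apply: segint_FTC => //; first exact: continuous_onW.
  by move=> y /andP[y1 y2]; apply: PP; lra.
pose E n l h := h^-1 * (segint (mesh T n l) (mesh T n l.+1) (fun y => g (y + h)) -
  segint (mesh T n l) (mesh T n l.+1) g).
have EP n l : (l < n)%N ->
    E n l h @[h --> 0^'] --> g (mesh T n l.+1) - g (mesh T n l).
  move=> ln; set a := mesh T n l; set b := mesh T n l.+1.
  have a0 : 0 <= a by exact: mesh_ge0.
  have ab : a <= b by apply: mesh_le.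
  have bT : b <= T by apply: mesh_leT.
  have Pcvg y : 0 <= y <= T -> h^-1 * (P (h + y) - P y) @[h --> 0^'] --> g y.
    move=> y0T; have dP : is_derive y 1 P (g y) by apply: PP; lra.
    have dPy : derivable P y 1 by case: dP.
    have <- : 'D_1 P y = g y by apply: derive_val.
    move: dPy; rewrite /derivable /derive => dPy.
    apply: cvg_trans dPy; apply: near_eq_cvg; near=> h.
    by rewrite /= /shift /= /GRing.scale /= mulr1.
  have : (h^-1 * (P (h + b) - P b) - h^-1 * (P (h + a) - P a)) @[h --> 0^'] --> g b - g a.
    by apply: cvgB; apply: Pcvg; lra.
  apply: cvg_trans; apply: near_eq_cvg; near=> h.
  have h1 : `|h| < 1.
    near: h; apply: dnbhs0_lt; exact: ltr01.
  rewrite ltr_norml in h1; case/andP: h1 => h1 h2.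
  rewrite /E -/a -/b segint_shift // !FTC //; [|lra..].
  by rewrite [h + b]addrC [h + a]addrC; ring.
pose D h := h^-1 * (conv_segment (x + h) - conv_segment x).
have DE n h : (0 < n)%N -> h != 0 ->
    \sum_(l < n) f (x - mesh T n l.+1) * E n l h <= D h <=
    \sum_(l < n) f (x - mesh T n l) * E n l h.
  move=> n0 hn0; pose k y := h^-1 * (g (y + h) - g y).
  have k0 y : 0 <= k y.
    rewrite /k; case: (ltgtP h 0) hn0 => // h0 _.
      rewrite nmulr_rge0 ?invr_lt0 // subr_le0; apply: g_nd; lra.
    rewrite mulr_ge0 ?invr_ge0 ?(ltW h0) // subr_ge0; apply: g_nd; lra.
  have ck : continuous k.
    apply: contM; first by move=> y; exact: cvg_cst.
    by move=> y; apply: cvgB; [exact: shift_cont|exact: g_cont].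
  have -> : D h = segint 0 T (fun y => f (x - y) * k y).
    rewrite /D conv_segment_shift /conv_segment -segintB; last 2 first.
    - by apply/continuous_onW/contM; [exact: refl_cont|exact: shift_cont].
    - by apply/continuous_onW/contM; [exact: refl_cont|exact: g_cont].
    rewrite -segintZ; first by apply: eq_segint => y _; rewrite /k; ring.
    by apply: continuous_onW => y; apply: cvgB; apply: contM.
  have cfk : continuous (fun y => f (x - y) * k y) by apply: contM.
  have Ek l : E n l h = segint (mesh T n l) (mesh T n l.+1) k.
    rewrite /k segintZ; last first.
      by apply: continuous_onW => y; apply: cvgB; [exact: shift_cont|exact: g_cont].
    by rewrite segintB //; apply: continuous_onW.
  have kc (c : R) : continuous (fun y => c * k y).
    by apply: contM => // y; exact: cvg_cst.
  rewrite (segint_mesh n0 cfk); apply/andP; split; apply: ler_sum => l _.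
    rewrite Ek -segintZ; last exact: continuous_onW.
    apply: ler_segint; [exact: continuous_onW..|move=> y /andP[y1 y2]].
    by rewrite ler_wpM2r //; apply: f_nd; rewrite lerD2l lerN2.
  rewrite Ek -segintZ; last exact: continuous_onW.
  apply: ler_segint; [exact: continuous_onW..|move=> y /andP[y1 y2]].
  by rewrite ler_wpM2r //; apply: f_nd; rewrite lerD2l lerN2.
have DJ : D h @[h --> 0^'] --> J x.
  apply/cvgrPdist_lt => e e0; have e30 : 0 < e / 3 by rewrite divr_gt0.
  have [n n0 gap] := upper_lower_cvg f_cont g_nd T_gt0 x e30.
  have [Ln Un] := andP (J_between x n0).
  have cU : \sum_(l < n) f (x - mesh T n l) * E n l h @[h --> 0^'] --> upper_sum f g T n x.
    apply: cvg_big => [|l _]; [exact: add_continuous|]; apply: cvgM; [exact: cvg_cst|exact: EP].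
  have cL : \sum_(l < n) f (x - mesh T n l.+1) * E n l h @[h --> 0^'] --> lower_sum f g T n x.
    apply: cvg_big => [|l _]; [exact: add_continuous|]; apply: cvgM; [exact: cvg_cst|exact: EP].
  near=> h.
  have hn0 : h != 0 by near: h; exact: nbhs_dnbhs_neq.
  have /andP[D1 D2] := DE n h n0 hn0.
  have : `|upper_sum f g T n x - \sum_(l < n) f (x - mesh T n l) * E n l h| < e / 3.
    by near: h; by move/cvgrPdist_lt: cU; apply.
  have : `|lower_sum f g T n x - \sum_(l < n) f (x - mesh T n l.+1) * E n l h| < e / 3.
    by near: h; by move/cvgrPdist_lt: cL; apply.
  rewrite !ltr_norml => /andP[a1 a2] /andP[b1 b2]; apply/andP; split; lra.
have DJ' : (fun h => h^-1 *: ((conv_segment \o shift x) (h *: 1) - conv_segment x)) @ 0^' --> J x.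
  apply: cvg_trans DJ; apply: near_eq_cvg; near=> h.
  by rewrite /D /= /shift /= /GRing.scale /= mulr1 (addrC x h).
apply: DeriveDef; first by apply/cvg_ex; exists (J x).
exact/cvg_lim.
Unshelve. all: by end_near. Qed.

End QuasiPeriodicConvolution.

(** * The convolution of the periodic factors *)

Section StieltjesIntegral.
Variables (R : realType) (f : R -> R) (c : cumulative R R) (T : R).
Hypotheses (f_cont : continuous f) (c_cont : continuous c) (f_nd : nondecreasing f)
  (T_gt0 : 0 < T).
Local Notation nu := (lebesgue_stieltjes_measure c).

Lemma stieltjes_measure_oc (a b : R) : a <= b -> nu `]a, b] = (c b - c a)%:E.
Proof.
move=> ab; rewrite /lebesgue_stieltjes_measure /measure_extension /=.
by rewrite measurable_mu_extE /= ?wlength_itv_bnd //; exact: is_ocitv.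
Qed.

Lemma stieltjes_measure_set1 (a : R) : nu [set a] = 0%E.
Proof.
apply/eqP; rewrite eq_le measure_ge0 andbT.
apply/lee_addgt0Pr => e e0; rewrite add0e.
have /cvgrPdist_lt /(_ e e0) /nbhs_ballP [r /= r0 rP] := @c_cont a.
have r20 : 0 < r / 2 by rewrite divr_gt0.
apply: (@le_trans _ _ (nu `]a - r / 2, a])).
  apply: le_measure; rewrite ?inE //=.
  by move=> _ /= ->; rewrite in_itv /= lexx andbT ltrBlDr ltrDl.
rewrite stieltjes_measure_oc ?lerBlDr ?lerDl ?(ltW r20) // lee_fin.
have := rP (a - r / 2); rewrite /ball /= opprB addrC subrK gtr0_norm //.
have rr : r / 2 < r by rewrite ltr_pdivrMr // ltr_pMr // ltr1n.
by move=> /(_ rr) /ltW; apply: le_trans; exact: ler_norm.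
Qed.

Lemma stieltjes_measure_cc_fin (a b : R) : (nu `[a, b] < +oo)%E.
Proof.
have [ab|ba] := leP a b; last by rewrite set_itv_ge ?measure0 // bnd_simp -ltNge.
have ab1 : a - 1 <= b by rewrite lerBlDr (le_trans ab) // lerDl.
apply: (@le_lt_trans _ _ (nu `]a - 1, b])).
  apply: le_measure; rewrite ?inE //= => x /=; rewrite !in_itv /= => /andP[ax ->].
  by rewrite andbT (lt_le_trans _ ax) // ltrBlDr ltrDl.
by rewrite stieltjes_measure_oc // ltry.
Qed.

Lemma stieltjes_integrable (k : R -> R) (a b : R) : continuous k ->
  nu.-integrable `[a, b] (EFin \o k).
Proof.
move=> ck.
apply: measurable_bounded_integrable => //.
- exact: stieltjes_measure_cc_fin.
- by apply: measurable_funTS; exact: measurable_realfun.continuous_measurable_fun.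
- have cfab : {within `[a, b], continuous k}.
    exact: continuous_subspaceT.
  have /(@compact_bounded R R^o) [M [_ mrt]] := continuous_compact cfab (@segment_compact R a b).
  by exists M; split; rewrite ?num_real // => N MN y yab; apply: mrt => //; exists y.
Qed.

Definition stieltjes_conv (x : R) : R := \int[nu]_(y in `[0, T]) f (x - y).

Lemma stieltjes_cell (x a b : R) : a <= b ->
  f (x - b) * (c b - c a) <= \int[nu]_(y in `]a, b]) f (x - y) <=
  f (x - a) * (c b - c a).
Proof.
move=> ab.
have int_f : nu.-integrable `]a, b] (EFin \o (fun y => f (x - y))).
  apply: integrableS (stieltjes_integrable a b (@continuous_reflect _ _ x f_cont)) => //.
  by move=> y /=; rewrite !in_itv /= => /andP[/ltW -> ->].
have int_cst k : nu.-integrable `]a, b] (EFin \o (fun=> k : R)).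
  have ck : continuous (fun _ : R => k) by move=> y; exact: cvg_cst.
  apply: integrableS (stieltjes_integrable a b ck) => //.
  by move=> y /=; rewrite !in_itv /= => /andP[/ltW -> ->].
have cstE k : \int[nu]_(y in `]a, b]) k = k * (c b - c a).
  by rewrite Rintegral_cst //= stieltjes_measure_oc.
rewrite -!cstE; apply/andP; split; apply: le_Rintegral => // y /=;
  by rewrite in_itv /= => /andP[ay yb]; apply: f_nd; lra.
Qed.

Lemma stieltjes_conv_between n x : (0 < n)%N ->
  lower_sum f c T n x <= stieltjes_conv x <= upper_sum f c T n x.
Proof.
move=> n0.
have step : forall m, (m <= n)%N ->
    \sum_(l < m) f (x - mesh T n l.+1) * (c (mesh T n l.+1) - c (mesh T n l)) <=
    \int[nu]_(y in `[0, mesh T n m]) f (x - y) <=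
    \sum_(l < m) f (x - mesh T n l) * (c (mesh T n l.+1) - c (mesh T n l)).
  elim=> [|m IH] mn.
    (* The cells are half-open while the integral is over a closed segment; the remaining point 0 is
       null because [c] is continuous. *)
    rewrite !big_ord0 mesh0 set_itv1 /Rintegral null_set_integral ?lexx //.
      by apply: measurable_fun_set1.
    exact: stieltjes_measure_set1.
  have m0 : 0 <= mesh T n m by exact: mesh_ge0.
  have mm : mesh T n m <= mesh T n m.+1 by apply: mesh_le.
  rewrite !big_ord_recr /=.
  rewrite (@itv_bndbnd_setU _ _ _ (BRight (mesh T n m))) ?bnd_simp //.
  rewrite Rintegral_setU //; last 2 first.
  - rewrite -itv_bndbnd_setU ?bnd_simp //; exact: (stieltjes_integrable _ _ (@continuous_reflect _ _ x f_cont)).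
  - apply/disj_setPRL => y /=; rewrite !in_itv /= => /andP[y1 _] /andP[_ y2].
    by move: y1; rewrite ltNge y2.
  have /andP[h1 h2] := IH (ltnW mn).
  have /andP[h3 h4] := stieltjes_cell x mm.
  by apply/andP; split; apply: lerD.
by have := step n (leqnn n); rewrite meshn.
Qed.

End StieltjesIntegral.

Lemma periodic_reduce (R : realType) (T x : R) : 0 < T ->
  exists2 y, 0 <= y <= T & forall h : R -> R, periodic h T -> h x = h y.
Proof.
move=> T0; pose k := Num.floor (x / T); pose y := x - k%:~R * T.
have /andP[k1 k2] := floor_itv (x / T).
exists y.
  rewrite /y subr_ge0 -ler_pdivlMr // k1 /=.
  move: k2; rewrite ltr_pdivrMr // intrD mulrDl mul1r => /ltW.
  by rewrite lerBlDr addrC.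
move=> h ph; have hn n u : h (u + n%:R * T) = h u.
  by rewrite mulr_natl periodicn.
rewrite /y; case: k {k1 k2 y} => n.
  by rewrite -[LHS](congr1 h (subrK (n%:R * T) x)) hn.
by rewrite NegzE mulrNz mulNr opprK -[in RHS]pmulrn hn.
Qed.

Section TensorDensity.
Variables (R : realType) (p T : R) (s1 s2 : R -> R).
Hypotheses (p_gt0 : 0 < p) (T_gt0 : 0 < T)
  (s1_per : continuous_positive_periodic T s1)
  (rho1_nd : nondecreasing (rho p s1))
  (s2_per : continuous_positive_periodic T s2)
  (rho2_nd : nondecreasing (rho p s2)).
Local Notation f := (rho p s1).
Local Notation g := (rho p s2).
Local Notation q := (expR (T / p)).

Lemma rho_continuous s : continuous_positive_periodic T s -> continuous (rho p s).
Proof.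
move=> [cs _ _] x; apply: cvgM; last exact: cs.
apply: continuous_comp; last exact: continuous_expR.
by apply: cvgM; [exact: cvg_id|exact: cvg_cst].
Qed.

Lemma rho_quasi_periodic s x : continuous_positive_periodic T s ->
  rho p s (x + T) = q * rho p s x.
Proof. by move=> [_ _ ps]; rewrite /rho mulrDl expRD ps mulrCA mulrA. Qed.

Lemma rho_gt0 s x : continuous_positive_periodic T s -> 0 < rho p s x.
Proof. by move=> [_ s0 _]; rewrite mulr_gt0 ?expR_gt0. Qed.

(** The weights e^(-x/p), e^((x - y)/p) and e^(y/p) cancel. This trades the periodic factors for the
    monotone functions [rho], to which Stieltjes sums apply. *)
Lemma periodic_convE x :
  periodic_conv T s1 s2 x = T^-1 * (expR (- x / p) * conv_segment f g T x).
Proof.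
have [[c1 _ _] [c2 _ _]] := (s1_per, s2_per).
rewrite /periodic_conv -/(segint 0 T _); congr (_ * _).
rewrite /conv_segment -segintZ; last first.
  move=> y _; apply: cvgM; last exact: (rho_continuous s2_per).
  exact/continuous_reflect/(rho_continuous s1_per).
apply: eq_segint => y _; rewrite /rho.
have -> : expR ((x - y) / p) = expR (x / p) * (expR (y / p))^-1.
  by rewrite mulrBl expRD expRN.
have e0 := expR_gt0 (y / p); have e1 := expR_gt0 (x / p).
rewrite mulNr expRN; field; rewrite !gt_eqF //.
Qed.

Local Notation J := (stieltjes_conv f (rho_cumulative s2_per rho2_nd) T).

Let J_between n x : (0 < n)%N -> lower_sum f g T n x <= J x <= upper_sum f g T n x.
Proof.
move=> n0; apply: (stieltjes_conv_between (c := rho_cumulative s2_per rho2_nd)) => //.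
- exact: rho_continuous.
- exact: rho_continuous.
Qed.

Lemma is_derive_periodic_conv (x : R) : is_derive x 1 (periodic_conv T s1 s2)
  (T^-1 * (expR (- x / p) * J x - p^-1 * (expR (- x / p) * conv_segment f g T x))).
Proof.
have dC : is_derive x 1 (conv_segment f g T) (J x).
  apply: (@is_derive_conv_segment _ f g T q) => //; try exact: rho_continuous.
  - by move=> y; apply: rho_quasi_periodic.
  - by move=> y; apply: rho_quasi_periodic.
have dE : is_derive x 1 (fun y => expR (- y / p)) (expR (- x / p) * - p^-1).
  have -> : (fun y => expR (- y / p)) = expR \o ((- p^-1) \*: id).
    by apply/funext => y /=; rewrite /GRing.scale /= mulNr mulrC mulNr.
  rewrite (_ : - x / p = ((- p^-1) \*: id) x); last first.
    by rewrite /= /GRing.scale /= mulNr mulrC mulNr.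
  apply: is_derive1_comp; rewrite -[X in is_derive _ _ _ X]mulr1.
  exact: is_deriveZ.
have -> : periodic_conv T s1 s2 =
    T^-1 \*: ((fun y => expR (- y / p)) * conv_segment f g T).
  by apply/funext => y; rewrite periodic_convE.
apply: (is_derive_eq (is_deriveZ _ (is_deriveM dE dC))).
by rewrite /GRing.scale /=; ring.
Qed.

(** The summand [periodic_conv / p] is what cancels the derivative of the weight e^(-x/p). *)
Lemma s_tensorE x : s_tensor p T s1 s2 x = expR (- x / p) * (T^-1 * J x).
Proof.
have dP := is_derive_periodic_conv x.
by rewrite /s_tensor derive1E derive_val periodic_convE; ring.
Qed.

Lemma scaled_sum_periodic (F : R -> R) : (forall x, F (x + T) = q * F x) ->
  periodic (fun x => expR (- x / p) * F x) T.
Proof.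
move=> FT x; rewrite FT opprD mulrDl expRD mulNr [- T / p]mulNr !expRN.
by field; rewrite !gt_eqF ?expR_gt0.
Qed.

Let upper_sumT n x : upper_sum f g T n (x + T) = q * upper_sum f g T n x.
Proof.
rewrite /upper_sum mulr_sumr; apply: eq_bigr => l _.
by rewrite addrAC rho_quasi_periodic // mulrA.
Qed.

Let lower_sumT n x : lower_sum f g T n (x + T) = q * lower_sum f g T n x.
Proof.
rewrite /lower_sum mulr_sumr; apply: eq_bigr => l _.
by rewrite addrAC rho_quasi_periodic // mulrA.
Qed.

(** The weighted gap is T-periodic, so x may be taken in [0, T], where the weight is at most 1 and
    all nodes x - mesh lie in [-T, T]; one modulus of continuity then serves all x. *)
Lemma upper_lower_uniform e : 0 < e -> exists2 n, (0 < n)%N &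
  forall x, expR (- x / p) * (upper_sum f g T n x - lower_sum f g T n x) <= e.
Proof.
move=> e0; have D0 : 0 <= g T - g 0 by rewrite subr_ge0; apply: rho2_nd; exact: ltW.
have e'0 : 0 < e / (g T - g 0 + 1) by rewrite divr_gt0 // ltr_wpDl.
have [d d0 dP] := heine_segment (- T) T (rho_continuous s1_per) e'0.
pose n := (Num.truncn (T / d)).+1.
have nT : T / n%:R < d.
  by rewrite ltr_pdivrMr ?ltr0n // mulrC -ltr_pdivrMr // truncnS_gt.
exists n => // x.
have per : periodic (fun x => expR (- x / p) *
    (upper_sum f g T n x - lower_sum f g T n x)) T.
  by apply: scaled_sum_periodic => y; rewrite upper_sumT lower_sumT mulrBr.
have [y /andP[y0 yT] /(_ _ per) /= ->] := periodic_reduce x T_gt0.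
have le1 : expR (- y / p) <= 1.
  by rewrite -expR0 ler_expR mulNr oppr_le0 divr_ge0 // ltW.
have gap : upper_sum f g T n y - lower_sum f g T n y <= e.
  apply: le_trans (upper_lower_gap (w := e / (g T - g 0 + 1)) rho2_nd T_gt0 _ _) _ => //.
    move=> l ln; apply: le_trans (ler_norm _) (ltW _); apply: dP.
      have := mesh_ge0 T_gt0 n l; have := mesh_leT T_gt0 (ltnW ln); lra.
    rewrite opprB addrC subrKA /mesh -mulrBl -natr1 addrAC subrr add0r mul1r.
    by rewrite gtr0_norm // divr_gt0 // ltr0n.
  by rewrite -mulrAC ler_pdivrMr ?ltr_wpDl // ler_pM2l // lerDl.
have gap0 : 0 <= upper_sum f g T n y - lower_sum f g T n y.
  by have /andP[h1 h2] := @J_between n y isT; rewrite subr_ge0 (le_trans h1).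
by apply: le_trans gap; rewrite ler_piMl.
Qed.

Lemma s_tensor_approx e : 0 < e -> exists2 n, (0 < n)%N & forall x,
  `|expR (- x / p) * upper_sum f g T n x - T * s_tensor p T s1 s2 x| <= e /\
  `|expR (- x / p) * lower_sum f g T n x - T * s_tensor p T s1 s2 x| <= e.
Proof.
move=> e0; have [n n0 nP] := upper_lower_uniform e0; exists n => // x.
have -> : T * s_tensor p T s1 s2 x = expR (- x / p) * J x.
  by rewrite s_tensorE mulrCA [T * _]mulrA mulfV ?gt_eqF // mul1r.
have /andP[h1 h2] := J_between x n0; have ee := expR_ge0 (- x / p).
have := ler_wpM2l ee h1; have := ler_wpM2l ee h2; have := nP x.
rewrite mulrBr !ler_norml => a1 a2 a3; split; lra.
Qed.

(** Continuity comes from uniform approximation by weighted upper sums. Positivity is visible in the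
    lower sum with a single cell, since rho2(T) = e^(T/p) rho2(0) > rho2(0). *)
Lemma s_tensor_continuous_positive_periodic :
  continuous_positive_periodic T (s_tensor p T s1 s2).
Proof.
split.
- move=> x; apply/cvgrPdist_lt => e e0.
  have e3 : 0 < T * e / 3 by rewrite !divr_gt0 // mulr_gt0.
  have [n n0 nP] := s_tensor_approx e3.
  pose F y := expR (- y / p) * upper_sum f g T n y.
  have cF : {for x, continuous F}.
    apply: cvgM.
      apply: continuous_comp; last exact: continuous_expR.
      by apply: cvgM; [apply: cvgN; exact: cvg_id|exact: cvg_cst].
    apply: cvg_big => [|l _]; first exact: add_continuous.
    apply: cvgM; last exact: cvg_cst.
    exact/continuous_translate/(rho_continuous s1_per).
  move/cvgrPdist_lt : cF => /(_ _ e3); apply: filterS => y Fxy.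
  have [a _] := nP x; have [b _] := nP y; rewrite -/(F x) -/(F y) in a b.
  rewrite -(ltr_pM2l T_gt0) -(gtr0_norm T_gt0) -normrM (gtr0_norm T_gt0) mulrBr.
  move: a b Fxy; rewrite !ler_norml !ltr_norml => /andP[a1 a2] /andP[b1 b2] /andP[c1 c2].
  apply/andP; split; lra.
- move=> x; rewrite s_tensorE !mulr_gt0 ?expR_gt0 ?invr_gt0 //.
  have /andP[h _] := @J_between 1 x isT; apply: lt_le_trans h.
  rewrite /lower_sum big_ord1 mesh0 meshn // mulr_gt0 ?rho_gt0 // subr_gt0.
  have := rho_quasi_periodic 0 s2_per; rewrite add0r => ->.
  rewrite ltr_pMl ?rho_gt0 //.
  by rewrite -expR0 ltr_expR divr_gt0.
- move=> x; rewrite /s_tensor.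
  have pp : periodic (periodic_conv T s1 s2) T.
    move=> y; rewrite /periodic_conv; congr (_ * _); apply: eq_Rintegral => z _.
    by have [_ _ ps] := s1_per; rewrite addrAC ps.
  rewrite pp; congr (_ + _); rewrite !derive1E /derive.
  set u := (X in lim (X @ _) = _); set v := (X in _ = lim (X @ _)).
  suff -> : u = v by [].
  by apply/funext => h; rewrite /u /v /= /shift /= addrA !pp.
Qed.

End TensorDensity.

(** * Convolution of slowly varying functions *)

Section LogConvolution.
Variable R : realType.
Implicit Types (a : R -> R) (x y e B K M : R).

(** The Mellin convolution in the variable ln; [mellin_conv_log] makes this precise. *)
Definition log_conv (a1 a2 : R -> R) x : R := segint 0 x (fun u => a1 (x - u) * a2 u).

(* What the asymptotics uses of the function phi (expR x); the derivatives of
   phi only serve to make the slow variation uniform over bounded shifts. *)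
Record log_slow a : Prop := LogSlow {
  log_slow_cont : continuous a;
  log_slow_gt0 : forall x, 0 < a x;
  log_slow_shift : forall e B, 0 < e -> exists M, forall x y, M <= x -> M <= y ->
    `|x - y| <= B -> a x <= (1 + e) * a y;
  log_slow_int : forall C, exists2 K, 0 <= K & C <= segint 0 K a }.

Let contM (u v : R -> R) (l r : R) : continuous u -> continuous v ->
  continuous_on l r (fun y => u y * v y).
Proof. by move=> cu cv y _; apply: cvgM; [exact: cu|exact: cv]. Qed.

Lemma log_conv_integrand_cont a1 a2 x (l r : R) : log_slow a1 -> log_slow a2 ->
  continuous_on l r (fun u => a1 (x - u) * a2 u).
Proof.
by move=> h1 h2; apply: contM; [apply: continuous_reflect|]; exact: log_slow_cont.
Qed.

Lemma log_convC a1 a2 x : log_slow a1 -> log_slow a2 -> 0 <= x ->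
  log_conv a1 a2 x = log_conv a2 a1 x.
Proof.
move=> h1 h2 x0; rewrite /log_conv.
have [| | | |_] := @segint_subst _ (-1) (x + 1) 0 x (fun u => x - u) (fun=> -1)
  (fun u => a1 (x - u) * a2 u) x0.
- by move=> y _; apply: (@log_conv_integrand_cont a1 a2 x y y h1 h2); rewrite lexx.
- by move=> y /andP[y0 yx]; lra.
- by move=> y _; rewrite -[X in is_derive _ _ _ X]add0r; apply: is_deriveB.
- by move=> y _; exact: cvg_cst.
rewrite subrr subr0 => /(_ x0) ->.
rewrite -[LHS]mulN1r -segintZ; last first.
  apply: contM; last by move=> y; exact: cvg_cst.
  move=> y; apply: cvgM; last exact/continuous_reflect/log_slow_cont.
  apply: (@continuous_reflect _ (fun v => a1 (x - v)) x).
  by apply: continuous_reflect; exact: log_slow_cont.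
by apply: eq_segint => u _; rewrite opprB addrC subrK mulrN1 mulN1r opprK mulrC.
Qed.

Section Domination.
Variables a1 a2 : R -> R.
Hypotheses (h1 : log_slow a1) (h2 : log_slow a2).
Local Notation A := (log_conv a1 a2).

Let ci x l r : continuous_on l r (fun u => a1 (x - u) * a2 u).
Proof. exact: log_conv_integrand_cont. Qed.

Let ige0 x u : 0 <= a1 (x - u) * a2 u.
Proof. by rewrite mulr_ge0 // ltW // log_slow_gt0. Qed.

Lemma log_conv_part_le x l r : 0 <= l -> l <= r -> r <= x ->
  segint l r (fun u => a1 (x - u) * a2 u) <= A x.
Proof.
move=> l0 lr rx; rewrite /log_conv (@segint_split _ 0 l x) ?l0 ?(le_trans lr) //.
rewrite (@segint_split _ l r x) ?lr //.
have i1 : 0 <= segint 0 l (fun u => a1 (x - u) * a2 u) by apply: segint_ge0.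
have i2 : 0 <= segint r x (fun u => a1 (x - u) * a2 u) by apply: segint_ge0.
by lra.
Qed.

Lemma log_conv_ge0 x : 0 <= A x.
Proof. exact: segint_ge0. Qed.

(* On [0, K] the integrand is about a1 x * a2 u, and the integral of a2 over
   [0, K] is as large as desired. *)
Lemma log_conv_dominates_left C : 0 <= C -> exists X, forall x, X <= x -> C * a1 x <= A x.
Proof.
move=> C0; have [K K0 KC] := log_slow_int h2 (2 * C).
have [M MP] := log_slow_shift h1 K ltr01.
exists (Num.max (M + K) K) => x; rewrite ge_max => /andP[xM xK].
have a0 := log_slow_gt0 h1 x.
apply: (@le_trans _ _ (segint 0 K (fun u => a1 (x - u) * a2 u))); last first.
  exact: log_conv_part_le.
apply: (@le_trans _ _ (segint 0 K (fun u => a1 x / 2 * a2 u))).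
  rewrite segintZ; last by move=> y _; exact: log_slow_cont.
  by nra.
apply: ler_segint => //.
- by apply: contM; [move=> y; exact: cvg_cst|exact: log_slow_cont].
move=> u /andP[u0 uK]; rewrite ler_wpM2r ?(ltW (log_slow_gt0 h2 u)) //.
have : a1 x <= (1 + 1) * a1 (x - u).
  apply: MP; [lra|lra|]; rewrite opprB addrC subrK ger0_norm //.
by lra.
Qed.

End Domination.

Section SlowVariation.
Variables a1 a2 : R -> R.
Hypotheses (h1 : log_slow a1) (h2 : log_slow a2).
Local Notation A := (log_conv a1 a2).

(** The bound for [a1] rests on the divergent integral of [a2], and the other one on that of [a1] by
    commutativity. Both are used to discard the two ends of the convolution. *)
Lemma log_conv_dominates C : 0 <= C -> exists X, forall x, X <= x ->
  C * a1 x <= A x /\ C * a2 x <= A x.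
Proof.
move=> C0; have [X1 P1] := log_conv_dominates_left h1 h2 C0.
have [X2 P2] := log_conv_dominates_left h2 h1 C0.
exists (Num.max (Num.max X1 X2) 0) => x; rewrite !ge_max => /andP[/andP[x1 x2] x0].
by split; [exact: P1|rewrite log_convC //; exact: P2].
Qed.

Lemma log_slow_bounded a (l r : R) : log_slow a ->
  exists2 C, 0 < C & forall u, l <= u <= r -> a u <= C.
Proof.
move=> ha; have [lr|rl] := leP l r; last first.
  by exists 1 => // u /andP[lu ur]; have := le_lt_trans (le_trans lu ur) rl; rewrite ltxx.
have cw : {within `[l, r], continuous a}.
  by apply: continuous_on_within => x _; exact: log_slow_cont.
have [m _ mP] := EVT_max lr cw; exists (a m); first exact: log_slow_gt0.
by move=> u lur; apply: mP; rewrite in_itv.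
Qed.

(** On this window of length M + c the factor [a1] is evaluated on the compact [0, M + c], hence is
    at most some C, and a2(u) <= 2 a2(x). The integral is thus at most [D] a2(x), and a2 is
    negligible against the convolution. *)
Lemma log_conv_tail_small M c e : 0 <= M -> 0 <= c -> 0 < e -> exists X, forall x, X <= x ->
  segint (x - M) (x + c) (fun u => a1 (x + c - u) * a2 u) <= e * A x.
Proof.
move=> M0 c0 e0.
have [C C0 CP] := @log_slow_bounded a1 0 (M + c) h1.
have [N NP] := log_slow_shift h2 (M + c) ltr01.
pose D := C * 2 * (M + c).
have D0 : 0 <= D / e by rewrite divr_ge0 ?(ltW e0) // mulr_ge0 ?addr_ge0 // mulr_ge0 ?(ltW C0).
have [X XP] := log_conv_dominates D0.
exists (Num.max X (N + M)) => x; rewrite ge_max => /andP[xX xN].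
have [_ dom] := XP _ xX.
have a0 := log_slow_gt0 h2 x.
apply: (@le_trans _ _ (segint (x - M) (x + c) (fun=> C * (2 * a2 x)))).
  apply: ler_segint.
  - exact: log_conv_integrand_cont.
  - by move=> y _; exact: cvg_cst.
  move=> u /andP[u1 u2]; apply: ler_pM.
  - exact/ltW/log_slow_gt0.
  - exact/ltW/log_slow_gt0.
  - by apply: CP; lra.
  - apply: NP; [lra|lra|]; rewrite ler_norml; lra.
rewrite segint_cst; last by lra.
rewrite [leRHS]mulrC -ler_pdivrMr // (le_trans _ dom) // /D le_eqVlt; apply/orP; left.
by apply/eqP; field; rewrite gt_eqF.
Qed.

Lemma log_conv_head_small K e : 0 <= K -> 0 < e -> exists X, forall x, X <= x ->
  segint 0 K (fun u => a1 (x - u) * a2 u) <= e * A x.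
Proof.
move=> K0 e0.
have [N NP] := log_slow_shift h1 K ltr01.
pose D := 2 * segint 0 K a2.
have D0 : 0 <= D / e.
  by rewrite divr_ge0 ?(ltW e0) // mulr_ge0 //; apply: segint_ge0 => u _; exact/ltW/log_slow_gt0.
have [X XP] := log_conv_dominates D0.
exists (Num.max X (N + K)) => x; rewrite ge_max => /andP[xX xN].
have [dom _] := XP _ xX.
apply: (@le_trans _ _ (segint 0 K (fun u => 2 * a1 x * a2 u))).
  apply: ler_segint.
  - exact: log_conv_integrand_cont.
  - by apply: contM; [move=> y; exact: cvg_cst|exact: log_slow_cont].
  move=> u /andP[u0 uK]; rewrite ler_wpM2r ?(ltW (log_slow_gt0 h2 u)) //.
  apply: NP; [lra|lra|]; rewrite ler_norml; lra.
rewrite segintZ; last by move=> y _; exact: log_slow_cont.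
rewrite [leRHS]mulrC -ler_pdivrMr // (le_trans _ dom) // /D le_eqVlt; apply/orP; left.
by apply/eqP; field; rewrite gt_eqF.
Qed.

(** For u <= x - M the arguments of [a1] stay beyond the threshold of its slow variation, so
    shifting costs a factor 1 + e/2; the rest is a small tail. In the second bound the tail is
    measured by A x, and this term is absorbed in the next lemma. *)
Lemma log_conv_shift_nonneg c e : 0 <= c -> 0 < e -> exists X, forall x, X <= x ->
  A (x + c) <= (1 + e) * A x /\ A x <= (1 + e) * A (x + c) + e * A x.
Proof.
move=> c0 e0; have e20 : 0 < e / 2 by rewrite divr_gt0.
have [N NP] := log_slow_shift h1 c e20.
have [M M0 NM] : exists2 M : R, 0 <= M & N <= M.
  by exists (Num.max N 0); rewrite le_max lexx ?orbT.
have [X1 P1] := log_conv_tail_small M0 c0 e20.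
have [X2 P2] := log_conv_tail_small M0 (lexx 0) e0.
exists (Num.max (Num.max X1 X2) M) => x; rewrite !ge_max => /andP[/andP[x1 x2] xM].
have {}P1 := P1 _ x1; have {}P2 := P2 _ x2; rewrite addr0 in P2.
have cE y l r : continuous_on l r (fun u => a1 (y - u) * a2 u).
  exact: log_conv_integrand_cont.
have splitA y : x - M <= y -> A y = segint 0 (x - M) (fun u => a1 (y - u) * a2 u) +
    segint (x - M) y (fun u => a1 (y - u) * a2 u).
  by move=> xy; apply: segint_split => //; rewrite xy subr_ge0 xM.
have cmp y z : x <= y -> x <= z -> `|y - z| <= c ->
    segint 0 (x - M) (fun u => a1 (y - u) * a2 u) <=
    (1 + e / 2) * segint 0 (x - M) (fun u => a1 (z - u) * a2 u).
  move=> xy xz yz; rewrite -segintZ //; apply: ler_segint => //.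
    move=> u _; apply: cvgM; first exact: cvg_cst.
    by apply: (cE z u u); rewrite lexx.
  move=> u /andP[u0 ux]; rewrite mulrA ler_wpM2r ?(ltW (log_slow_gt0 h2 u)) //.
  apply: NP; [lra|lra|].
  by rewrite opprB addrA subrK.
have i0 y l r : 0 <= segint l r (fun u => a1 (y - u) * a2 u).
  by apply: segint_ge0 => u _; rewrite mulr_ge0 // ltW // log_slow_gt0.
have xc : x <= x + c by rewrite lerDl.
have n1 : `|x + c - x| <= c by rewrite addrAC subrr add0r ger0_norm.
have n2 : `|x - (x + c)| <= c by rewrite distrC.
have := cmp _ _ xc (lexx x) n1; have := cmp _ _ (lexx x) xc n2.
have := splitA (x + c) ltac:(lra); have := splitA x ltac:(lra).
have := i0 x (x - M) x; have := i0 (x + c) (x - M) (x + c).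
have := i0 x 0 (x - M); have := i0 (x + c) 0 (x - M).
move: P1 P2.
move: (A x) (A (x + c)) (segint _ _ _) (segint _ _ _) (segint _ _ _) (segint _ _ _).
move=> Ax Ac u0 u1 u2 u3 r1 r2 p0 p1 p2 p3 eA eC q1 q2.
have m0 := mulr_ge0 (ltW e0) p0; have m1 := mulr_ge0 (ltW e0) p1.
have m2 := mulr_ge0 (ltW e0) p2; have m3 := mulr_ge0 (ltW e0) p3.
by rewrite eA eC; rewrite eA in r1 r2; split; lra.
Qed.

Lemma log_conv_slow c e : 0 < e -> exists X, forall x, X <= x ->
  A (x + c) <= (1 + e) * A x /\ A x <= (1 + e) * A (x + c).
Proof.
move=> e0; wlog c0 : c / 0 <= c.
  move=> h; have [/h //|c0] := leP 0 c.
  have [|X XP] := h (- c); first by rewrite oppr_ge0 ltW.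
  exists (X - c) => x; rewrite lerBlDr => /XP [].
  by rewrite addrK.
(* Absorbing the tail gives (1 - d) A x <= (1 + d) A (x + c); 4 d <= min(e, 1) ensures 1 + d <= (1 -
   d) (1 + e). *)
pose d := Num.min e 1 / 4.
have m0 : 0 < Num.min e 1 by rewrite lt_min e0 ltr01.
have d0 : 0 < d by rewrite divr_gt0.
have de : 4 * d <= e by rewrite /d mulrC divfK // ge_min lexx.
have d1 : 4 * d <= 1 by rewrite /d mulrC divfK // ge_min lexx orbT.
have [X XP] := log_conv_shift_nonneg c0 d0.
exists X => x /XP [u v]; have Ax := log_conv_ge0 h1 h2 x; have Ac := log_conv_ge0 h1 h2 (x + c).
move: (A x) (A (x + c)) u v Ax Ac => y z u v y0 z0; split.
  by apply: (le_trans u); rewrite ler_wpM2r //; lra.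
have k1 : (1 - d) * y <= (1 + d) * z by lra.
have k2 : (1 + d) <= (1 - d) * (1 + e) by nra.
have k3 : (1 - d) * y <= (1 - d) * ((1 + e) * z).
  by rewrite mulrA (le_trans k1) // ler_wpM2r.
by rewrite -(@ler_pM2l _ (1 - d)) //; lra.
Qed.

End SlowVariation.
End LogConvolution.

(** * Asymptotics of the counting function *)

Section Asymptotics.
Variables (R : realType) (p T : R).
Hypotheses (p_gt0 : 0 < p) (T_gt0 : 0 < T).
Implicit Types (x y z e M B : R).

Lemma periodic_bounded (s : R -> R) : continuous_positive_periodic T s ->
  exists2 B, 0 < B & forall x, s x <= B.
Proof.
move=> [cs s0 ps]; have T0 := ltW T_gt0.
have cw : {within `[0, T], continuous s} by exact: continuous_subspaceT.
have [m _ mP] := EVT_max T0 cw; exists (s m) => // x.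
by have [y yT /(_ _ ps) ->] := periodic_reduce x T_gt0; apply: mP; rewrite in_itv.
Qed.

Lemma periodic_lower_bound (s : R -> R) : continuous_positive_periodic T s ->
  exists2 m, 0 < m & forall x, m <= s x.
Proof.
move=> [cs s0 ps]; have T0 := ltW T_gt0.
have cw : {within `[0, T], continuous s} by exact: continuous_subspaceT.
have [m _ mP] := EVT_min T0 cw; exists (s m) => // x.
by have [y yT /(_ _ ps) ->] := periodic_reduce x T_gt0; apply: mP; rewrite in_itv.
Qed.

(** The error is measured by a(x) e^(x/p), without the oscillating factor s, so that errors at
    nearby points can be compared. *)
Definition rho_asymptotic (a s f : R -> R) := forall e, 0 < e ->
  exists X, forall x, X <= x ->
    `|f x - a x * rho p s x| <= e * (a x * expR (x / p)).

(** The slowly varying factor is frozen at one point y of the window, while [rho] keeps its argument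
    z. In 2 (1 + S) Q the 1 accounts for the error of [f], the S for the freezing, and Q for the
    growth of e^(z/p) over the window. *)
Lemma rho_asymptotic_window a s f e B : log_slow a ->
  continuous_positive_periodic T s -> rho_asymptotic a s f -> 0 < e ->
  exists M, forall y z, M <= y -> M <= z -> `|z - y| <= B ->
    `|f z - a y * rho p s z| <= e * (a y * expR (y / p)).
Proof.
move=> ha hs fa e0; have [S S0 sS] := periodic_bounded hs.
pose Q := expR (B / p); have Q0 : 0 < Q by exact: expR_gt0.
have D0 : 0 < 2 * (1 + S) * Q by rewrite !mulr_gt0 // addr_gt0.
pose d := Num.min 1 (e / (2 * (1 + S) * Q)).
have d0 : 0 < d by rewrite lt_min ltr01 divr_gt0.
have d1 : d <= 1 by rewrite ge_min lexx.
have dD : d * (2 * (1 + S) * Q) <= e by rewrite -ler_pdivlMr // ge_min lexx orbT.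
have [X XP] := fa _ d0; have [N NP] := log_slow_shift ha B d0.
exists (Num.max X N) => y z; rewrite !ge_max => /andP[Xy Ny] /andP[Xz Nz] zy.
have yz : `|y - z| <= B by rewrite distrC.
have fz := XP _ Xz; have azy := NP _ _ Nz Ny zy; have ayz := NP _ _ Ny Nz yz.
have ez : expR (z / p) <= Q * expR (y / p).
  rewrite /Q -expRD ler_expR -mulrDl ler_pM2r ?invr_gt0 //.
  by move: zy; rewrite ler_norml => /andP[_]; rewrite lerBlDr.
have rz : rho p s z <= S * (Q * expR (y / p)).
  rewrite /rho mulrC; apply: ler_pM => //.
  by have [_ s0 _] := hs; exact/ltW.
have r0 : 0 < rho p s z by exact: (rho_gt0 _ _ hs).
have a0 := log_slow_gt0 ha y; have a0z := log_slow_gt0 ha z.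
have e1 := expR_gt0 (z / p); have e2 := expR_gt0 (y / p).
move: fz azy ayz ez rz r0 a0 a0z e1 e2.
move: (f z) (a z) (a y) (rho p s z) (expR (z / p)) (expR (y / p)).
move=> w az ay r E E' fz azy ayz ez rz r0 a0 a0z e1 e2.
have az2 : az <= 2 * ay by nra.
have daz : `|az - ay| <= 2 * d * ay by rewrite ler_norml; nra.
have t1 : d * (az * E) <= d * (2 * ay * (Q * E')).
  by rewrite ler_wpM2l ?(ltW d0) // ler_pM // ltW.
have t2 : `|(az - ay) * r| <= 2 * d * ay * (S * (Q * E')).
  by rewrite normrM (gtr0_norm r0) ler_pM // ltW.
have -> : w - ay * r = (w - az * r) + (az - ay) * r by ring.
apply: (le_trans (ler_normD _ _)); apply: (@le_trans _ _ (d * (2 * (1 + S) * Q) * (ay * E'))).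
  by lra.
by rewrite ler_wpM2r // mulr_ge0 // ltW.
Qed.

(** Made for one term of a Stieltjes sum: X is a value with error d, and Y an increment, a
    difference of two values, with error 2 d. *)
Lemma mulr_perturb (X Y P Q d b c : R) : 0 <= d -> d <= 1 ->
  `|X - P| <= d -> `|Y - Q| <= 2 * d -> `|P| <= b -> `|Q| <= c ->
  `|X * Y - P * Q| <= (2 * (b + 1) + c) * d.
Proof.
move=> d0 d1 XP YQ Pb Qc.
have -> : X * Y - P * Q = X * (Y - Q) + (X - P) * Q by ring.
apply: (le_trans (ler_normD _ _)); rewrite !normrM.
have Xb : `|X| <= b + 1.
  rewrite -(subrK P X) (le_trans (ler_normD _ _)) // addrC lerD //.
  exact: le_trans XP d1.
have h1 : `|X| * `|Y - Q| <= (b + 1) * (2 * d) by apply: ler_pM.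
have h2 : `|X - P| * `|Q| <= d * c by apply: ler_pM.
by lra.
Qed.

Variables (s1 s2 a1 a2 : R -> R).
Hypotheses (s1_per : continuous_positive_periodic T s1)
  (rho1_nd : nondecreasing (rho p s1))
  (s2_per : continuous_positive_periodic T s2)
  (rho2_nd : nondecreasing (rho p s2)).
Hypotheses (h1 : log_slow a1) (h2 : log_slow a2).
Local Notation rho1 := (rho p s1).
Local Notation rho2 := (rho p s2).
Local Notation S := (s_tensor p T s1 s2).
Local Notation A := (log_conv a1 a2).

Variables (f f1 f2 : R -> R) (G : R -> R -> R) (c : R).
Hypotheses (f1_asymp : rho_asymptotic a1 s1 f1) (f2_asymp : rho_asymptotic a2 s2 f2)
  (f1_nd : nondecreasing f1)
  (f1_ge0 : forall x, 0 <= f1 x) (f2_ge0 : forall x, 0 <= f2 x).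
Hypotheses
  (G_ge : forall x a b, a <= b -> f1 (x - b) * (f2 b - f2 a) <= G x b - G x a)
  (G_le : forall x a b, a <= b -> G x b - G x a <= f1 (x - a) * (f2 b - f2 a))
  (G_head : forall x a, 0 <= G x a <= f1 (x + c) * f2 a)
  (G_tail : forall x a, 0 <= f x - G x a <= f1 (x - a) * f2 (x + c)).

Lemma rho_translate s (k : nat) x : continuous_positive_periodic T s ->
  rho p s (x + k%:R * T) = expR (k%:R * T / p) * rho p s x.
Proof.
move=> [_ _ ps]; rewrite /rho mulrDl expRD mulr_natl periodicn //.
by rewrite mulrCA mulrA.
Qed.

(* o = 0 gives the upper and o = 1 the lower sum over the chunk [kT, (k+1)T]. *)
Lemma chunk_sum (o n : nat) e : (o <= 1)%N -> (0 < n)%N -> 0 < e ->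
  exists M, forall (k : nat) x, M <= k%:R * T -> M <= x - k.+1%:R * T ->
  `|expR (- x / p) * (\sum_(l < n) f1 (x - k%:R * T - mesh T n (l + o)) *
       (f2 (k%:R * T + mesh T n l.+1) - f2 (k%:R * T + mesh T n l)))
    - a1 (x - k%:R * T) * a2 (k%:R * T) * (expR (- x / p) *
      \sum_(l < n) rho1 (x - mesh T n (l + o)) *
       (rho2 (mesh T n l.+1) - rho2 (mesh T n l)))|
  <= e * (a1 (x - k%:R * T) * a2 (k%:R * T)).
Proof.
move=> o1 n0 e0; have [S1 S10 s1S] := periodic_bounded s1_per.
pose c2 := rho2 T.
have c20 : 0 < c2 by exact: (rho_gt0 _ _ s2_per).
have nR0 : 0 < n%:R :> R by rewrite ltr0n.
have D0 : 0 < n%:R * (2 * (S1 + 1) + c2) by rewrite mulr_gt0 // addr_gt0 // mulr_gt0 // addr_gt0.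
(* The n terms of the sum have errors of at most (2 (S1 + 1) + c2) d each. As n is already fixed, d
   may be chosen after it. *)
pose d := Num.min 1 (e / (n%:R * (2 * (S1 + 1) + c2))).
have d0 : 0 < d by rewrite lt_min ltr01 divr_gt0.
have d1 : d <= 1 by rewrite ge_min lexx.
have dD : d * (n%:R * (2 * (S1 + 1) + c2)) <= e by rewrite -ler_pdivlMr // ge_min lexx orbT.
have [M1 P1] := rho_asymptotic_window T h1 s1_per f1_asymp d0.
have [M2 P2] := rho_asymptotic_window T h2 s2_per f2_asymp d0.
exists (Num.max M1 M2) => k x; rewrite !ge_max => /andP[k1 k2] /andP[x1 x2].
set t := k%:R * T; set y := x - t.
have kT : k.+1%:R * T = t + T by rewrite -natr1 mulrDl mul1r.
have yM : M1 <= y - T by rewrite /y; move: x1; rewrite kT opprD addrA.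
pose E1 := expR (y / p); pose E2 := expR (t / p).
have E10 : 0 < E1 by exact: expR_gt0.
have E20 : 0 < E2 by exact: expR_gt0.
have ExE : expR (- x / p) = (E1 * E2)^-1.
  by rewrite /E1 /E2 -expRD -mulrDl subrK mulNr expRN.
have ay0 := log_slow_gt0 h1 y; have at0 := log_slow_gt0 h2 t.
(* Since E1 E2 = e^(x/p), these normalizations use up the weight, and the quasi-periodicity of [rho]
   absorbs the shift t = kT: all chunks are compared with one sum over [0, T]. *)
pose X l := f1 (y - mesh T n (l + o)) / (a1 y * E1).
pose Y l := f2 (t + mesh T n l) / (a2 t * E2).
pose P l := rho1 (y - mesh T n (l + o)) / E1.
have mT l : (l <= n)%N -> 0 <= mesh T n l <= T.
  by move=> ln; rewrite mesh_ge0 // mesh_leT.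
have lo (l : 'I_n) : (l + o <= n)%N.
  by case: l => l /= ln; apply: leq_trans (leq_add (leqnn l) o1) _; rewrite addn1.
have hX (l : 'I_n) : `|X l - P l| <= d.
  have /andP[m0 mt] := mT _ (lo l).
  have := P1 y (y - mesh T n (l + o)).
  have hyz : `|y - mesh T n (l + o) - y| <= T.
    by rewrite addrAC subrr add0r normrN ger0_norm.
  move=> /(_ _ _ hyz) h; have {}h := h ltac:(lra) ltac:(lra).
  have -> : X l - P l =
     (f1 (y - mesh T n (l + o)) - a1 y * rho1 (y - mesh T n (l + o))) / (a1 y * E1).
    by rewrite /X /P; field; rewrite !gt_eqF.
  rewrite normrM normfV (gtr0_norm (mulr_gt0 ay0 E10)) ler_pdivrMr ?mulr_gt0 //.
have hY l : (l <= n)%N -> `|Y l - rho2 (mesh T n l)| <= d.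
  move=> ln; have /andP[m0 mt] := mT _ ln.
  have := P2 t (t + mesh T n l).
  have hyz : `|t + mesh T n l - t| <= T.
    by rewrite addrAC subrr add0r ger0_norm.
  move=> /(_ _ _ hyz) h; have {}h := h ltac:(lra) ltac:(lra).
  have -> : Y l - rho2 (mesh T n l) =
     (f2 (t + mesh T n l) - a2 t * rho2 (t + mesh T n l)) / (a2 t * E2).
    have -> : rho2 (t + mesh T n l) = E2 * rho2 (mesh T n l).
      by rewrite addrC /t rho_translate.
    by rewrite /Y; field; rewrite !gt_eqF.
  rewrite normrM normfV (gtr0_norm (mulr_gt0 at0 E20)) ler_pdivrMr ?mulr_gt0 //.
have PE (l : 'I_n) : P l = expR (- x / p) * rho1 (x - mesh T n (l + o)).
  rewrite /P ExE; have -> : x - mesh T n (l + o) = y - mesh T n (l + o) + k%:R * T.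
    by rewrite /y -/t addrAC subrK.
  by rewrite rho_translate // -/t -/E2; field; rewrite !gt_eqF.
have Pb (l : 'I_n) : `|P l| <= S1.
  have /andP[m0 mt] := mT _ (lo l).
  rewrite /P ger0_norm; last by rewrite divr_ge0 ?(ltW E10) // ltW // (rho_gt0 _ _ s1_per).
  rewrite ler_pdivrMr // /rho mulrC ler_pM ?expR_ge0 //.
    by have [_ s0 _] := s1_per; exact/ltW.
  by rewrite ler_expR ler_pM2r ?invr_gt0 //; lra.
have Qb (l : 'I_n) : `|rho2 (mesh T n l.+1) - rho2 (mesh T n l)| <= c2.
  have m1 : rho2 (mesh T n l) <= rho2 (mesh T n l.+1) by apply: rho2_nd; exact: mesh_le.
  have m2 : rho2 (mesh T n l.+1) <= c2 by apply: rho2_nd; exact: mesh_leT.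
  have m3 : 0 < rho2 (mesh T n l) by exact: (rho_gt0 _ _ s2_per).
  by rewrite ger0_norm; lra.
have -> : expR (- x / p) * (\sum_(l < n) f1 (y - mesh T n (l + o)) *
       (f2 (t + mesh T n l.+1) - f2 (t + mesh T n l))) -
    a1 y * a2 t * (expR (- x / p) *
      \sum_(l < n) rho1 (x - mesh T n (l + o)) *
       (rho2 (mesh T n l.+1) - rho2 (mesh T n l))) =
    a1 y * a2 t * \sum_(l < n) (X l * (Y l.+1 - Y l) -
       P l * (rho2 (mesh T n l.+1) - rho2 (mesh T n l))).
  rewrite !mulr_sumr -sumrB; apply: eq_bigr => l _.
  by rewrite PE ExE /X /Y; field; rewrite !gt_eqF.
rewrite normrM (gtr0_norm (mulr_gt0 ay0 at0)) mulrC ler_wpM2r ?(ltW (mulr_gt0 ay0 at0)) //.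
apply: (le_trans (ler_norm_sum _ _ _)).
apply: (@le_trans _ _ (\sum_(l < n) (2 * (S1 + 1) + c2) * d)); last first.
  by rewrite sumr_const card_ord -[X in X <= _]mulr_natl; move: dD; congr (_ <= _); ring.
apply: ler_sum => l _; apply: mulr_perturb => //; first exact: ltW.
have -> : Y l.+1 - Y l - (rho2 (mesh T n l.+1) - rho2 (mesh T n l)) =
   (Y l.+1 - rho2 (mesh T n l.+1)) - (Y l - rho2 (mesh T n l)) by ring.
apply: (le_trans (ler_normB _ _)); have := hY l.+1 (ltn_ord l).
by have := hY l (ltnW (ltn_ord l)); lra.
Qed.

(** The mesh size n is taken from [s_tensor_approx] before any threshold. The increments of [G x]
    over the cells add up to the chunk and lie between the terms of the two sums, both of which have
    weighted limits within e/2 of T * S x. *)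
Lemma chunk_counting e : 0 < e ->
  exists M, forall (k : nat) x, M <= k%:R * T -> M <= x - k.+1%:R * T ->
  `|expR (- x / p) * (G x (k.+1%:R * T) - G x (k%:R * T))
    - T * S x * (a1 (x - k%:R * T) * a2 (k%:R * T))|
  <= e * (a1 (x - k%:R * T) * a2 (k%:R * T)).
Proof.
move=> e0; have e20 : 0 < e / 2 by rewrite divr_gt0.
have [n n0 nP] := s_tensor_approx p_gt0 T_gt0 s1_per rho1_nd s2_per rho2_nd e20.
have [M0 P0] := @chunk_sum 0 n (e / 2) isT n0 e20.
have [M1 P1] := @chunk_sum 1 n (e / 2) isT n0 e20.
exists (Num.max M0 M1) => k x; rewrite !ge_max => /andP[k0 k1] /andP[x0 x1].
have {}P0 := P0 _ _ k0 x0; have {}P1 := P1 _ _ k1 x1; have [U L] := nP x.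
set t := k%:R * T in P0 P1 *.
have kT : k.+1%:R * T = t + T by rewrite -natr1 mulrDl mul1r.
have GE : G x (k.+1%:R * T) - G x t =
    \sum_(l < n) (G x (t + mesh T n l.+1) - G x (t + mesh T n l)).
  rewrite -(big_mkord xpredT (fun l => G x (t + mesh T n l.+1) - G x (t + mesh T n l))).
  by rewrite telescope_sumr // meshn // mesh0 addr0 kT.
have tle l : t + mesh T n l <= t + mesh T n l.+1 by rewrite lerD2l mesh_le.
set W := a1 (x - t) * a2 t in P0 P1 *.
have W0 : 0 < W by rewrite mulr_gt0 // ?(log_slow_gt0 h1) ?(log_slow_gt0 h2).
have ex0 := expR_ge0 (- x / p).
have up : expR (- x / p) * (G x (k.+1%:R * T) - G x t) <=
    expR (- x / p) * \sum_(l < n) f1 (x - t - mesh T n (l + 0)) *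
       (f2 (t + mesh T n l.+1) - f2 (t + mesh T n l)).
  rewrite ler_wpM2l // GE; apply: ler_sum => l _.
  by rewrite addn0 -addrA -opprD; apply: G_le.
have lo : expR (- x / p) * (\sum_(l < n) f1 (x - t - mesh T n (l + 1)) *
       (f2 (t + mesh T n l.+1) - f2 (t + mesh T n l))) <=
    expR (- x / p) * (G x (k.+1%:R * T) - G x t).
  rewrite ler_wpM2l // GE; apply: ler_sum => l _.
  by rewrite addn1 -addrA -opprD; apply: G_ge.
have UE : upper_sum rho1 rho2 T n x = \sum_(l < n) rho1 (x - mesh T n (l + 0)) *
       (rho2 (mesh T n l.+1) - rho2 (mesh T n l)).
  by apply: eq_bigr => l _; rewrite addn0.
have LE : lower_sum rho1 rho2 T n x = \sum_(l < n) rho1 (x - mesh T n (l + 1)) *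
       (rho2 (mesh T n l.+1) - rho2 (mesh T n l)).
  by apply: eq_bigr => l _; rewrite addn1.
rewrite -UE in P0; rewrite -LE in P1.
move: up lo P0 P1 U L; move: (expR _ * (G _ _ - _)) (expR _ * \sum_(_ < _) _)
  (expR _ * \sum_(_ < _) _) (expR _ * upper_sum _ _ _ _ _) (expR _ * lower_sum _ _ _ _ _).
move=> D u l U L Du lD; rewrite !ler_norml => /andP[u1 u2] /andP[l1 l2] /andP[U1 U2] /andP[L1 L2].
have WU : W * (U - T * S x) <= W * (e / 2) by rewrite ler_wpM2l // ltW.
have WL : W * (- (e / 2)) <= W * (L - T * S x) by rewrite ler_wpM2l // ltW.
by apply/andP; split; lra.
Qed.

Lemma chunk_integral e : 0 < e ->
  exists M, forall t x, M <= t -> M <= x - (t + T) ->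
  `|segint t (t + T) (fun u => a1 (x - u) * a2 u) - T * (a1 (x - t) * a2 t)|
  <= e * (a1 (x - t) * a2 t).
Proof.
(* Each factor of the integrand varies by at most 1 + d, their product by at most 1 + 3 d. The lower
   estimate loses 3 d E with E <= 4 T W, whence the 12. *)
move=> e0; pose d := Num.min 1 (e / (12 * T)).
have D0 : 0 < 12 * T by rewrite mulr_gt0.
have d0 : 0 < d by rewrite lt_min ltr01 divr_gt0.
have d1 : d <= 1 by rewrite ge_min lexx.
have dD : d * (12 * T) <= e by rewrite -ler_pdivlMr // ge_min lexx orbT.
have [M1 P1] := log_slow_shift h1 T d0; have [M2 P2] := log_slow_shift h2 T d0.
exists (Num.max M1 M2) => t x; rewrite !ge_max => /andP[t1 t2] /andP[x1 x2].
have T0 := T_gt0; set W := a1 (x - t) * a2 t; set E := segint _ _ _.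
have p1 := log_slow_gt0 h1; have p2 := log_slow_gt0 h2.
have W0 : 0 < W by rewrite mulr_gt0.
have ci : continuous_on t (t + T) (fun u => a1 (x - u) * a2 u).
  exact: log_conv_integrand_cont.
have cc (k : R) : continuous_on t (t + T) (fun=> k) by move=> y _; exact: cvg_cst.
have q : (1 + d) * (1 + d) <= 1 + 3 * d by nra.
have near1 u : t <= u <= t + T -> `|x - u - (x - t)| <= T /\ `|u - t| <= T.
  by move=> ?; rewrite !ler_norml; split; apply/andP; split; lra.
have up : E <= (1 + 3 * d) * W * T.
  have -> : T = t + T - t by rewrite addrAC subrr add0r.
  rewrite -segint_cst; last by lra.
  apply: ler_segint => // u utT; have [n1 n2] := near1 u utT.
  apply: (@le_trans _ _ (((1 + d) * a1 (x - t)) * ((1 + d) * a2 t))).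
    apply: ler_pM; [exact/ltW/p1|exact/ltW/p2|apply: P1 => //; lra|apply: P2 => //; lra].
  by rewrite mulrACA ler_wpM2r // ltW.
have lo : W * T <= (1 + 3 * d) * E.
  have -> : T = t + T - t by rewrite addrAC subrr add0r.
  rewrite -segint_cst; last by lra.
  rewrite /E -segintZ //.
  apply: ler_segint => //.
    by move=> y yt; apply: cvgM; [exact: cvg_cst|exact: ci].
  move=> u utT; have [n1 n2] := near1 u utT.
  apply: (@le_trans _ _ (((1 + d) * a1 (x - u)) * ((1 + d) * a2 u))).
    rewrite distrC in n1; rewrite distrC in n2.
    apply: ler_pM; [exact/ltW/p1|exact/ltW/p2|apply: P1 => //; lra|apply: P2 => //; lra].
  by rewrite mulrACA ler_wpM2r // mulr_ge0 // ltW.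
have WT : 0 < W * T by rewrite mulr_gt0.
have eW : d * (12 * T) * W <= e * W by rewrite ler_wpM2r // ltW.
have dE : 3 * d * E <= 3 * d * (4 * (W * T)).
  rewrite ler_wpM2l ?mulr_ge0 ?(ltW d0) //; apply: (le_trans up).
  by rewrite -mulrA ler_wpM2r ?(ltW WT) //; lra.
have dW : 0 <= d * (W * T) by rewrite mulr_ge0 ?(ltW d0) ?(ltW WT).
by rewrite ler_norml; apply/andP; split; lra.
Qed.

Lemma rho_asymptotic_growth a s h b : log_slow a -> continuous_positive_periodic T s ->
  rho_asymptotic a s h ->
  exists2 C, 0 <= C & exists X, forall x, X <= x -> expR (- x / p) * h (x + b) <= C * a x.
Proof.
move=> ha hs hh; have [B B0 sB] := periodic_bounded hs.
have [M MP] := rho_asymptotic_window `|b| ha hs hh ltr01.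
exists (B * expR (b / p) + 1).
  by rewrite addr_ge0 // mulr_ge0 ?expR_ge0 // ltW.
exists (M + `|b|) => x xM.
have bb := ler_norm b; have bb' := ler_norm (- b); rewrite normrN in bb'.
have a0 := log_slow_gt0 ha x.
have n0 := normr_ge0 b.
have := MP x (x + b) ltac:(lra) ltac:(lra).
rewrite addrAC subrr add0r => /(_ (lexx _)); rewrite mul1r ler_norml => /andP[_ h3].
have e0 := expR_gt0 (x / p).
rewrite mulNr expRN mulrC ler_pdivrMr //.
have hx : h (x + b) <= a x * rho p s (x + b) + a x * expR (x / p) by lra.
apply: (le_trans hx); rewrite /rho mulrDl expRD.
have : a x * (expR (x / p) * expR (b / p) * s (x + b)) <=
  a x * (expR (x / p) * expR (b / p) * B).
  by rewrite ler_wpM2l ?(ltW a0) // ler_wpM2l ?mulr_ge0 ?expR_ge0.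
by lra.
Qed.

Lemma counting_head_small a e : 0 < e ->
  exists X, forall x, X <= x -> expR (- x / p) * G x a <= e * A x.
Proof.
move=> e0; have [C C0 [X XP]] := rho_asymptotic_growth c h1 s1_per f1_asymp.
have D0 : 0 <= C * f2 a / e by rewrite divr_ge0 ?mulr_ge0 ?(ltW e0).
have [Y YP] := log_conv_dominates h1 h2 D0.
exists (Num.max X Y) => x; rewrite ge_max => /andP[/XP xX /YP [dom _]].
have /andP[_ Gx] := G_head x a.
have : e * (C * f2 a / e * a1 x) <= e * A x by rewrite ler_wpM2l // ltW.
rewrite (_ : e * (C * f2 a / e * a1 x) = C * a1 x * f2 a); last by field; rewrite gt_eqF.
apply: le_trans; apply: (le_trans (ler_wpM2l (expR_ge0 _) Gx)).
by rewrite mulrA ler_wpM2r.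
Qed.

(** The cut [a] may depend on x, because the last chunk ends at a multiple of T. As x - a <= M, the
    factor f1(x - a) is bounded by f1(M), and f2(x + c) e^(-x/p) is O(a2(x)). *)
Lemma counting_tail_small M e : 0 < e ->
  exists X, forall x a, X <= x -> x - a <= M ->
    expR (- x / p) * (f x - G x a) <= e * A x.
Proof.
move=> e0; have [C C0 [X XP]] := rho_asymptotic_growth c h2 s2_per f2_asymp.
have D0 : 0 <= C * f1 M / e by rewrite divr_ge0 ?mulr_ge0 ?(ltW e0).
have [Y YP] := log_conv_dominates h1 h2 D0.
exists (Num.max X Y) => x a; rewrite ge_max => /andP[/XP xX /YP [_ dom]] xaM.
have /andP[_ Gx] := G_tail x a.
have : e * (C * f1 M / e * a2 x) <= e * A x by rewrite ler_wpM2l // ltW.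
rewrite (_ : e * (C * f1 M / e * a2 x) = f1 M * (C * a2 x)); last by field; rewrite gt_eqF.
apply: le_trans; apply: (le_trans (ler_wpM2l (expR_ge0 _) Gx)).
rewrite mulrCA; apply: ler_pM => //; first by rewrite mulr_ge0 ?expR_ge0.
exact: f1_nd.
Qed.

(** The product a1(x - kT) a2(kT) is only an intermediary between the count and the integral. With
    the integral itself in the error bound, summing over k is immediate. *)
Lemma chunk_comparison e : 0 < e ->
  exists M, forall (k : nat) x, M <= k%:R * T -> M <= x - k.+1%:R * T ->
  `|expR (- x / p) * (G x (k.+1%:R * T) - G x (k%:R * T))
    - S x * segint (k%:R * T) (k.+1%:R * T) (fun u => a1 (x - u) * a2 u)|
  <= e * segint (k%:R * T) (k.+1%:R * T) (fun u => a1 (x - u) * a2 u).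
Proof.
move=> e0.
have Sper := s_tensor_continuous_positive_periodic p_gt0 T_gt0 s1_per rho1_nd s2_per rho2_nd.
have [Sm Sm0 SmP] := periodic_bounded Sper.
have [_ S0 _] := Sper; have T0 := T_gt0.
have Sm1 : 0 < 1 + Sm by rewrite addr_gt0.
(* h <= T/2 yields T W <= 2 E, and the total error (1 + Sm) h W is then at most e T W / 2 <= e E. *)
pose h := Num.min (T / 2) (e * T / (2 * (1 + Sm))).
have h0 : 0 < h by rewrite lt_min !divr_gt0 // ?mulr_gt0.
have hT : h <= T / 2 by rewrite ge_min lexx.
have he : h * (2 * (1 + Sm)) <= e * T.
  by rewrite -ler_pdivlMr ?mulr_gt0 // ge_min lexx orbT.
have [M1 P1] := chunk_counting h0.
have [M2 P2] := chunk_integral h0.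
exists (Num.max M1 M2) => k x; rewrite !ge_max => /andP[k1 k2] /andP[x1 x2].
have kT : k.+1%:R * T = k%:R * T + T by rewrite -natr1 mulrDl mul1r.
have := P1 _ _ k1 x1; rewrite kT in x2 *; have := P2 _ _ k2 x2.
set W := a1 _ * a2 _; set E := segint _ _ _; set D := expR _ * _.
have W0 : 0 < W by rewrite mulr_gt0 ?(log_slow_gt0 h1) ?(log_slow_gt0 h2).
move=> EW DW.
have [s0 sm] := (S0 x, SmP x).
move: W0 EW DW s0 sm; move: W E D (S x) => W E D s W0 EW DW s0 sm.
have hW : h * W <= T / 2 * W by rewrite ler_wpM2r // ltW.
have WE : T * W <= 2 * E by move: EW; rewrite ler_norml => /andP[]; lra.
have sE : `|s * (T * W - E)| <= Sm * (h * W).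
  by rewrite normrM (gtr0_norm s0) distrC; apply: ler_pM => //; exact: ltW.
have -> : D - s * E = (D - T * s * W) + s * (T * W - E) by ring.
apply: (le_trans (ler_normD _ _)).
have heW : h * (2 * (1 + Sm)) * W <= e * T * W by rewrite ler_wpM2r // ltW.
have eWE : e * (T * W) <= e * (2 * E) by rewrite ler_wpM2l // ltW.
by lra.
Qed.

Lemma convolution_asymptotic e : 0 < e ->
  exists X, forall x, X <= x ->
    `|expR (- x / p) * f x - S x * A x| <= e * A x.
Proof.
(* The end counts enter with a plus and the end integrals with a minus sign, so on either side at
   most three errors of e/4 occur together. *)
move=> e0; have e40 : 0 < e / 4 by rewrite divr_gt0.
have Sper := s_tensor_continuous_positive_periodic p_gt0 T_gt0 s1_per rho1_nd s2_per rho2_nd.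
have [Sm Sm0 SmP] := periodic_bounded Sper.
have [_ S0 _] := Sper; have T0 := T_gt0.
have eS0 : 0 < e / 4 / Sm by rewrite divr_gt0.
have [M1 P1] := chunk_comparison e40.
have [M M0 M1M] : exists2 M : R, 0 <= M & M1 <= M.
  by exists (Num.max M1 0); rewrite le_max lexx ?orbT.
pose K := (Num.truncn (M / T)).+1.
have MK : M <= K%:R * T by rewrite -ler_pdivrMr // ltW // truncnS_gt.
have KT0 : 0 <= K%:R * T by rewrite mulr_ge0 // ltW.
have MT0 : 0 <= M + T by rewrite addr_ge0 // ltW.
have [X1 Q1] := counting_head_small (K%:R * T) e40.
have [X2 Q2] := counting_tail_small (M + T) e40.
have [X3 Q3] := log_conv_head_small h1 h2 KT0 eS0.
have [X4 Q4] := log_conv_tail_small h1 h2 MT0 (lexx 0) eS0.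
exists (Num.max (Num.max X1 X2) (Num.max (Num.max X3 X4) (M + T + K%:R * T))) => x.
rewrite 4!ge_max => /andP[/andP[x1 x2] /andP[/andP[x3 x4] xK]].
have {}Q1 := Q1 _ x1; have {}Q2 := Q2 x _ x2; have {}Q3 := Q3 _ x3; have := Q4 _ x4.
rewrite addr0 => {}Q4.
(* QT is the last multiple of T not exceeding x - M. What remains has length less than M + T, which
   is why the tail estimates above were taken with M + T. *)
pose Q := Num.truncn ((x - M) / T).
have xM0 : 0 <= (x - M) / T by rewrite divr_ge0 ?(ltW T0) //; lra.
have QT : Q%:R * T <= x - M by rewrite -ler_pdivlMr // truncn_le.
have QT1 : x - M < Q%:R * T + T.
  have := truncnS_gt ((x - M) / T); rewrite ltr_pdivrMr // -/Q.
  by rewrite -natr1 mulrDl mul1r.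
have KQ : (K <= Q)%N.
  rewrite -ltnS -(ltr_nat R) -(ltr_pM2r T_gt0) -[Q.+1%:R]natr1 mulrDl mul1r; lra.
have KQT : K%:R * T <= Q%:R * T by rewrite ler_wpM2r ?ler_nat // ltW.
pose I l r := segint l r (fun u => a1 (x - u) * a2 u).
have ci l r : continuous_on l r (fun u => a1 (x - u) * a2 u).
  exact: log_conv_integrand_cont.
have I0 l r : 0 <= I l r.
  by apply: segint_ge0 => u _; rewrite mulr_ge0 // ltW // ?(log_slow_gt0 h1) ?(log_slow_gt0 h2).
have AE : A x = I 0 (K%:R * T) + I (K%:R * T) (Q%:R * T) + I (Q%:R * T) x.
  rewrite /log_conv (@segint_split _ 0 (K%:R * T) x) //; last by lra.
  by rewrite (@segint_split _ (K%:R * T) (Q%:R * T) x) ?addrA //; lra.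
have IQ : I (Q%:R * T) x <= I (x - (M + T)) x.
  rewrite [leRHS](@segint_split _ _ (Q%:R * T) x) //; last by lra.
  by rewrite lerDr; exact: I0.
have telG : G x (Q%:R * T) - G x (K%:R * T) =
    \sum_(K <= k < Q) (G x (k.+1%:R * T) - G x (k%:R * T)).
  by rewrite (telescope_sumr (fun k : nat => G x (k%:R * T))).
have telI : I (K%:R * T) (Q%:R * T) = \sum_(K <= k < Q) I (k%:R * T) (k.+1%:R * T).
  rewrite (eq_bigr (fun k : nat => I 0 (k.+1%:R * T) - I 0 (k%:R * T))); last first.
    move=> k _; rewrite /I (@segint_split _ 0 (k%:R * T) (k.+1%:R * T)) //.
      by rewrite addrAC subrr add0r.
    by rewrite mulr_ge0 ?(ltW T0) //= ler_wpM2r ?(ltW T0) // ler_nat.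
  rewrite (telescope_sumr (fun k : nat => I 0 (k%:R * T))) //.
  by rewrite /I (@segint_split _ 0 (K%:R * T) (Q%:R * T)) ?KT0 // addrAC subrr add0r.
have mid : `|expR (- x / p) * (G x (Q%:R * T) - G x (K%:R * T)) -
    S x * I (K%:R * T) (Q%:R * T)| <= e / 4 * I (K%:R * T) (Q%:R * T).
  rewrite telG telI !mulr_sumr -sumrB.
  apply: (le_trans (ler_norm_sum _ _ _)); rewrite big_nat_cond [leRHS]big_nat_cond.
  apply: ler_sum => k /andP[/andP[Kk kQ] _]; apply: P1.
    by rewrite (le_trans M1M) // (le_trans MK) // ler_wpM2r ?(ltW T0) // ler_nat.
  have : k.+1%:R * T <= Q%:R * T by rewrite ler_wpM2r ?(ltW T0) // ler_nat.
  by lra.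
have {}Q2 := Q2 (Q%:R * T) ltac:(lra).
have /andP[g1 _] := G_head x (K%:R * T); have /andP[g2 _] := G_tail x (Q%:R * T).
have eg1 := mulr_ge0 (expR_ge0 (- x / p)) g1.
have eg2 := mulr_ge0 (expR_ge0 (- x / p)) g2.
have [s0 sm] := (S0 x, SmP x).
have A0 := log_conv_ge0 h1 h2 x.
have sI1 : S x * I 0 (K%:R * T) <= e / 4 * A x.
  rewrite (_ : e / 4 * A x = Sm * (e / 4 / Sm * A x)); last by field; rewrite gt_eqF.
  by apply: ler_pM => //; exact: ltW.
have sI2 : S x * I (Q%:R * T) x <= e / 4 * A x.
  rewrite (_ : e / 4 * A x = Sm * (e / 4 / Sm * A x)); last by field; rewrite gt_eqF.
  by apply: ler_pM => //; [exact: ltW|exact: le_trans Q4].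
have sI10 : 0 <= S x * I 0 (K%:R * T) by rewrite mulr_ge0 // ltW.
have sI20 : 0 <= S x * I (Q%:R * T) x by rewrite mulr_ge0 // ltW.
have IA : e / 4 * I (K%:R * T) (Q%:R * T) <= e / 4 * A x.
  rewrite ler_wpM2l ?(ltW e40) // AE.
  by have := I0 0 (K%:R * T); have := I0 (Q%:R * T) x; lra.
have sA : S x * A x = S x * I 0 (K%:R * T) + S x * I (K%:R * T) (Q%:R * T) +
    S x * I (Q%:R * T) x by rewrite AE !mulrDr.
have ef : expR (- x / p) * f x = expR (- x / p) * G x (K%:R * T) +
    expR (- x / p) * (G x (Q%:R * T) - G x (K%:R * T)) +
    expR (- x / p) * (f x - G x (Q%:R * T)) by ring.
rewrite sA ef.
move: mid Q1 Q2 eg1 eg2 sI1 sI2 sI10 sI20 IA.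
move: (_ * (_ - _)) (_ * (f x - _)) => u1 u2.
rewrite !ler_norml => /andP[m1 m2] *; apply/andP; split; lra.
Qed.

End Asymptotics.

(** * Logarithmic coordinates *)

Section LogCoordinates.
Variable R : realType.
Implicit Types (phi : R -> R) (x y e B C : R).

Definition in_log phi x : R := phi (expR x).

Lemma regular_continuous phi y : C2_log_regular phi -> 0 < y -> {for y, continuous phi}.
Proof.
move=> [dphi _ _ _] y0; apply: differentiable_continuous; apply/derivable1_diffP.
by case: (dphi _ y0).
Qed.

Lemma in_log_continuous phi : C2_log_regular phi -> continuous (in_log phi).
Proof.
move=> hr x; apply: continuous_comp; first exact: continuous_expR.
by apply: regular_continuous => //; exact: expR_gt0.
Qed.

(** The derivative of ln phi(e^x) is y (ln phi)'(y) at y = e^x, which tends to 0. By the mean value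
    theorem ln phi(e^x) is eventually Lipschitz with constant ln(1 + e) / (|B| + 1), so shifts of
    length at most B change it by at most ln(1 + e). *)
Lemma in_log_shift phi e B : slowly_varying 0 phi -> C2_log_regular phi -> 0 < e ->
  exists M, forall x y, M <= x -> M <= y -> `|x - y| <= B ->
    in_log phi x <= (1 + e) * in_log phi y.
Proof.
move=> [_ phi0 _] [dphi _ lnphi _] e0.
have n0 : 0 < `|B| + 1 by rewrite ltr_wpDl.
have l0 : 0 < ln (1 + e) by rewrite ln_gt0 // ltrDl.
have d0 : 0 < ln (1 + e) / (`|B| + 1) by rewrite divr_gt0.
move/cvgrPdist_le : lnphi => /(_ _ d0) [M [_ MP]].
have p0 x : 0 < in_log phi x by apply: phi0; exact: expR_gt0.
pose dL y := derive1 (fun y => ln (phi y)) y.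
have dE x : is_derive x 1 (fun x => ln (in_log phi x)) (dL (expR x) * expR x).
  have ex := expR_gt0 x.
  have dp : derivable (fun y => ln (phi y)) (expR x) 1.
    have [dpx _] := dphi _ ex.
    have /@ex_derive := @is_derive1_comp _ (@ln R) phi (expR x) _ _
      (is_derive1_ln (phi0 _ ex)) (derivableP dpx).
    exact.
  have d1 : is_derive (expR x) 1 (fun y => ln (phi y)) (dL (expR x)).
    by rewrite /dL derive1E; exact/derivableP.
  exact: (@is_derive1_comp _ (fun y => ln (phi y)) (@expR R) x _ _ d1 (is_derive_expR x)).
have cL : continuous (fun x => ln (in_log phi x)).
  by move=> x; apply: differentiable_continuous; apply/derivable1_diffP; case: (dE x).
have lip x y : M < expR x -> x <= y ->
    `|ln (in_log phi y) - ln (in_log phi x)| <= ln (1 + e) / (`|B| + 1) * (y - x).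
  move=> xM xy.
  have [z zxy ->] := MVT_segment xy (fun z _ => dE z) (continuous_subspaceT cL).
  move: zxy; rewrite in_itv /= => /andP[xz zy].
  rewrite normrM (ger0_norm (_ : 0 <= y - x)) ?subr_ge0 // ler_wpM2r ?subr_ge0 //.
  have zM : M < expR z by rewrite (lt_le_trans xM) // ler_expR.
  by have := MP _ zM; rewrite sub0r normrN mulrC.
exists (ln (Num.max M 1 + 1)) => x y xM yM xyB.
have m0 : 0 < Num.max M 1 + 1 by rewrite ltr_wpDl // le_max ler01 orbT.
have mM : M < Num.max M 1 + 1 by rewrite ltr_pwDr // le_max lexx.
have big z : ln (Num.max M 1 + 1) <= z -> M < expR z.
  by rewrite -ler_expR lnK //; apply: lt_le_trans.
have : ln (in_log phi x) - ln (in_log phi y) <= ln (1 + e).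
  apply: (@le_trans _ _ (ln (1 + e) / (`|B| + 1) * `|x - y|)).
    apply: (le_trans (ler_norm _)); have [xy|yx] := leP x y.
      by rewrite (distrC (ln _)) (distrC x) (ger0_norm (_ : 0 <= y - x)) ?subr_ge0 // lip // big.
    rewrite (gtr0_norm (_ : 0 < x - y)) ?subr_gt0 // lip //; [exact: big|exact: ltW].
  rewrite -mulrA ler_piMr ?(ltW l0) // mulrC ler_pdivrMr // mul1r.
  by rewrite (le_trans xyB) // (le_trans (ler_norm _)) // lerDl.
rewrite lerBlDr -lnM ?posrE ?addr_gt0 // ler_ln ?posrE ?mulr_gt0 ?addr_gt0 //.
Qed.

Lemma in_log_segint phi K : C2_log_regular phi -> 0 <= K ->
  segint 0 K (in_log phi) = segint 1 (expR K) (fun y => phi y / y).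
Proof.
move=> hr K0.
have [| | |inc _] := @segint_subst _ 0 (expR K + 1) 0 K (@expR R) (@expR R) (fun y => phi y / y) K0.
- move=> y /andP[y0 _]; apply: cvgM; first exact: regular_continuous.
  by apply: cvgV; [rewrite gt_eqF|exact: cvg_id].
- move=> y /andP[y0 yK]; rewrite expR_gt0 /=.
  by apply: (@le_lt_trans _ _ (expR K)); rewrite ?ler_expR // ltrDl.
- by move=> y _; exact: continuous_expR.
have e1 : expR 0 <= expR K by rewrite ler_expR.
move: (inc e1); rewrite expR0 => ->; apply: eq_segint => u _.
by rewrite divfK // gt_eqF // expR_gt0.
Qed.

(** If all segment integrals were below C, monotone convergence along [1, e^n] would bound the
    infinite integral by C. *)
Lemma in_log_divergent phi C : slowly_varying 0 phi -> C2_log_regular phi ->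
  (\int[lebesgue_measure]_(x in `[1%R, +oo[) (phi x / x)%:E = +oo)%E ->
  exists2 K, 0 <= K & C <= segint 0 K (in_log phi).
Proof.
move=> [_ phi0 _] hr ioo; apply: contrapT => nK.
have bd (n : nat) : segint 1 (expR n%:R) (fun y => phi y / y) <= C.
  rewrite -in_log_segint //; rewrite leNgt; apply/negP => lt.
  by apply: nK; exists n%:R => //; exact: ltW.
have cg : forall n : nat, continuous_on 1 (expR n%:R) (fun y => phi y / y).
  move=> n y /andP[y1 _]; have y0 : 0 < y by exact: lt_le_trans y1.
  apply: cvgM; first exact: regular_continuous.
  by apply: cvgV; [rewrite gt_eqF|exact: cvg_id].
pose F (n : nat) : set R := `[1, expR n%:R]%classic.
have cF : \bigcup_n F n = `[1, +oo[%classic.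
  apply/seteqP; split=> x.
    by move=> [n _]; rewrite /F /= !in_itv /= => /andP[->].
  rewrite /= in_itv /= andbT => x1; exists (Num.truncn x).+1 => //.
  rewrite /F /= in_itv /= x1 /=; apply: (le_trans (ltW (truncnS_gt x))).
  by apply: le_trans (expR_ge1Dx _); rewrite lerDr.
have lim : (\int[lebesgue_measure]_(x in F n) (phi x / x)%:E @[n --> \oo] -->
    \int[lebesgue_measure]_(x in \bigcup_n F n) (phi x / x)%:E)%E.
  apply: ge0_nondecreasing_set_cvg_integral.
  - move=> m n mn; rewrite subsetEset /F; apply: subset_itvl.
    by rewrite bnd_simp ler_expR ler_nat.
  - by move=> n; exact: measurable_itv.
  - move=> n; apply/measurable_realfun.measurable_EFinP.
    apply: measurable_realfun.subspace_continuous_measurable_fun; first exact: measurable_itv.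
    exact: continuous_on_within (cg n).
  - move=> n x; rewrite /F /= in_itv /= => /andP[x1 _].
    have x0 : 0 < x by exact: lt_le_trans x1.
    by rewrite lee_fin divr_ge0 ?(ltW x0) // ltW // phi0.
rewrite cF ioo in lim.
have : ((+oo : \bar R) <= C%:E)%E.
  apply: cvge_le lim; apply: nearW => n.
  have int_n := continuous_on_integrable (cg n).
  rewrite -(fineK (integrable_fin_num _ int_n)) // lee_fin.
  exact: bd.
by rewrite leye_eq.
Qed.

Lemma in_log_slow phi : slowly_varying 0 phi -> C2_log_regular phi ->
  (\int[lebesgue_measure]_(x in `[1%R, +oo[) (phi x / x)%:E = +oo)%E ->
  log_slow (in_log phi).
Proof.
move=> sv hr ioo; split.
- exact: in_log_continuous.
- by move=> x; have [_ phi0 _] := sv; apply: phi0; exact: expR_gt0.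
- by move=> e B e0; exact: in_log_shift.
- by move=> C; exact: in_log_divergent.
Qed.

Lemma mellin_conv_log phi1 phi2 x : C2_log_regular phi1 -> C2_log_regular phi2 ->
  0 <= x -> mellin_conv phi1 phi2 (expR x) = log_conv (in_log phi1) (in_log phi2) x.
Proof.
move=> hr1 hr2 x0.
(* The substitution is y = e^(x - u), which gives [phi1] the argument x - u as in [log_conv]; it is
   decreasing, so the second orientation applies. *)
have [| | | |_ dec] := @segint_subst _ 0 (expR x + 1) 0 x (fun u => expR (x - u))
  (fun u => expR (x - u) * -1) (fun y => phi1 y * phi2 (expR x / y) / y) x0.
- move=> y /andP[y0 _].
  have yv : {for y, continuous (@GRing.inv R)}.
    by apply: cvgV; [rewrite gt_eqF|exact: cvg_id].
  apply: cvgM => //; apply: cvgM; first exact: regular_continuous.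
  apply: continuous_comp; first by apply: cvgM => //; exact: cvg_cst.
  by apply: regular_continuous => //; rewrite divr_gt0 // expR_gt0.
- move=> u /andP[u0 ux]; rewrite expR_gt0 /=.
  apply: (@le_lt_trans _ _ (expR x)); first by rewrite ler_expR lerBlDr lerDl.
  by rewrite ltrDl.
- move=> u _; have du : is_derive u 1 (fun u => x - u) (-1).
    by rewrite -[X in is_derive _ _ _ X]add0r; apply: is_deriveB.
  exact: (@is_derive1_comp _ (@expR R) (fun u => x - u)).
- move=> u _; apply: cvgM; last exact: cvg_cst.
  by apply: continuous_reflect; exact: continuous_expR.
have e1 : expR (x - x) <= expR (x - 0) by rewrite ler_expR lerD2l lerN2.
have := dec e1; rewrite subrr subr0 expR0 /mellin_conv -/(segint 1 _ _) => ->.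
rewrite -[LHS]mulN1r -segintZ; last first.
  move=> u _; apply: cvgM; last first.
    apply: cvgM; last exact: cvg_cst.
    by apply: continuous_reflect; exact: continuous_expR.
  have eu : {for u, continuous (fun u => expR (x - u))}.
    by apply: continuous_reflect; exact: continuous_expR.
  have ev : {for u, continuous (fun u => (expR (x - u))^-1)}.
    by apply: cvgV; rewrite ?gt_eqF ?expR_gt0.
  apply: cvgM => //; apply: cvgM.
    apply: continuous_comp => //; apply: regular_continuous => //; exact: expR_gt0.
  apply: continuous_comp; first by apply: cvgM => //; exact: cvg_cst.
  by apply: regular_continuous => //; rewrite divr_gt0 // expR_gt0.
apply: eq_segint => u _; rewrite /in_log.
have -> : expR x / expR (x - u) = expR u by rewrite -expRN -expRD opprB addrC subrK.
by field; rewrite gt_eqF // expR_gt0.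
Qed.

End LogCoordinates.

Section LogConvContinuity.
Variables (R : realType) (a1 a2 : R -> R).
Hypotheses (h1 : log_slow a1) (h2 : log_slow a2).
Local Notation A := (log_conv a1 a2).

Lemma log_conv_gt0 (x : R) : 0 < x -> 0 < A x.
Proof.
move=> x0; have ci : continuous_on 0 x (fun u => a1 (x - u) * a2 u).
  exact: log_conv_integrand_cont.
have [m _ mP] := EVT_min (ltW x0) (continuous_on_within ci).
have m0 : 0 < a1 (x - m) * a2 m by rewrite mulr_gt0 ?(log_slow_gt0 h1) ?(log_slow_gt0 h2).
apply: (@lt_le_trans _ _ (segint 0 x (fun=> a1 (x - m) * a2 m))).
  by rewrite segint_cst ?(ltW x0) // subr0 mulr_gt0.
by apply: ler_segint => // y _; exact: cvg_cst.
Qed.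

(** Both the domain and the integrand move with the argument: the added piece is at most C1 C2 (z -
    y), and on [0, y] the change is controlled by uniform continuity of [a1]. *)
Lemma log_conv_uniform (B e : R) : 0 < B -> 0 < e -> exists2 d, 0 < d &
  forall y z, 0 <= y -> y <= z -> z <= B -> z - y < d -> `|A z - A y| <= e.
Proof.
move=> B0 e0.
have [C1 C10 C1P] := @log_slow_bounded _ a1 0 B h1.
have [C2 C20 C2P] := @log_slow_bounded _ a2 0 B h2.
have D0 : 0 < C2 * B by rewrite mulr_gt0.
have E0 : 0 < C1 * C2 by rewrite mulr_gt0.
have e20 : 0 < e / 2 by rewrite divr_gt0.
have [d d0 dP] := heine_segment 0 B (log_slow_cont h1) (divr_gt0 e20 D0).
exists (Num.min d (e / 2 / (C1 * C2))); first by rewrite lt_min d0 !divr_gt0.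
move=> y z y0 yz zB; rewrite lt_min => /andP[zyd zye].
have ci x l r : continuous_on l r (fun u => a1 (x - u) * a2 u).
  exact: log_conv_integrand_cont.
have cu w : continuous (fun u => a1 (w - u) * a2 u).
  by move=> u; apply: (ci w u u); rewrite lexx.
have p1 u := ltW (log_slow_gt0 h1 u); have p2 u := ltW (log_slow_gt0 h2 u).
rewrite /log_conv (@segint_split _ 0 y z) ?y0 //.
have cc (k : R) l r : continuous_on l r (fun=> k) by move=> u _; exact: cvg_cst.
have t1 : segint y z (fun u => a1 (z - u) * a2 u) <= e / 2.
  apply: (@le_trans _ _ (segint y z (fun=> C1 * C2))).
    apply: ler_segint => // u /andP[yu uz].
    by apply: ler_pM => //; [apply: C1P; lra|apply: C2P; lra].
  by rewrite segint_cst // mulrC -ler_pdivlMr // ltW.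
have t10 : 0 <= segint y z (fun u => a1 (z - u) * a2 u).
  by apply: segint_ge0 => u _; exact: mulr_ge0.
have diff u : 0 <= u <= y -> `|a1 (z - u) * a2 u - a1 (y - u) * a2 u| <= e / 2 / B.
  move=> /andP[u0 uy]; rewrite -mulrBl normrM (ger0_norm (p2 u)).
  have da : `|a1 (z - u) - a1 (y - u)| <= e / 2 / (C2 * B).
    apply/ltW/dP; first by apply/andP; split; lra.
    by rewrite opprB addrA subrK ger0_norm // subr_ge0.
  have a2u : a2 u <= C2 by apply: C2P; lra.
  have -> : e / 2 / B = e / 2 / (C2 * B) * C2 by field; rewrite !gt_eqF.
  exact: ler_pM.
have yB : e / 2 / B * y <= e / 2.
  by rewrite mulrAC ler_pdivrMr // ler_pM2l ?divr_gt0 //; lra.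
have t2 : `|segint 0 y (fun u => a1 (z - u) * a2 u) -
    segint 0 y (fun u => a1 (y - u) * a2 u)| <= e / 2.
  rewrite -segintB // ler_norml; apply/andP; split.
    apply: (@le_trans _ _ (segint 0 y (fun=> - (e / 2 / B)))).
      by rewrite segint_cst // subr0 mulNr lerN2.
    apply: ler_segint => //.
      by move=> u uy; apply: cvgB; exact: cu.
    by move=> u uy; have := diff u uy; rewrite ler_norml => /andP[].
  apply: (@le_trans _ _ (segint 0 y (fun=> e / 2 / B))); last by rewrite segint_cst // subr0.
  apply: ler_segint => //.
    by move=> u uy; apply: cvgB; exact: cu.
  by move=> u uy; have := diff u uy; rewrite ler_norml => /andP[].
by move: t2; rewrite !ler_norml => /andP[? ?]; apply/andP; split; lra.
Qed.

Lemma log_conv_continuous (x : R) : 0 < x -> {for x, continuous A}.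
Proof.
move=> x0; apply/cvgrPdist_le => e e0.
have x10 : 0 < x + 1 by rewrite addr_gt0.
have [d d0 dP] := log_conv_uniform x10 e0.
apply/nbhs_ballP; exists (Num.min d (Num.min 1 x)); first by rewrite /= !lt_min d0 ltr01.
move=> y; rewrite /ball /= !lt_min => /and3P[xyd xy1 xyx].
move: xyd xy1 xyx; rewrite !ltr_norml => /andP[? ?] /andP[? ?] /andP[? ?].
have [xy|yx] := leP x y.
  by rewrite distrC; apply: dP; lra.
by apply: dP; lra.
Qed.

End LogConvContinuity.

Section Mellin.
Variables (R : realType) (phi1 phi2 : R -> R).
Hypotheses (hr1 : C2_log_regular phi1) (hr2 : C2_log_regular phi2)
  (h1 : log_slow (in_log phi1)) (h2 : log_slow (in_log phi2)).
Local Notation A := (log_conv (in_log phi1) (in_log phi2)).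

Lemma mellin_convE (y : R) : 1 <= y -> mellin_conv phi1 phi2 y = A (ln y).
Proof.
move=> y1; have y0 : 0 < y by exact: lt_le_trans y1.
by rewrite -mellin_conv_log ?lnK // ln_ge0.
Qed.

(** The threshold is 1 because the convolution integrates over [1, y], so it is positive only for y
    > 1. *)
Lemma mellin_conv_slowly_varying : slowly_varying 1 (mellin_conv phi1 phi2).
Proof.
split.
- apply: measurable_realfun.open_continuous_measurable_fun; first exact: interval_open.
  move=> y; rewrite inE /= in_itv /= andbT => y1.
  have y0 : 0 < y by exact: lt_trans y1.
  have cA : {for y, continuous (A \o @ln R)}.
    apply: continuous_comp; first exact: continuous_ln.
    by apply: log_conv_continuous => //; rewrite ln_gt0.
  rewrite /continuous_at mellin_convE ?(ltW y1) //.
  apply: cvg_trans cA; apply: near_eq_cvg; near=> z.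
  rewrite /= mellin_convE //; near: z.
  apply/nbhs_ballP; exists (y - 1) => /=; first by rewrite subr_gt0.
  by move=> z; rewrite /ball /= ltr_norml => /andP[? ?]; lra.
- move=> y y1; rewrite mellin_convE ?(ltW y1) //; apply: log_conv_gt0 => //.
  by rewrite ln_gt0.
- move=> c c0; apply/cvgrPdist_le => e e0.
  have [X XP] := log_conv_slow h1 h2 (ln c) e0.
  near=> x.
  have x1 : 1 < x by near: x; apply: nbhs_pinfty_gt; exact: num_real.
  have cx1 : 1 < c * x.
    rewrite mulrC -ltr_pdivrMr //; near: x; apply: nbhs_pinfty_gt; exact: num_real.
  have xX : X <= ln x.
    have ex : expR X < x by near: x; apply: nbhs_pinfty_gt; exact: num_real.
    have x0 : 0 < x by exact: lt_trans x1.
    by rewrite -ler_expR lnK // ltW.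
  have x0 : 0 < x by exact: lt_trans x1.
  rewrite !mellin_convE ?(ltW x1) ?(ltW cx1) // lnM ?posrE // [ln c + _]addrC.
  have [u v] := XP _ xX.
  have p : 0 < A (ln x) by apply: log_conv_gt0 => //; rewrite ln_gt0.
  rewrite distrC ler_norml lerBlDr ler_pdivrMr // [e + 1]addrC u andbT.
  rewrite lerBrDr ler_pdivlMr //.
  have q : 0 <= A (ln x + ln c) by exact: log_conv_ge0.
  have [le|lt] := leP (A (ln x)) (A (ln x + ln c)).
    apply: le_trans le; rewrite ler_piMl ?(ltW p) //; lra.
  have : e * A (ln x + ln c) <= e * A (ln x) by rewrite ler_wpM2l ?(ltW e0) // ltW.
  by lra.
Unshelve. all: by end_near. Qed.

End Mellin.

(** * Spectral asymptotics as t tends to 0 *)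

Section AtZero.
Variable R : realType.

Lemma near_zero_expR (P : R -> Prop) :
  (\forall t \near (0 : R)^'+, P t) <-> exists X, forall x, X <= x -> P (expR (- x)).
Proof.
split=> [[d /= d0 dP]|[X XP]].
  exists (- ln d + 1) => x xX; apply: dP; last exact: expR_gt0.
  rewrite /ball_ /= sub0r normrN gtr0_norm ?expR_gt0 // -[ltRHS]lnK // ltr_expR.
  by rewrite ltrNl (lt_le_trans _ xX) // ltrDl.
exists (expR (- X)) => /=; first exact: expR_gt0.
move=> t; rewrite /ball_ /= sub0r normrN => tX t0.
rewrite gtr0_norm // in tX; rewrite -[t]lnK // -[ln t]opprK; apply: XP.
by rewrite lerNr -ler_expR lnK // ltW.
Qed.

Lemma spectral_densityE (p : R) phi s x :
  spectral_density p phi s (expR (- x)) = phi (expR x) * s x * expR (x / p).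
Proof.
rewrite /spectral_density expRN invrK expRK; congr (_ * _).
rewrite /powR gt_eqF ?invr_gt0 ?expR_gt0 // lnV ?posrE ?expR_gt0 //.
rewrite expRK mulrN expRN invrK.
by rewrite mulrC.
Qed.

Variables (K : scalars R) (H : hilbert K) (A : H -> H) (p T : R) (phi s : R -> R).
Hypotheses (T_gt0 : 0 < T) (phi_gt0 : forall x, 0 < x -> 0 < phi x)
  (s_per : continuous_positive_periodic T s)
  (A_asymp : counting_function A ~_((0 : R)^'+) spectral_density p phi s).

Lemma counting_function_rho_asymptotic :
  rho_asymptotic p (in_log phi) s (fun x => counting_function A (expR (- x))).
Proof.
move=> e e0; have [S S0 SP] := periodic_bounded T_gt0 s_per.
have eS : 0 < e / S by rewrite divr_gt0.
have /eqaddoP /(_ _ eS) := A_asymp; rewrite near_zero_expR => -[X XP].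
exists X => x /XP; rewrite /= !fctE spectral_densityE.
have px : 0 < phi (expR x) by apply: phi_gt0; exact: expR_gt0.
have ex := expR_gt0 (x / p); have [_ s0 _] := s_per.
rewrite (_ : _ * s x * _ = in_log phi x * rho p s x); last by rewrite /in_log /rho; ring.
move=> h; apply: (le_trans h).
have r0 : 0 < in_log phi x * rho p s x by rewrite mulr_gt0 ?(rho_gt0 p x s_per).
rewrite gtr0_norm //.
have -> : e * (in_log phi x * expR (x / p)) = e / S * (in_log phi x * (expR (x / p) * S)).
  by field; rewrite gt_eqF.
by rewrite ler_wpM2l ?(ltW eS) // ler_wpM2l ?(ltW px) // /rho ler_wpM2l ?(ltW ex).
Qed.

Lemma counting_function_gt0_near : exists X, forall x, X <= x ->
  0 < counting_function A (expR (- x)).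
Proof.
have e2 : (0 : R) < 1 / 2 by rewrite divr_gt0.
have /eqaddoP /(_ _ e2) := A_asymp; rewrite near_zero_expR => -[X XP].
exists X => x /XP; rewrite /= !fctE spectral_densityE.
have px : 0 < phi (expR x) by apply: phi_gt0; exact: expR_gt0.
have ex := expR_gt0 (x / p); have [_ s0 _] := s_per.
have r0 : 0 < phi (expR x) * s x * expR (x / p) by rewrite !mulr_gt0.
rewrite (gtr0_norm r0) ler_norml => /andP[lo _]; lra.
Qed.

(** [fset_set] of an infinite set is empty, so a positive count at a level e^(-x) <= t proves that
    level set finite, and it contains the one of t. *)
Lemma eigenvalue_level_finite t : 0 < t -> finite_set [set n | t < eigenvalues A n].
Proof.
move=> t0; have [X XP] := counting_function_gt0_near.
pose x := Num.max X (- ln t).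
have xX : X <= x by rewrite le_max lexx.
have xt : expR (- x) <= t.
  by rewrite -[leRHS]lnK // ler_expR lerNl le_max lexx orbT.
have := XP _ xX; rewrite /counting_function /fset_set.
case: pselect => [fin _|_]; last by rewrite cardfs0 ltxx.
by apply: sub_finite_set fin => n /=; exact: le_lt_trans.
Qed.

(* Without an enumeration [eigenvalues A] would be the null sequence, and an
   infinite level set would have [fset_set] equal to [fset0]: in both cases the
   counting function would vanish near 0, against its asymptotics. *)
Lemma eigenvaluesP : enumerates_eigenvalues A (eigenvalues A).
Proof.
rewrite /eigenvalues; case: xgetP => // nex.
have [X XP] := counting_function_gt0_near; have := XP X (lexx X).
rewrite /counting_function.
have -> : [set n | expR (- X) < eigenvalues A n] = set0.
  apply/seteqP; split=> // n /=; rewrite /eigenvalues.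
  by case: xgetP => [l -> /= /nex //|_]; rewrite ltNge expR_ge0.
by rewrite fset_set0 cardfs0 ltxx.
Qed.

End AtZero.

Theorem theorem3 (R : realType) (K : scalars R)
  (H1 H2 : hilbert K) (H : hilbert_tensor H1 H2)
  (A1 : {linear H1 -> H1}) (A2 : {linear H2 -> H2}) (A : {linear H -> H})
  (p T : R) (phi1 phi2 s1 s2 : R -> R)
  (A1_compact : compact_operator A1) (A1_nonneg : nonneg_self_adjoint A1)
  (A2_compact : compact_operator A2) (A2_nonneg : nonneg_self_adjoint A2)
  (A_tensor : tensor_operator A1 A2 A)
  (p_gt0 : 0 < p) (T_gt0 : 0 < T)
  (phi1_sv : slowly_varying 0 phi1) (phi1_reg : C2_log_regular phi1)
  (phi2_sv : slowly_varying 0 phi2) (phi2_reg : C2_log_regular phi2)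
  (s1_per : continuous_positive_periodic T s1)
  (rho1_nd : nondecreasing (rho p s1))
  (s2_per : continuous_positive_periodic T s2)
  (rho2_nd : nondecreasing (rho p s2))
  (A1_asymp :
    counting_function A1 ~_((0 : R)^'+) spectral_density p phi1 s1)
  (A2_asymp :
    counting_function A2 ~_((0 : R)^'+) spectral_density p phi2 s2)
  (phi1_int :
    (\int[lebesgue_measure]_(x in `[1%R, +oo[) (phi1 x / x)%:E = +oo)%E)
  (phi2_int :
    (\int[lebesgue_measure]_(x in `[1%R, +oo[) (phi2 x / x)%:E = +oo)%E) :
  [/\ counting_function A ~_((0 : R)^'+)
        spectral_density p (mellin_conv phi1 phi2) (s_tensor p T s1 s2),
      slowly_varying 1 (mellin_conv phi1 phi2),
      forall x, derivable (periodic_conv T s1 s2) x 1,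
      forall x, s_tensor p T s1 s2 x =
        expR (- x / p) * (T^-1 *
          \int[lebesgue_stieltjes_measure (rho_cumulative s2_per rho2_nd)]_(y in `[0, T])
             rho p s1 (x - y)) &
      continuous_positive_periodic T (s_tensor p T s1 s2)].
Proof.
have h1 := in_log_slow phi1_sv phi1_reg phi1_int.
have h2 := in_log_slow phi2_sv phi2_reg phi2_int.
have [[_ phi1_gt0 _] [_ phi2_gt0 _]] := (phi1_sv, phi2_sv).
have S_per := s_tensor_continuous_positive_periodic p_gt0 T_gt0 s1_per rho1_nd s2_per rho2_nd.
split; last 4 first.
- exact: mellin_conv_slowly_varying.
- by move=> x; case: (is_derive_periodic_conv T_gt0 s1_per rho1_nd s2_per rho2_nd x).
- exact: s_tensorE.
- exact: S_per.
have lamP := eigenvaluesP phi1_gt0 s1_per A1_asymp.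
have muP := eigenvaluesP phi2_gt0 s2_per A2_asymp.
have lam_fin := eigenvalue_level_finite phi1_gt0 s1_per A1_asymp.
have mu_fin := eigenvalue_level_finite phi2_gt0 s2_per A2_asymp.
have f1_asymp := counting_function_rho_asymptotic T_gt0 phi1_gt0 s1_per A1_asymp.
have f2_asymp := counting_function_rho_asymptotic T_gt0 phi2_gt0 s2_per A2_asymp.
have prod_fin := finite_product_level lamP muP lam_fin mu_fin.
have [lam0 lamd _] := lamP; have [mu0 mud _] := muP.
have [c [G [G1 G2 G3 G4]]] := product_counting_split lam0 mu0
  (fun n => lamd 0%N n isT) (fun n => mud 0%N n isT) lam_fin mu_fin prod_fin.
have f1_nd : nondecreasing (fun x => counting_function A1 (expR (- x))).
  move=> x y xy; apply: ler_cardr; first by apply: lam_fin; exact: expR_gt0.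
  by move=> n /=; apply: le_lt_trans; rewrite ler_expR lerN2.
have f1_ge0 x : 0 <= counting_function A1 (expR (- x)) by exact: ler0n.
have f2_ge0 x : 0 <= counting_function A2 (expR (- x)) by exact: ler0n.
have main := convolution_asymptotic p_gt0 T_gt0 s1_per rho1_nd s2_per rho2_nd h1 h2
  f1_asymp f2_asymp f1_nd f1_ge0 f2_ge0 G1 G2 G3 G4.
(* The error e m A x is relative to the convolution only; the lower bound m of [s_tensor] makes it
   relative to the full density. *)
have [m m0 mP] := periodic_lower_bound T_gt0 S_per.
apply/eqaddoP => e e0; have em0 : 0 < e * m by rewrite mulr_gt0.
apply/near_zero_expR; have [X XP] := main _ em0.
exists (Num.max X 0) => x; rewrite ge_max => /andP[/XP xX x0].
rewrite /= !fctE spectral_densityE mellin_conv_log //.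
rewrite (counting_function_tensor A1_compact A1_nonneg A2_compact A2_nonneg A_tensor
  lamP muP lam_fin mu_fin) ?expR_gt0 //.
have A0 := log_conv_ge0 h1 h2 x; have ex := expR_gt0 (x / p).
have [_ S0 _] := S_per.
move: xX; rewrite /cardr; set N := #|` _|%:R => xX.
have -> : N - log_conv (in_log phi1) (in_log phi2) x * s_tensor p T s1 s2 x * expR (x / p) =
  expR (x / p) * (expR (- x / p) * N -
    s_tensor p T s1 s2 x * log_conv (in_log phi1) (in_log phi2) x).
  by rewrite mulNr expRN; field; rewrite gt_eqF.
rewrite normrM (gtr0_norm ex) (ger0_norm (mulr_ge0 (mulr_ge0 A0 (ltW (S0 x))) (ltW ex))).
apply: (le_trans (ler_wpM2l (ltW ex) xX)).
have := ler_wpM2l (ltW e0) (ler_wpM2l (mulr_ge0 (ltW ex) A0) (mP x)).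
by congr (_ <= _); ring.
Qed.
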